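(* Let $M$ be a real smooth $n$-dimensional manifold, let $L:T^2M\to\mathbb{R}$ be a regular second order Lagrangian and let $S$ be its associated semispray. There exists a unique nonlinear connection $N$ on $T^2M$ such that: (1) $\omega_L^2(hX,v_1Y)=2g^c(hX,v_1Y)$ for all vector fields $X,Y$ on $T^2M$; (2) $\nabla^2g=0$ and $d_h\theta_L^2=0$.
   Context: $T^2M$ is the second order tangent bundle (2-jets at $0$ of curves in $M$). A chart $(x^i)$ on $M$ induces coordinates $(x^i,y^{(1)i},y^{(2)i})$ on $T^2M$ by $y^{(\alpha)i}(j^2_0\rho)=\frac{1}{\alpha!}\frac{d^\alpha(x^i\circ\rho)}{dt^\alpha}\big|_{t=0}$, $\alpha=1,2$. All objects are smooth; the summation convention is used; $(\alpha\wedge\beta)(X,Y)=\alpha(X)\beta(Y)-\alpha(Y)\beta(X)$ for one-forms. Tangent structure: $J=\frac{\partial}{\partial y^{(1)i}}\otimes dx^i+\frac{\partial}{\partial y^{(2)i}}\otimes dy^{(1)i}$. Vertical distributions: $V_1=\mathrm{Im}\,J=\ker J^2$, $V_2=\mathrm{Im}\,J^2=\ker J$. A semispray is a global vector field $S$ on $T^2M$ with $JS=y^{(1)i}\frac{\partial}{\partial y^{(1)i}}+2y^{(2)i}\frac{\partial}{\partial y^{(2)i}}$. $L$ is regular if the matrix $g_{ij}=\frac12\frac{\partial^2L}{\partial y^{(2)i}\partial y^{(2)j}}$ (the metric tensor) has rank $n$ everywhere. Put $\theta_L^1=dL\circ J=\frac{\partial L}{\partial y^{(1)i}}dx^i+\frac{\partial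 L}{\partial y^{(2)i}}dy^{(1)i}$, $\theta_L^2=dL\circ J^2=\frac{\partial L}{\partial y^{(2)i}}dx^i$, $\omega_L^2=d\theta_L^2$. The associated semispray of $L$ is the unique semispray $S$ with $\mathcal{L}_S\theta_L^2=\theta_L^1$. A nonlinear connection is a regular distribution $N$ on $T^2M$ with $T_uT^2M=N(u)\oplus V_1(u)$ for all $u$. With $N_1=J(N)$ one has $TT^2M=N\oplus N_1\oplus V_2$; $h,v_1,v_2$ denote the corresponding projectors onto $N,N_1,V_2$. The local coefficients $\underset{(1)}{N}{}^j_i,\underset{(2)}{N}{}^j_i$ of $N$ are defined by requiring that $N$ be spanned by $$\frac{\delta}{\delta x^i}=\frac{\partial}{\partial x^i}-\underset{(1)}{N}{}^j_i\frac{\partial}{\partial y^{(1)j}}-\underset{(2)}{N}{}^j_i\frac{\partial}{\partial y^{(2)j}}.$$ The second order dynamical covariant derivative $\nabla^2g$ of the metric tensor (induced by $S$ and $N$) is the tensor with components $$\nabla^2g_{ij}=S^2(g_{ij})-2\underset{(1)}{N}{}^k_iS(g_{kj})-2\underset{(1)}{N}{}^k_jS(g_{ik})-2\underset{(2)}{N}{}^k_ig_{kj}-2\underset{(2)}{N}{}^k_jg_{ik}+2g_{mk}\underset{(1)}{N}{}^k_j\underset{(1)}{N}{}^m_i,$$ and $\nabla^2 g=0$ means that all these components vanish in every induced chart. The metric structure $g^c$ on $T^2M$ is the globally defined symmetric tensor $$g^c=g_{ij}\left(dx^i\otimes dy^{(2)j}+dy^{(1)i}\otimes dy^{(1)j}+dy^{(2)i}\otimes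 dx^j\right)+S(g_{ij})\left(dx^i\otimes dy^{(1)j}+dy^{(1)i}\otimes dx^j\right)+\tfrac12S^2(g_{ij})\,dx^i\otimes dx^j.$$ The condition $d_h\theta_L^2=0$ means $\omega_L^2(hX,hY)=0$ for all vector fields $X,Y$ on $T^2M$. *)

(* Defs.v *)
From HB Require Import structures.
From mathcomp Require Import all_boot all_order all_algebra.
From mathcomp Require Import all_classical all_reals all_analysis.

Set Implicit Arguments.
Unset Strict Implicit.
Unset Printing Implicit Defensive.

Import Order.TTheory GRing.Theory Num.Theory.
Import numFieldNormedType.Exports.

Local Open Scope classical_set_scope.
Local Open Scope ring_scope.

Section Smooth.
Context {R : realType} {V W : normedModType R}.

(* Vectorwise form of "C^(k+1) iff differentiable with a C^k differential";
   it is meant for finite-dimensional V and open U. *)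
Fixpoint Ck_on (k : nat) (U : set V) (f : V -> W) : Prop :=
  match k with
  | 0 => forall x, U x -> {for x, continuous f}
  | k'.+1 => (forall x, U x -> differentiable f x) /\
             forall v : V, Ck_on k' U ('D_v f)
  end.

Definition smooth_on (U : set V) (f : V -> W) := forall k, Ck_on k U f.

End Smooth.

Section Manifold.
Variables (R : realType) (n : nat).

(* [cmap] and [cinv] are total functions; their values outside [cdom] and
   [cmap @` cdom] respectively are irrelevant. *)
Record chart (M : topologicalType) := Chart {
  cdom : set M;
  cmap : M -> 'rV[R]_n;
  cinv : 'rV[R]_n -> M;
  cdom_open : open cdom;
  cimg_open : open (cmap @` cdom);
  cmapK : forall p, cdom p -> cinv (cmap p) = p;
  cmap_continuous : {within cdom, continuous cmap};
  cinv_continuous : {within cmap @` cdom, continuous cinv} }.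

Definition smooth_transition (M : topologicalType) (c d : chart M) :=
  smooth_on (cmap c @` (cdom c `&` cdom d)) (cmap d \o cinv c).

Record smoothManifold := SmoothManifold {
  carrier :> topologicalType;
  atlas : set (chart carrier);
  carrier_hausdorff : hausdorff_space carrier;
  carrier_second_countable : @second_countable carrier;
  atlas_cover : forall p, exists2 c, atlas c & cdom c p;
  atlas_compatible : forall c d, atlas c -> atlas d -> smooth_transition c d;
  atlas_maximal : forall c,
    (forall d, atlas d -> smooth_transition c d /\ smooth_transition d c) ->
    atlas c }.

Definition mchart (M : smoothManifold) := {c : chart M | atlas c}.
Coercion chart_of_mchart (M : smoothManifold) (c : mchart M) : chart M :=
  sval c.

End Manifold.

Section SecondOrderTangentBundle.
Context {R : realType} {n : nat} {M : smoothManifold R n}.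
Implicit Types (c d : mchart M) (rho sigma : R -> M).

(* Only the germ at 0 matters. *)
Definition smooth_curve rho := forall c, cdom c (rho 0) ->
  exists2 e : R, 0 < e &
    (forall t, `|t| < e -> cdom c (rho t)) /\
    smooth_on [set t : R^o | `|t| < e] (cmap c \o rho).

Definition same_jet2 rho sigma := rho 0 = sigma 0 /\
  forall c, cdom c (rho 0) -> forall k, (k <= 2)%N ->
    ((cmap c \o rho)^`(k) 0 = (cmap c \o sigma)^`(k) 0)%classic.

(* The points of T^2M are the equivalence classes for [same_jet2]. *)
Record jet2 := Jet2 {
  jet2_class : set (R -> M);
  jet2_classP : exists2 rho, smooth_curve rho &
    jet2_class = [set sigma | smooth_curve sigma /\ same_jet2 rho sigma] }.

Definition jet2_curve (u : jet2) : R -> M := projT1 (cid2 (jet2_classP u)).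

(* The induced chart of T^2M.  The coordinates (x, y^(1), y^(2)) of a jet are
   the rows 0, 1, 2 of a 3 x n matrix. *)
Definition tdom c : set jet2 := [set u | cdom c (jet2_curve u 0)].

Definition tcoord c (u : jet2) : 'M[R]_(3, n) :=
  \matrix_(k, i) ((k`!%:R)^-1 * ((cmap c \o jet2_curve u)^`(k) 0)%classic 0 i).

Definition timg c : set 'M[R]_(3, n) := tcoord c @` tdom c.

(* The expression of F : T^2M -> E in the chart induced by c, namely
   F \o (tcoord c)^-1 on [timg c] (and 0 elsewhere). *)
Definition inchart (E : zmodType) c (F : jet2 -> E) (z : 'M[R]_(3, n)) : E :=
  xget 0 [set F u | u in tdom c `&` tcoord c @^-1` [set z]].

Definition smooth_fun (F : jet2 -> R) :=
  forall c, smooth_on (timg c) (inchart c F : 'M[R]_(3, n) -> R^o).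

(* A tangent vector of T^2M at u is the family of its components in all the
   induced charts at u; the remaining components are set to 0, so that equal
   vectors are equal families. *)
Definition tvector := mchart M -> 'M[R]_(3, n).

Definition tangent (u : jet2) : set tvector := [set v |
  (forall c d, tdom c u -> tdom d u ->
     v d = 'd (inchart c (tcoord d)) (tcoord c u) (v c)) /\
  (forall c, ~ tdom c u -> v c = 0)].

Definition vector_field (X : jet2 -> tvector) :=
  (forall u, tangent u (X u)) /\
  forall c, smooth_on (timg c) (inchart c (X ^~ c)).

(* The coordinate vector d/dx^i, d/dy^(1)i or d/dy^(2)i for k = 0, 1, 2.
   Dually, dx^i, dy^(1)i, dy^(2)i take the values xi 0 i, xi 1 i, xi 2 i
   on a vector xi. *)
Definition partial (k : 'I_3) (i : 'I_n) : 'M[R]_(3, n) := delta_mx k i.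

Definition Jmx (xi : 'M[R]_(3, n)) : 'M[R]_(3, n) :=
  \sum_i (xi 0 i *: partial 1 i + xi 1 i *: partial 2 i).

Definition J (v : tvector) : tvector := fun c => Jmx (v c).

Definition V1 (u : jet2) : set tvector := J @` tangent u.
Definition V2 (u : jet2) : set tvector := (J \o J) @` tangent u.

Definition semispray (S : jet2 -> tvector) := vector_field S /\
  forall c u, tdom c u ->
    J (S u) c = \sum_i (tcoord c u 1 i *: partial 1 i +
                        2 * tcoord c u 2 i *: partial 2 i).

(* A one-form on an open subset of R^(3n) is a function theta with theta z xi
   linear in xi.  In both definitions below the vectors xi and eta are
   extended to constant vector fields. *)
Definition exterior_derivative (theta : 'M[R]_(3, n) -> 'M[R]_(3, n) -> R)
    (z xi eta : 'M[R]_(3, n)) : R :=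
  'D_xi (theta ^~ eta : _ -> R^o) z - 'D_eta (theta ^~ xi : _ -> R^o) z.

Definition lie_derivative (S : 'M[R]_(3, n) -> 'M[R]_(3, n))
    (theta : 'M[R]_(3, n) -> 'M[R]_(3, n) -> R) (z eta : 'M[R]_(3, n)) : R :=
  'D_(S z) (theta ^~ eta : _ -> R^o) z + theta z ('D_eta S z).

Section Lagrangian.
Variable L : jet2 -> R.

Definition Lc c : 'M[R]_(3, n) -> R^o := inchart c L.

Definition metric c (z : 'M[R]_(3, n)) : 'M[R]_n :=
  \matrix_(i, j) (2^-1 * 'D_(partial 2 i) ('D_(partial 2 j) (Lc c)) z).

Definition regular_lagrangian :=
  smooth_fun L /\ forall c z, timg c z -> \rank (metric c z) = n.

Definition theta1 c (z xi : 'M[R]_(3, n)) : R := 'd (Lc c) z (Jmx xi).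
Definition theta2 c (z xi : 'M[R]_(3, n)) : R := 'd (Lc c) z (Jmx (Jmx xi)).
Definition omega2 c := exterior_derivative (theta2 c).

Definition associated_semispray (S : jet2 -> tvector) := semispray S /\
  forall c z, timg c z -> forall eta,
    lie_derivative (inchart c (S ^~ c)) (theta2 c) z eta = theta1 c z eta.

Section Semispray.
Variable S : jet2 -> tvector.

Definition along c (f : 'M[R]_(3, n) -> R^o) : 'M[R]_(3, n) -> R^o :=
  fun z => 'D_(inchart c (S ^~ c) z) f z.

Definition g c i j : 'M[R]_(3, n) -> R^o := fun z => metric c z i j.
Definition Sg c i j := along c (g c i j).
Definition SSg c i j := along c (Sg c i j).

Definition gc c (z xi eta : 'M[R]_(3, n)) : R :=
  \sum_i \sum_j
    (g c i j z * (xi 0 i * eta 2 j + xi 1 i * eta 1 j + xi 2 i * eta 0 j)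
     + Sg c i j z * (xi 0 i * eta 1 j + xi 1 i * eta 0 j)
     + 2^-1 * SSg c i j z * (xi 0 i * eta 0 j)).

(* N1 and N2 are the matrices of local coefficients, with the upper index as
   row index. *)
Definition nabla2g c (z : 'M[R]_(3, n)) (N1 N2 : 'M[R]_n) (i j : 'I_n) : R :=
  SSg c i j z
  - 2 * \sum_k N1 k i * Sg c k j z - 2 * \sum_k N1 k j * Sg c i k z
  - 2 * \sum_k N2 k i * g c k j z - 2 * \sum_k N2 k j * g c i k z
  + 2 * \sum_m \sum_k g c m k z * N1 k j * N1 m i.

End Semispray.
End Lagrangian.

Section NonlinearConnection.
Variable N : jet2 -> set tvector.

(* Smooth distribution of constant rank: N has a smooth local frame, written
   here in induced coordinates, around every point. *)
Definition regular_distribution := (forall u, N u `<=` tangent u) /\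
  exists k : nat, forall u0, exists2 c, tdom c u0 &
  exists2 U : set 'M[R]_(3, n),
    [/\ open U, U (tcoord c u0) & U `<=` timg c] &
  exists2 E : 'I_k -> 'M[R]_(3, n) -> 'M[R]_(3, n),
    forall i, smooth_on U (E i) &
  forall u, tdom c u -> U (tcoord c u) ->
    let frame := [seq E i (tcoord c u) | i : 'I_k] in
    free frame /\
    forall v, tangent u v -> (N u v <-> v c \in <<frame>>%VS).

Definition nonlinear_connection := regular_distribution /\
  forall u v, tangent u v -> exists! p : tvector * tvector,
    [/\ N u p.1, V1 u p.2 & v = p.1 + p.2].

Definition N_1 (u : jet2) : set tvector := J @` N u.

(* The components of v in the decomposition N + N_1 + V_2. *)
Definition adapted_components (u : jet2) (v : tvector) :
    tvector * tvector * tvector :=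
  xget 0 [set p | [/\ N u p.1.1, N_1 u p.1.2, V2 u p.2 &
                      v = p.1.1 + p.1.2 + p.2]].

Definition hproj u v := (adapted_components u v).1.1.
Definition v1proj u v := (adapted_components u v).1.2.
Definition v2proj u v := (adapted_components u v).2.

Definition delta_x (N1 N2 : 'M[R]_n) (i : 'I_n) : 'M[R]_(3, n) :=
  partial 0 i - \sum_j N1 j i *: partial 1 j - \sum_j N2 j i *: partial 2 j.

Definition local_coefficients c u (N1 N2 : 'M[R]_n) :=
  forall v, tangent u v ->
    (N u v <-> v c \in <<[seq delta_x N1 N2 i | i : 'I_n]>>%VS).

Variables (L : jet2 -> R) (S : jet2 -> tvector).

Definition metric_parallel := forall c u, tdom c u ->
  forall N1 N2, local_coefficients c u N1 N2 ->
  forall i j, nabla2g L S c (tcoord c u) N1 N2 i j = 0.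

Definition horizontally_closed := forall X Y, vector_field X ->
  vector_field Y -> forall c u, tdom c u ->
  omega2 L c (tcoord c u) (hproj u (X u) c) (hproj u (Y u) c) = 0.

Definition compatible_hv1 := forall X Y, vector_field X ->
  vector_field Y -> forall c u, tdom c u ->
  omega2 L c (tcoord c u) (hproj u (X u) c) (v1proj u (Y u) c) =
  2 * gc L S c (tcoord c u) (hproj u (X u) c) (v1proj u (Y u) c).

End NonlinearConnection.

End SecondOrderTangentBundle.

Arguments jet2 {R n} M.
Arguments tvector {R n} M.

(* Main.v *)
(** In induced coordinates, write the vector (xi0, xi1, xi2) as the polynomial
    xi0 + t xi1 + t^2 xi2 modulo t^3.  Then J is multiplication by t, and a
    change of charts multiplies vectors by A(t) = A0 + t A1 + t^2 A2, where A0
    is the Jacobian of the change of base coordinates, A1 = S(A0) and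
    A2 = S(A1)/2; g^c(xi, eta) is the t^2 coefficient of xi(t) g(t) eta(t)^T with
    g(t) = g + t S(g) + t^2 S^2(g)/2, which shows that g^c is a tensor.

    Since nabla^2 g_ij = 2 g^c(delta_i, delta_j), the three conditions on N are
    the tensorial equations omega(h, J h) = 2 g^c(h, J h), g^c(h, h) = 0 and
    omega(h, h) = 0 on horizontal vectors h.  In a chart they form a triangular
    system: the first is a linear equation 4 X^T + 2 X = Y for X = - N_(1)^T g,
    and the other two give the symmetric and the antisymmetric part of
    Z = - N_(2)^T g.  So every chart carries exactly one solution, depending
    smoothly on the point, and tensoriality makes the local solutions agree.

    The conditions quantify over global vector fields; bump functions show that
    every tangent vector is the value of one, so they hold pointwise. *)

From HB Require Import structures.
Require Import Defs.
From mathcomp Require Import all_boot all_order all_algebra.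
From mathcomp Require Import all_classical all_reals all_analysis.
From mathcomp Require Import perm ring lra.

Set Implicit Arguments.
Unset Strict Implicit.
Unset Printing Implicit Defensive.

Import Order.TTheory GRing.Theory Num.Theory.
Import numFieldNormedType.Exports.

Local Open Scope classical_set_scope.
Local Open Scope ring_scope.

(** * Calculus of C^k functions *)

(** The map X |-> 4 X^T + 2 X is multiplication by 6 on symmetric matrices and by -2 on
    antisymmetric ones, hence invertible; half of the 4 comes from omega and half from 2 g^c. On
    horizontal vectors g^c is a symmetric form and omega an antisymmetric one, so the last two
    conditions constrain complementary halves of Z and cannot conflict. Since g is invertible, X and
    Z give back the coefficients.

    The calculus is shaped by [Ck_on], which speaks only of derivatives in constant directions. The
    derivatives that matter here have moving directions (S, y^(1), the velocity of a curve); to see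
    that such a derivative is smooth, it is expanded in a basis with smooth coefficients.

    Symmetry of second derivatives enters three times: the metric is symmetric, the differential of
    a prolonged change of charts is multiplication by A(t), and the inhomogeneous terms cancel in
    the transformation of omega. *)

Section CkGeneral.
Context {R : realType} {V W : normedModType R}.
Implicit Types (U : set V) (f h : V -> W) (k : nat).

Lemma Ck_on_sub k U U' f : U' `<=` U -> Ck_on k U f -> Ck_on k U' f.
Proof.
elim: k f => [|k IH] f sU /=; first by move=> fU x /sU; exact: fU.
by move=> [df Df]; split=> [x /sU /df //|v]; apply: IH.
Qed.

(** Works because [Ck_on] asks for continuity and differentiability in the ambient space, point by
    point over the set. *)
Lemma Ck_on_local k U f :
  (forall x, U x -> exists2 U', U' x & Ck_on k U' f) -> Ck_on k U f.
Proof.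
elim: k f => [|k IH] f fU /=; first by move=> x /fU[U' U'x]; exact.
split=> [x /fU[U' U'x [df _]]|v]; first exact: df.
by apply: IH => x /fU[U' U'x [_ Df]]; exists U' => //; exact: Df.
Qed.

Lemma open_near_eq U f h x : open U -> U x -> {in U, f =1 h} ->
  \forall y \near x, f y = h y.
Proof.
move=> oU Ux fh; have := open_nbhs_nbhs (conj oU Ux).
by apply: filterS => y Uy; apply: fh; rewrite inE.
Qed.

Lemma derive_open_eq U f h x v : open U -> U x -> {in U, f =1 h} ->
  'D_v f x = 'D_v h x.
Proof. by move=> oU Ux fh; apply: near_eq_derive; exact: open_near_eq fh. Qed.

(** The first order expansion at x holds with zero differential, its remainder being 0 near x. *)
Lemma near0_differentiable f x : (\forall y \near x, f y = 0) ->
  differentiable f x.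
Proof.
move=> f0; have fx0 := nbhs_singleton f0.
have fE : f \o shift x = cst (f x) + (0 : V -> W) +o_ 0 id.
  apply/eqaddoP => e e0; near=> y.
  rewrite !fctE /= fx0 addr0 subr0.
  suff -> : f (y + x) = 0 by rewrite normr0 mulr_ge0 // ltW.
  by near: y; move: f0; rewrite (near_shift 0) /= subr0.
apply/diff_locallyP.
have c0 : continuous (\0 : V -> W) by move=> y; exact: cst_continuous.
by rewrite (@diff_unique _ _ _ f \0 x c0 fE).
Unshelve. all: by end_near. Qed.

Lemma near_eq_differentiable f h x : (\forall y \near x, f y = h y) ->
  differentiable f x -> differentiable h x.
Proof.
move=> fh df; have -> : h = f + (h - f) by rewrite addrC subrK.
apply: differentiableD => //; apply: near0_differentiable.
by apply: filterS fh => y; rewrite !fctE => ->; rewrite subrr.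
Qed.

Lemma Ck_on_eq k U f h : open U -> {in U, f =1 h} ->
  Ck_on k U f -> Ck_on k U h.
Proof.
elim: k f h => [|k IH] f h oU fh /=.
  move=> cf x Ux; have fhx := open_near_eq oU Ux fh.
  rewrite /prop_for /continuous_at -(nbhs_singleton fhx).
  by apply: cvg_trans (cf x Ux); exact: near_eq_cvg.
move=> [df Df]; split=> [x Ux|v].
  by apply: near_eq_differentiable (df x Ux); exact: open_near_eq fh.
apply: IH (Df v) => // x; rewrite inE => Ux.
exact: derive_open_eq fh.
Qed.

Lemma Ck_onS k U f : Ck_on k.+1 U f -> Ck_on k U f.
Proof.
elim: k f => [|k IH] f [df Df].
  by move=> x Ux; apply: differentiable_continuous; exact: df.
by split=> // v; apply: IH.
Qed.

Lemma Ck_on_cst k U (a : W) : Ck_on k U (cst a : V -> W).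
Proof.
elim: k a => [|k IH] a; first by move=> x _; exact: cst_continuous.
split=> [x _|v]; first exact: differentiable_cst.
rewrite (_ : 'D_v _ = cst 0) //; apply/funext => x; exact: derive_cst.
Qed.

Lemma Ck_onD k U f h : open U -> Ck_on k U f -> Ck_on k U h ->
  Ck_on k U (f + h).
Proof.
elim: k f h => [|k IH] f h oU.
  by move=> cf ch x Ux; apply: continuousD; [exact: cf|exact: ch].
move=> [df Df] [dh Dh]; split=> [x Ux|v].
  by apply: differentiableD; [exact: df|exact: dh].
apply: (Ck_on_eq (f := 'D_v f + 'D_v h)) => //; last first.
  by apply: IH; [|exact: Df|exact: Dh].
move=> x; rewrite inE => Ux; rewrite [RHS]deriveD//; apply: diff_derivable.
- exact: df.
- exact: dh.
Qed.

Lemma Ck_onZ k U f (a : R) : open U -> Ck_on k U f -> Ck_on k U (a *: f).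
Proof.
elim: k f => [|k IH] f oU.
  by move=> cf x Ux; apply: (@continuousZr _ _ _ f); exact: cf.
move=> [df Df]; split=> [x Ux|v].
  by apply: differentiableZ; exact: df.
apply: (Ck_on_eq (f := a *: 'D_v f)) => //; last by apply: IH; [|exact: Df].
move=> x; rewrite inE => Ux; rewrite [RHS]deriveZ//; apply: diff_derivable.
exact: df.
Qed.

Lemma Ck_on_sum k U (I : Type) (r : seq I) (P : pred I) (F : I -> V -> W) :
  open U -> (forall i, P i -> Ck_on k U (F i)) ->
  Ck_on k U (fun x => \sum_(i <- r | P i) F i x).
Proof.
move=> oU FC; rewrite (_ : (fun _ => _) = \sum_(i <- r | P i) F i); last first.
  by apply/funext => x; rewrite fct_sumE.
elim/big_rec: _ => [|i f Pi fC]; first exact: Ck_on_cst.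
by apply: Ck_onD => //; exact: FC.
Qed.

End CkGeneral.

Section CkMul.
Context {R : realType} {V : normedModType R}.
Implicit Types (U : set V) (f h : V -> R^o) (k : nat).

Lemma Ck_onM k U f h : open U -> Ck_on k U f -> Ck_on k U h ->
  Ck_on k U (f * h).
Proof.
elim: k f h => [|k IH] f h oU.
  by move=> cf ch x Ux; apply: continuousM; [exact: cf|exact: ch].
move=> Cf Ch; have [[df Df] [dh Dh]] := (Cf, Ch); split=> [x Ux|v].
  by apply: differentiableM; [exact: df|exact: dh].
apply: (Ck_on_eq (f := f * 'D_v h + h * 'D_v f)) => //.
  move=> x; rewrite inE => Ux; rewrite [RHS]deriveM//; apply: diff_derivable.
  - exact: df.
  - exact: dh.
by apply: Ck_onD => //; apply: IH => //; first [exact: Ck_onS|exact: Df|exact: Dh].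
Qed.

Lemma Ck_on_prod k U (I : Type) (r : seq I) (P : pred I) (F : I -> V -> R^o) :
  open U -> (forall i, P i -> Ck_on k U (F i)) ->
  Ck_on k U (fun x => \prod_(i <- r | P i) F i x).
Proof.
move=> oU FC; rewrite (_ : (fun _ => _) = \prod_(i <- r | P i) F i); last first.
  by apply/funext => x; rewrite fct_prodE.
elim/big_rec: _ => [|i f Pi fC]; first exact: Ck_on_cst.
by apply: Ck_onM => //; exact: FC.
Qed.

(** The derivative -(1/f)^2 f' contains 1/f only undifferentiated, so the induction hypothesis for
    1/f itself suffices. *)
Lemma Ck_onV k U f : open U -> (forall x, U x -> f x != 0) ->
  Ck_on k U f -> Ck_on k U (fun x => (f x)^-1).
Proof.
move=> oU f0; elim: k => [|k IH].
  by move=> cf x Ux; apply: continuousV; [exact: f0|exact: cf].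
move=> Cf1; have [df Df] := Cf1; split=> [x Ux|v].
  by apply: differentiableV; [exact: df|exact: f0].
apply: (Ck_on_eq
  (f := ((-1) *: (fun x => (f x)^-1) * (fun x => (f x)^-1)) * 'D_v f)) => //.
  move=> x; rewrite inE => Ux; rewrite [RHS]deriveV ?f0//; last first.
    by apply: diff_derivable; exact: df.
  by rewrite !fctE /GRing.scale /= expr2 invfM; ring.
have Cf : Ck_on k U (fun x => (f x)^-1) by apply/IH/Ck_onS.
by apply: Ck_onM => //; [apply: Ck_onM => //; exact: Ck_onZ|exact: Df].
Qed.

End CkMul.

Section CkComp.
Context {R : realType} {V V' W W' : normedModType R}.
Implicit Types (U : set V) (k : nat).

Lemma derive_comp (f : V -> V') (h : V' -> W) x v :
  differentiable f x -> differentiable h (f x) ->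
  'D_v (h \o f) x = 'D_('D_v f x) h (f x).
Proof.
move=> df dh; rewrite deriveE; last exact: differentiable_comp.
by rewrite diff_comp //= !deriveE.
Qed.

Lemma derive_lin (l : {linear V' -> W}) (f : V -> V') x v : continuous l ->
  differentiable f x -> 'D_v (l \o f) x = l ('D_v f x).
Proof.
move=> cl df; rewrite derive_comp//; last exact: linear_differentiable.
by rewrite deriveE ?diff_lin//; exact: linear_differentiable.
Qed.

Lemma Ck_on_lin (l : {linear V' -> W}) k U (f : V -> V') : continuous l ->
  open U -> Ck_on k U f -> Ck_on k U (l \o f).
Proof.
move=> cl oU; elim: k f => [|k IH] f.
  by move=> cf x Ux; apply: continuous_comp; [exact: cf|exact: cl].
move=> [df Df]; split=> [x Ux|v].
  by apply: differentiable_comp; [exact: df|exact: linear_differentiable].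
apply: (Ck_on_eq (f := l \o 'D_v f)) => //; last by apply: IH; exact: Df.
by move=> x; rewrite inE => Ux /=; rewrite derive_lin//; exact: df.
Qed.

End CkComp.
Section CkScale.
Context {R : realType} {V W : normedModType R}.

Lemma Ck_onZl k (U : set V) (a : V -> R^o) (w : W) : open U -> Ck_on k U a ->
  Ck_on k U (fun x => a x *: w).
Proof.
have sx_lin : linear ( *:%R ^~ w : R^o -> W).
  by move=> u y z; rewrite scalerDl scalerA.
pose sxlM := GRing.isLinear.Build _ _ _ _ _ sx_lin.
pose sxL : {linear R^o -> W} := HB.pack ( *:%R ^~ w : R^o -> W) sxlM.
have sxC : continuous sxL by move=> x; exact: (@scalel_continuous R W w x).
by move=> oU Ca; exact: (Ck_on_lin sxC oU Ca).
Qed.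

Variables (I : finType) (e : I -> V) (pr : I -> {linear V -> R^o}).
Hypothesis pr_cont : forall i, continuous (pr i).
Hypothesis prE : forall v, v = \sum_i pr i v *: e i.
Context {V0 : normedModType R}.

(** The chain rule produces the derivative of h in the moving direction ['D_v f x]. Expanding this
    direction in the basis [e] turns it into a sum of products of functions to which the induction
    applies. The basis is abstract in order to serve both matrices and [R^o]. *)
Lemma Ck_on_comp_basis k (U : set V0) (U' : set V) (f : V0 -> V)
    (h : V -> R^o) :
  open U -> (forall x, U x -> U' (f x)) -> Ck_on k U f -> Ck_on k U' h ->
  Ck_on k U (h \o f).
Proof.
move=> oU fU; elim: k h => [|k IH] h.
  move=> cf ch x Ux; apply: continuous_comp; first exact: cf.
  by apply: ch; exact: fU.
move=> Cf1 [dh Dh]; have [df Df] := Cf1; split=> [x Ux|v].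
  by apply: differentiable_comp; [exact: df|apply: dh; exact: fU].
apply: (Ck_on_eq
    (f := fun x => \sum_i ((pr i \o 'D_v f) * ('D_(e i) h \o f)) x)) => //.
  move=> x; rewrite inE => Ux; have dhx := dh _ (fU _ Ux).
  rewrite [RHS]derive_comp//; last exact: df.
  rewrite [in RHS](prE ('D_v f x)) deriveE// linear_sum.
  by apply: eq_bigr => i _; rewrite linearZ -deriveE.
apply: Ck_on_sum => // i _; apply: Ck_onM => //.
  by apply: Ck_on_lin => //; exact: Df.
by apply: IH; [exact: Ck_onS|exact: Dh].
Qed.

End CkScale.

Section MxCoord.
Context {R : realType} {p q : nat}.

Definition mxcoord (i : 'I_p) (j : 'I_q) (A : 'M[R]_(p, q)) : R^o := A i j.

Lemma mxcoord_linear i j : linear (mxcoord i j).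
Proof. by move=> a A B; rewrite /mxcoord !mxE. Qed.

HB.instance Definition _ i j :=
  GRing.isLinear.Build R 'M[R]_(p, q) R^o _ (mxcoord i j) (mxcoord_linear i j).

Lemma mxcoord_continuous i j : continuous (mxcoord i j).
Proof. exact: coord_continuous. Qed.

Context {V : normedModType R}.

Lemma Ck_on_mx k (U : set V) (f : V -> 'M[R]_(p, q)) : open U ->
  Ck_on k U f <-> forall i j, Ck_on k U (fun x => f x i j : R^o).
Proof.
move=> oU; split=> [Cf i j|Cf].
  exact: (Ck_on_lin (l := mxcoord i j) (@mxcoord_continuous i j)).
rewrite (_ : f = fun x => \sum_i \sum_j f x i j *: delta_mx i j).
  by apply: Ck_on_sum => // i _; apply: Ck_on_sum => // j _; exact: Ck_onZl.
by apply/funext => x; rewrite [LHS]matrix_sum_delta.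
Qed.

Lemma Ck_on_comp_mx k (U : set V) (U' : set 'M[R]_(p, q)) f h :
  open U -> (forall x, U x -> U' (f x)) -> Ck_on k U f -> Ck_on k U' h ->
  Ck_on k U (h \o f : V -> R^o).
Proof.
have prC (ij : 'I_p * 'I_q) : continuous (mxcoord ij.1 ij.2 : {linear _ -> _}).
  exact: mxcoord_continuous.
have prE A : A = \sum_ij mxcoord ij.1 ij.2 A *: delta_mx ij.1 ij.2.
  by rewrite [LHS]matrix_sum_delta pair_big.
exact: (Ck_on_comp_basis prC prE).
Qed.

End MxCoord.

Lemma Ck_on_comp_real (R : realType) (V : normedModType R) k (U : set V)
    (U' : set R^o) (f : V -> R^o) (h : R^o -> R^o) :
  open U -> (forall x, U x -> U' (f x)) -> Ck_on k U f -> Ck_on k U' h ->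
  Ck_on k U (h \o f).
Proof.
have prC (i : 'I_1) : continuous (idfun : {linear R^o -> R^o}).
  by move=> x; exact: cvg_id.
have prE (v : R^o) : v = \sum_(i < 1) (idfun : {linear R^o -> R^o}) v *: (1 : R^o).
  by rewrite big_ord1 /= /GRing.scale /= mulr1.
exact: (Ck_on_comp_basis prC prE).
Qed.

Section MxTarget.
Context {R : realType} {V : normedModType R}.

Lemma Ck_on_comp {p q r s : nat} k (U : set V) (U' : set 'M[R]_(p, q))
    (f : V -> 'M[R]_(p, q)) (h : 'M[R]_(p, q) -> 'M[R]_(r, s)) :
  open U -> open U' -> (forall x, U x -> U' (f x)) ->
  Ck_on k U f -> Ck_on k U' h -> Ck_on k U (h \o f).
Proof.
move=> oU oU' fU Cf /(Ck_on_mx _ _ oU')Ch; apply/(Ck_on_mx _ _ oU) => i j.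
exact: (Ck_on_comp_mx oU fU Cf (Ch i j)).
Qed.

Lemma Ck_on_mulmx {p q r : nat} k (U : set V) (A : V -> 'M[R]_(p, q))
    (B : V -> 'M[R]_(q, r)) :
  open U -> Ck_on k U A -> Ck_on k U B -> Ck_on k U (fun x => A x *m B x).
Proof.
move=> oU /(Ck_on_mx _ _ oU)CA /(Ck_on_mx _ _ oU)CB.
apply/(Ck_on_mx _ _ oU) => i j.
rewrite (_ : (fun _ => _) = fun x => \sum_l (A x i l * B x l j : R^o)).
  by apply: Ck_on_sum => // l _; exact: (Ck_onM oU (CA i l) (CB l j)).
by apply/funext => x; rewrite mxE.
Qed.

(** Cramer's rule: the entries of the inverse are cofactors, polynomial in the entries of A, divided
    by the determinant. *)
Lemma Ck_on_invmx {p : nat} k (U : set V) (A : V -> 'M[R]_p) :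
  open U -> (forall x, U x -> A x \in unitmx) ->
  Ck_on k U A -> Ck_on k U (fun x => invmx (A x)).
Proof.
move=> oU Au CA.
have Cdet m (B : V -> 'M[R]_m) : Ck_on k U B ->
    Ck_on k U (fun x => \det (B x) : R^o).
  move=> /(Ck_on_mx _ _ oU)CB; apply: Ck_on_sum => // s _.
  have Cp : Ck_on k U (fun x => \prod_i B x i (s i) : R^o) by apply: Ck_on_prod.
  exact: (Ck_onM oU (Ck_on_cst k U ((-1) ^+ s : R^o)) Cp).
apply: (Ck_on_eq (f := fun x => (\det (A x))^-1 *: \adj (A x))) => //.
  by move=> x; rewrite inE => Ux; rewrite /invmx Au.
apply/(Ck_on_mx _ _ oU) => i j.
rewrite (_ : (fun _ => _) = (fun x => (\det (A x))^-1 : R^o) *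
   (fun x => (-1) ^+ (j + i) * \det (row' j (col' i (A x))) : R^o)); last first.
  by apply/funext => x; rewrite !mxE.
apply: Ck_onM => //.
  apply: Ck_onV => //; last exact: Cdet.
  by move=> x Ux; have := Au x Ux; rewrite unitmxE unitfE.
suff Cp : Ck_on k U (fun x => \det (row' j (col' i (A x))) : R^o).
  exact: (Ck_onM oU (Ck_on_cst k U ((-1) ^+ (j + i) : R^o)) Cp).
apply: Cdet; apply/(Ck_on_mx _ _ oU) => a b.
under eq_fun do rewrite !mxE.
by move/(Ck_on_mx _ _ oU) : CA.
Qed.

End MxTarget.

(** * Symmetry of second derivatives *)

Section Schwarz.
Context {R : realType} {V : normedModType R}.
Implicit Types (f : V -> R^o).

Lemma is_derive_line f (x u : V) (s : R) : differentiable f (x + s *: u) ->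
  is_derive (s : R^o) 1 (fun s : R => f (x + s *: u) : R^o)
    ('D_u f (x + s *: u)).
Proof.
pose g := cst x + ( *:%R ^~ u) : R^o -> V.
move=> df; have dg2 : differentiable ( *:%R ^~ u : R^o -> V) s by [].
have dg : differentiable g s by apply: differentiableD.
have Dg : 'D_1 g s = u.
  by rewrite deriveE// diffD// diff_cst diff_val -[RHS]scale1r -[RHS]add0r.
apply: DeriveDef; first by apply: diff_derivable; exact: differentiable_comp.
by rewrite (derive_comp (f := g))// Dg.
Qed.

(* Two applications of the mean value theorem. *)
Lemma second_difference f (U : set V) (x u v : V) (h : R) : Ck_on 2 U f ->
  0 < h -> (forall s t : R, 0 <= s <= h -> 0 <= t <= h ->
    U (x + s *: u + t *: v)) ->
  exists s t : R, [/\ 0 <= s <= h, 0 <= t <= h &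
    f (x + h *: u + h *: v) - f (x + h *: u) - (f (x + h *: v) - f x) =
    h ^+ 2 * 'D_v ('D_u f) (x + s *: u + t *: v)].
Proof.
move=> [df Df] h0 Uh.
pose F s : R := f (x + h *: v + s *: u) - f (x + s *: u).
have Us s : 0 <= s <= h -> U (x + s *: u).
  by move=> sh; have := Uh s 0 sh; rewrite scale0r addr0; apply; rewrite lexx ltW.
have Us' s : 0 <= s <= h -> U (x + h *: v + s *: u).
  by move=> sh; rewrite addrAC; apply: Uh => //; rewrite ltW//=.
have dF s : s \in `[0, h] -> is_derive (s : R^o) 1 (F : R^o -> R^o)
    ('D_u f (x + h *: v + s *: u) - 'D_u f (x + s *: u)).
  rewrite in_itv => sh; apply: is_deriveB; apply: is_derive_line; apply: df.
    exact: Us'.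
  exact: Us.
have [s sh] := MVT_segment (ltW h0)
  (fun s hs => dF s (subset_itv_oo_cc hs))
  (derivable_within_continuous (fun s hs => @ex_derive _ _ _ _ _ _ _ (dF s hs))).
rewrite in_itv /= in sh.
pose G t : R := 'D_u f (x + s *: u + t *: v).
have dG t : t \in `[0, h] -> is_derive (t : R^o) 1 (G : R^o -> R^o)
    ('D_v ('D_u f) (x + s *: u + t *: v)).
  rewrite in_itv => th; apply: is_derive_line.
  by have [] := Df u => + _; apply; apply: Uh.
have [t th] := MVT_segment (ltW h0)
  (fun t ht => dG t (subset_itv_oo_cc ht))
  (derivable_within_continuous (fun s hs => @ex_derive _ _ _ _ _ _ _ (dG s hs))).
rewrite in_itv /= in th.
rewrite /F /G !scale0r !addr0 subr0.
rewrite [x + h *: v + s *: u]addrAC [x + h *: v + h *: u]addrAC => Et Es.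
exists s, t; split => //.
have Et' : 'D_u f (x + s *: u + h *: v) - 'D_u f (x + s *: u) =
  h * 'D_v ('D_u f) (x + s *: u + t *: v) by rewrite Et mulrC.
by rewrite Es mulrC Et' expr2 mulrA.
Qed.

(** The second difference over a small parallelogram is symmetric in u and v, and equals h^2 times
    either mixed derivative at some point of the parallelogram; both derivatives are continuous at
    x. *)
Theorem derive_commute f (U : set V) (x u v : V) : open U -> Ck_on 2 U f ->
  U x -> 'D_u ('D_v f) x = 'D_v ('D_u f) x.
Proof.
move=> oU Cf Ux; apply/eqP; rewrite -subr_eq0 -normr_le0; apply/ler_addgt0Pr => e e0.
have C2 a b : {for x, continuous ('D_a ('D_b f))}.
  by have [_ /(_ b)[_ /(_ a)]] := Cf; apply.
(* Small parallelograms at x lie in any neighbourhood; a and b range over both orders of u and v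
   since [second_difference] is used in both orders. *)
have box (P : set V) : nbhs x P -> \forall h \near (0:R)^'+, forall s t : R,
    0 <= s <= h -> 0 <= t <= h -> forall a b,
    (a = u /\ b = v) \/ (a = v /\ b = u) -> P (x + s *: a + t *: b).
  move=> /nbhs_ballP[d /= d0 dP].
  have M0 : 0 < `|u| + `|v| + 1 by rewrite ltr_wpDl// addr_ge0.
  near=> h => s t /andP[s0 sh] /andP[t0 th] a b ab; apply: dP.
  rewrite -ball_normE /= -addrA opprD addNKr normrN.
  apply: (le_lt_trans (ler_normD _ _)); rewrite !normrZ !ger0_norm//.
  have hM : h * (`|u| + `|v| + 1) < d.
    rewrite -ltr_pdivlMr//; near: h; apply: nbhs_right_lt; exact: divr_gt0.
  have h0 : 0 < h by near: h; exact: nbhs_right_gt.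
  apply: le_lt_trans hM; rewrite !mulrDr mulr1.
  have sa w : s * `|w| <= h * `|w| by rewrite ler_wpM2r.
  have ta w : t * `|w| <= h * `|w| by rewrite ler_wpM2r.
  case: ab => -[-> ->]; first by rewrite ler_wpDr ?lerD// ltW.
  by rewrite [leLHS]addrC ler_wpDr ?lerD// ltW.
have subAC (a b c d : R) : a - b - (c - d) = a - c - (b - d) by ring.
have e2 : 0 < e / 2 by rewrite divr_gt0.
have N1 : \forall t \near x, `|'D_u ('D_v f) x - 'D_u ('D_v f) t| < e / 2.
  exact: cvgr_dist_lt (C2 u v) _ e2.
have N2 : \forall t \near x, `|'D_v ('D_u f) x - 'D_v ('D_u f) t| < e / 2.
  exact: cvgr_dist_lt (C2 v u) _ e2.
have N3 := open_nbhs_nbhs (conj oU Ux).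
have N4 : \forall h \near (0:R)^'+, 0 < h by exact: nbhs_right_gt.
have [h [[[B1 B2] B3] h0]] :=
  filter_ex (filterI (filterI (filterI (box _ N1) (box _ N2)) (box _ N3)) N4).
have [|s [t [sh th E]]] := @second_difference f U x u v h Cf h0.
  by move=> s t sh th; apply: (B3 s t sh th u v); left.
have [|s' [t' [sh' th' E']]] := @second_difference f U x v u h Cf h0.
  by move=> s1 t1 sh1 th1; apply: (B3 s1 t1 sh1 th1 v u); right.
(* This common value is within e/2 of each mixed derivative at x. *)
have EE : 'D_v ('D_u f) (x + s *: u + t *: v) = 'D_u ('D_v f) (x + s' *: v + t' *: u).
  apply: (mulfI (x := h ^+ 2)); first by rewrite expf_neq0// gt_eqF.
  rewrite [x + h *: v + h *: u]addrAC in E'.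
  exact: (eq_trans (esym E) (eq_trans (subAC _ _ _ _) E')).
have A1 := B1 _ _ sh' th' v u (or_intror (conj erefl erefl)).
have A2 := B2 _ _ sh th u v (or_introl (conj erefl erefl)).
rewrite /= -EE in A1; rewrite /= distrC in A2; rewrite add0r.
apply: ltW; rewrite [ltRHS]splitr.
exact: (le_lt_trans (ler_distD _ _ _) (ltrD A1 A2)).
Unshelve. all: by end_near. Qed.

End Schwarz.

(* Otherwise failing unification problems unfold derivatives down to limits. *)
Local Opaque derive diff.

(** * Rules for smooth maps and for directional derivatives of matrix-valued maps *)

Section SmoothRules.
Context {R : realType} {V W : normedModType R}.
Implicit Types (U : set V) (f : V -> W).

Lemma smooth_differentiable U f x : smooth_on U f -> U x -> differentiable f x.
Proof. by move=> /(_ 1)[+ _]; apply. Qed.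

Lemma smooth_derive U f v : smooth_on U f -> smooth_on U ('D_v f).
Proof. by move=> sf k; have [_] := sf k.+1; apply. Qed.

Lemma smooth_continuous U f x : smooth_on U f -> U x -> {for x, continuous f}.
Proof. by move=> /(_ 0); apply. Qed.

Lemma smooth_eq U f h : open U -> {in U, f =1 h} -> smooth_on U f ->
  smooth_on U h.
Proof. by move=> oU fh sf k; exact: Ck_on_eq (sf k). Qed.

Lemma smooth_sub U U' f : U' `<=` U -> smooth_on U f -> smooth_on U' f.
Proof. by move=> sU sf k; exact: Ck_on_sub (sf k). Qed.

Lemma smooth_local U f :
  (forall x, U x -> exists2 U', U' x & smooth_on U' f) -> smooth_on U f.
Proof.
by move=> H k; apply: Ck_on_local => x /H[U' U'x sf]; exists U'.
Qed.

Lemma smooth_lin (W' : normedModType R) (l : {linear W -> W'}) U f :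
  continuous l -> open U -> smooth_on U f -> smooth_on U (l \o f).
Proof. by move=> cl oU sf k; exact: Ck_on_lin. Qed.

Lemma smooth_id U : open U -> smooth_on U (idfun : V -> V).
Proof.
move=> oU [|k]; first by move=> x _; exact: cvg_id.
split=> [x _|v]; first by [].
rewrite (_ : 'D_v _ = cst v); first exact: Ck_on_cst.
by apply/funext => x; exact: derive_id.
Qed.

Lemma deriveDd f x v v' : differentiable f x ->
  'D_(v + v') f x = 'D_v f x + 'D_v' f x.
Proof. by move=> df; rewrite !deriveE// linearD. Qed.

Lemma deriveZd f x (a : R) v : differentiable f x ->
  'D_(a *: v) f x = a *: 'D_v f x.
Proof. by move=> df; rewrite !deriveE// linearZ. Qed.

Lemma derive_sumd f x (I : finType) (F : I -> V) : differentiable f x ->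
  'D_(\sum_i F i) f x = \sum_i 'D_(F i) f x.
Proof.
by move=> df; rewrite deriveE// linear_sum; apply: eq_bigr => i _; rewrite deriveE.
Qed.

End SmoothRules.

Section MxRules.
Context {R : realType} {V : normedModType R}.
Implicit Types (U : set V).

Lemma linear_mx_continuous {p q : nat} {W : normedModType R}
  (l : {linear 'M[R]_(p, q) -> W}) : continuous l.
Proof.
have -> : l = (fun A => \sum_i \sum_j A i j *: l (delta_mx i j)) :> (_ -> _).
  apply/funext => A; rewrite {1}(matrix_sum_delta A) linear_sum.
  by apply: eq_bigr => i _; rewrite linear_sum; apply: eq_bigr => j _; rewrite linearZ.
have := @Ck_on_sum R 'M[R]_(p, q) W 0 setT _ (index_enum 'I_p) xpredT
  (fun i A => \sum_j A i j *: l (delta_mx i j)) openT.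
move=> H A; apply: H => // i _.
apply: Ck_on_sum; first exact: openT.
move=> j _; apply: (Ck_onZl (a := mxcoord i j)); first exact: openT.
move=> B _.
exact: mxcoord_continuous.
Qed.

Context {p q r : nat}.
Implicit Types (A : V -> 'M[R]_(p, q)) (B : V -> 'M[R]_(q, r)).

Lemma smooth_mulmx U A B : open U -> smooth_on U A -> smooth_on U B ->
  smooth_on U (fun x => A x *m B x).
Proof. by move=> oU sA sB k; exact: Ck_on_mulmx. Qed.

Lemma smooth_scale U (a : V -> R^o) A : open U -> smooth_on U a ->
  smooth_on U A -> smooth_on U (fun x => a x *: A x).
Proof.
move=> oU sa sA k; apply/(Ck_on_mx _ _ oU) => i j.
rewrite (_ : (fun _ => _) = a * (fun x => A x i j : R^o)).
  by apply: Ck_onM => //; apply: (Ck_on_mx _ _ oU).1.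
by apply/funext => x; rewrite mxE.
Qed.

Lemma derive_coord A x v i j : differentiable A x ->
  ('D_v A x) i j = 'D_v (fun y => A y i j : R^o) x.
Proof.
move=> dA.
have := @derive_lin _ _ _ _ (mxcoord i j) A x v (@mxcoord_continuous _ _ _ i j) dA.
by move=> /esym.
Qed.

Lemma differentiable_mx A x :
  (forall i j, differentiable (fun y => A y i j : R^o) x) -> differentiable A x.
Proof.
move=> dA; rewrite (_ : A = \sum_i \sum_j (fun y => A y i j *: delta_mx i j)).
  apply: differentiable_sum => i; apply: differentiable_sum => j.
  exact: differentiableZl.
apply/funext => y; rewrite {1}(matrix_sum_delta (A y)) fct_sumE.
by apply: eq_bigr => i _; rewrite fct_sumE.
Qed.

Lemma differentiable_entry A x i j : differentiable A x ->
  differentiable (fun y => A y i j : R^o) x.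
Proof.
move=> dA; apply: (differentiable_comp (g := mxcoord i j)) => //.
by apply: linear_differentiable; exact: mxcoord_continuous.
Qed.

End MxRules.

Section MxRules2.
Context {R : realType} {V : normedModType R} {p q r : nat}.
Implicit Types (A : V -> 'M[R]_(p, q)) (B : V -> 'M[R]_(q, r)).

Lemma differentiable_mulmx A B x : differentiable A x -> differentiable B x ->
  differentiable (fun y => A y *m B y) x.
Proof.
move=> dA dB; apply: differentiable_mx => i j.
rewrite (_ : (fun _ => _) =
  \sum_k ((fun y => A y i k : R^o) * (fun y => B y k j : R^o))).
  apply: differentiable_sum => k.
  by apply: differentiableM; exact: differentiable_entry.
by apply/funext => y; rewrite mxE fct_sumE.
Qed.

Lemma derive_mulmx A B x v : differentiable A x -> differentiable B x ->
  'D_v (fun y => A y *m B y) x = 'D_v A x *m B x + A x *m 'D_v B x.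
Proof.
move=> dA dB; apply/matrixP => i j.
rewrite derive_coord; last exact: differentiable_mulmx.
rewrite (_ : (fun _ => _) =
  \sum_k ((fun y => A y i k : R^o) * (fun y => B y k j : R^o))); last first.
  by apply/funext => y; rewrite mxE fct_sumE.
have dAe k : derivable (fun y => A y i k : R^o) x v.
  by apply: diff_derivable; exact: differentiable_entry.
have dBe k : derivable (fun y => B y k j : R^o) x v.
  by apply: diff_derivable; exact: differentiable_entry.
rewrite derive_sum; last by move=> k; exact: derivableM.
rewrite !mxE -big_split /=; apply: eq_bigr => k _.
rewrite deriveM// !derive_coord// addrC /GRing.scale /=.
by congr (_ + _); rewrite mulrC.
Qed.

Lemma differentiable_scale (a : V -> R^o) A x : differentiable a x ->
  differentiable A x -> differentiable (fun y => a y *: A y) x.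
Proof.
move=> da dA; apply: differentiable_mx => i j.
rewrite (_ : (fun _ => _) = a * (fun y => A y i j : R^o)).
  by apply: differentiableM => //; exact: differentiable_entry.
by apply/funext => y; rewrite mxE.
Qed.

Lemma derive_scale (a : V -> R^o) A x v : differentiable a x ->
  differentiable A x ->
  'D_v (fun y => a y *: A y) x = 'D_v a x *: A x + a x *: 'D_v A x.
Proof.
move=> da dA; apply/matrixP => i j.
rewrite derive_coord; last exact: differentiable_scale.
rewrite (_ : (fun _ => _) = a * (fun y => A y i j : R^o)); last first.
  by apply/funext => y; rewrite mxE.
rewrite deriveM//; [|exact: diff_derivable|].
  by rewrite !mxE derive_coord// addrC /GRing.scale /= [in LHS](mulrC (A x i j)).
by apply: diff_derivable; exact: differentiable_entry.
Qed.

Lemma derive_scale_eq (a : V -> R^o) A x v a' dA : differentiable a x ->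
  differentiable A x -> 'D_v a x = a' -> 'D_v A x = dA ->
  'D_v (fun y => a y *: A y) x = a' *: A x + a x *: dA.
Proof. by move=> da Ax <- <-; exact: derive_scale. Qed.

Lemma derive_mulmx_eq A B x v dA dB : differentiable A x ->
  differentiable B x -> 'D_v A x = dA -> 'D_v B x = dB ->
  'D_v (fun y => A y *m B y) x = dA *m B x + A x *m dB.
Proof. by move=> Ax Bx <- <-; exact: derive_mulmx. Qed.

Lemma derive_commute_mx A (U : set V) x u v : open U -> smooth_on U A -> U x ->
  'D_u ('D_v A) x = 'D_v ('D_u A) x.
Proof.
move=> oU sA Ux; apply/matrixP => i j.
have dD w : differentiable ('D_w A) x.
  exact: smooth_differentiable (smooth_derive w sA) Ux.
have E w w' : ('D_w ('D_w' A) x) i j =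
    'D_w ('D_w' (fun y => A y i j : R^o)) x.
  apply: (eq_trans (derive_coord w i j (dD w'))).
  apply: (derive_open_eq _ oU Ux) => y; rewrite inE => Uy.
  exact: (derive_coord w' i j (smooth_differentiable sA Uy)).
apply: (eq_trans (E u v)); apply: (eq_trans _ (esym (E v u))).
apply: (derive_commute _ _ oU _ Ux).
by have /(Ck_on_mx _ _ oU) := sA 2; apply.
Qed.

End MxRules2.

(** * Second order prolongation of a change of coordinates *)

Lemma ord3P (P : 'I_3 -> Prop) : P 0 -> P 1 -> P 2 -> forall k, P k.
Proof.
move=> P0 P1 P2 [[|[|[|//]]] kP].
- by rewrite (_ : Ordinal kP = 0)//; exact: val_inj.
- by rewrite (_ : Ordinal kP = 1)//; exact: val_inj.
- by rewrite (_ : Ordinal kP = 2)//; exact: val_inj.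
Qed.

Section Rows.
Context {R : realType} {n : nat}.
Implicit Types (w xi : 'M[R]_(3, n)) (a b c : 'rV[R]_n).

Definition mx3 a b c : 'M[R]_(3, n) :=
  \matrix_(k, j) (if k == 0 then a else if k == 1 then b else c) 0 j.

Lemma row0_mx3 a b c : row 0 (mx3 a b c) = a.
Proof. by apply/rowP => j; rewrite !mxE. Qed.

Lemma row1_mx3 a b c : row 1 (mx3 a b c) = b.
Proof. by apply/rowP => j; rewrite !mxE. Qed.

Lemma row2_mx3 a b c : row 2 (mx3 a b c) = c.
Proof. by apply/rowP => j; rewrite !mxE. Qed.

Definition row_mx3 := (row0_mx3, row1_mx3, row2_mx3).

Lemma row3P w xi : row 0 w = row 0 xi -> row 1 w = row 1 xi ->
  row 2 w = row 2 xi -> w = xi.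
Proof.
by move=> E0 E1 E2; apply/row_matrixP; exact: ord3P.
Qed.

Lemma mx3_row w : mx3 (row 0 w) (row 1 w) (row 2 w) = w.
Proof. by apply: row3P; rewrite row_mx3. Qed.

Context {V : normedModType R}.

Lemma row_continuous (k : 'I_3) : continuous (row k : 'M[R]_(3, n) -> _).
Proof. exact: linear_mx_continuous. Qed.

Lemma smooth_mx3 (U : set V) (f g h : V -> 'rV[R]_n) : open U ->
  smooth_on U f -> smooth_on U g -> smooth_on U h ->
  smooth_on U (fun x => mx3 (f x) (g x) (h x)).
Proof.
move=> oU sf sg sh m; apply/(Ck_on_mx _ _ oU) => k j.
rewrite (_ : (fun _ => _) =
    fun x => (if k == 0 then f else if k == 1 then g else h) x 0 j).
  by case: ifP => _; [|case: ifP => _]; move: j;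
     apply/(fun H => (Ck_on_mx _ _ oU).1 H 0).
by apply/funext => x; rewrite mxE; do 2?case: ifP.
Qed.

Lemma derive_row (A : V -> 'M[R]_(3, n)) x v k : differentiable A x ->
  row k ('D_v A x) = 'D_v (fun y => row k (A y)) x.
Proof.
move=> dA; have := @derive_lin _ _ _ _ (row k : {linear 'M[R]_(3, n) -> 'rV_n}) A x v.
by move=> ->//; exact: row_continuous.
Qed.

End Rows.

Lemma derive_linear (R : realType) (V W : normedModType R)
    (l : {linear V -> W}) x v : continuous l -> 'D_v l x = l v.
Proof.
move=> cl; apply: (eq_trans (deriveE v (@linear_differentiable _ _ _ l x cl))).
by rewrite diff_lin.
Qed.

Lemma derive_mulmxl (R : realType) (V : normedModType R) (p q r : nat)
    (c : 'M[R]_(p, q)) (F : V -> 'M[R]_(q, r)) x v : differentiable F x ->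
  'D_v (fun y => c *m F y) x = c *m 'D_v F x.
Proof.
move=> dF; apply: (@derive_lin _ _ _ _ (mulmx c : {linear _ -> 'M[R]_(p, r)})) => //.
exact: linear_mx_continuous.
Qed.

Lemma derive_basis (R : realType) (n : nat) (W : normedModType R)
    (F : 'rV[R]_n -> W) x a : differentiable F x ->
  'D_a F x = \sum_i a 0 i *: 'D_(delta_mx 0 i) F x.
Proof.
move=> dF; rewrite deriveE// {1}(row_sum_delta a) linear_sum.
by apply: eq_bigr => i _; rewrite linearZ deriveE.
Qed.

(** The algebra behind row 2 of [derive_prolong]. M0, M1, M2 stand for derivatives of the Jacobian;
    the three hypotheses are instances of the symmetry of higher derivatives. After their use the
    term x1 B1 occurs twice with factor 1/2. *)
Lemma prolong_row2 (R : realType) (n : nat) (y1 y2 x0 x1 x2 : 'rV[R]_n)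
    (B0 B1 M0 M1 M2 P Q : 'M[R]_n) :
  y2 *m M0 = x0 *m P -> y1 *m M1 = x1 *m B1 -> y1 *m M2 = x0 *m Q ->
  x2 *m B0 + y2 *m M0 + 2^-1 *: (x1 *m B1 + y1 *m (M1 + M2)) =
  x2 *m B0 + x1 *m B1 + x0 *m (P + 2^-1 *: Q).
Proof.
move=> E0 E1 E2; rewrite !mulmxDr E0 E1 E2 -scalemxAr.
set X := x1 *m B1; set Y := x0 *m Q.
have -> : 2^-1 *: (X + (X + Y)) = X + 2^-1 *: Y.
  have h2 : 2^-1 + 2^-1 = 1 :> R by rewrite -[2^-1]mul1r -splitr.
  by rewrite addrA !scalerDr -scalerDl h2 scale1r.
by rewrite addrACA.
Qed.

Section Prolongation.
Context {R : realType} {n : nat}.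
Variables (phi : 'rV[R]_n -> 'rV[R]_n) (O : set 'rV[R]_n).
Hypotheses (oO : open O) (sphi : smooth_on O phi).
Implicit Types (w xi : 'M[R]_(3, n)) (a b c x : 'rV[R]_n).

(* Acts on row vectors from the right. *)
Definition Jac x : 'M[R]_n := \matrix_i 'D_(delta_mx 0 i) phi x.

Lemma derive_Jac a x : O x -> 'D_a phi x = a *m Jac x.
Proof.
move=> Ox; have dx := smooth_differentiable sphi Ox.
rewrite deriveE// {1}(row_sum_delta a) linear_sum mulmx_sum_row.
by apply: eq_bigr => i _; rewrite linearZ rowK deriveE.
Qed.

Lemma smooth_Jac : smooth_on O Jac.
Proof.
move=> k; apply/(Ck_on_mx _ _ oO) => i j.
under eq_fun do rewrite mxE.
by apply: (Ck_on_mx _ _ oO).1; exact: smooth_derive.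
Qed.

(** Both sides are mixed second derivatives of [phi]. *)
Lemma derive_Jac_sym a b x : O x -> a *m 'D_b Jac x = b *m 'D_a Jac x.
Proof.
move=> Ox; have dJ := smooth_differentiable smooth_Jac Ox.
have E c d : c *m 'D_d Jac x = 'D_d ('D_c phi) x.
  apply: (eq_trans (esym (derive_mulmxl c d dJ))).
  by apply: (derive_open_eq _ oO Ox) => y; rewrite inE => Oy /=; rewrite derive_Jac.
apply: (eq_trans (E a b)); apply: (eq_trans _ (esym (E b a))).
exact: (derive_commute_mx _ _ oO).
Qed.

Lemma derive2_Jac_sym a b c x : O x ->
  a *m 'D_b ('D_c Jac) x = c *m 'D_b ('D_a Jac) x.
Proof.
move=> Ox; have dD d := smooth_differentiable (smooth_derive d smooth_Jac) Ox.
apply: (eq_trans (esym (derive_mulmxl a b (dD c)))).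
apply: (eq_trans _ (derive_mulmxl c b (dD a))).
apply: (derive_open_eq _ oO Ox) => y; rewrite inE => Oy.
exact: derive_Jac_sym.
Qed.

Definition jets_over : set 'M[R]_(3, n) := [set w | O (row 0 w)].

Lemma jets_over_open : open jets_over.
Proof. by apply: open_comp => // w _; exact: row_continuous. Qed.

Section Base.
Context {p q : nat} (F : 'rV[R]_n -> 'M[R]_(p, q)) (sF : smooth_on O F).

Lemma smooth_base : smooth_on jets_over (fun w => F (row 0 w)).
Proof.
move=> k; apply: (Ck_on_comp jets_over_open oO) => //.
by apply: (smooth_lin (l := row 0) _ jets_over_open (smooth_id jets_over_open));
  exact: row_continuous.
Qed.

Lemma derive_base w xi : jets_over w ->
  'D_xi (fun w => F (row 0 w)) w = 'D_(row 0 xi) F (row 0 w).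
Proof.
move=> Ow; have dr : differentiable (row 0 : 'M[R]_(3, n) -> 'rV[R]_n) w.
  by apply: linear_differentiable; exact: row_continuous.
have E : 'D_xi (row 0 : 'M[R]_(3, n) -> 'rV[R]_n) w = row 0 xi.
  by apply: (@derive_linear _ _ _ (row 0)); exact: row_continuous.
have dF : differentiable F (row 0 w) := smooth_differentiable sF Ow.
exact: (eq_trans (derive_comp xi dr dF) (congr1 (fun a => 'D_a F (row 0 w)) E)).
Qed.

End Base.

Section Dir.
Context {p q : nat} (F : 'rV[R]_n -> 'M[R]_(p, q)) (sF : smooth_on O F).

Let dirE w xi : jets_over w -> 'D_(row 1 xi) F (row 0 w) =
  \sum_i xi 1 i *: 'D_(delta_mx 0 i) F (row 0 w).
Proof.
move=> Ow; apply: (eq_trans (derive_basis (row 1 xi) (smooth_differentiable sF Ow))).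
by apply: eq_bigr => i _; rewrite mxE.
Qed.

(** The direction moves with w, so the derivative is written as a combination of derivatives along
    basis vectors with the entries of row 1 as coefficients. *)
Lemma smooth_dir : smooth_on jets_over (fun w => 'D_(row 1 w) F (row 0 w)).
Proof.
apply: (smooth_eq (f := fun w => \sum_i w 1 i *: 'D_(delta_mx 0 i) F (row 0 w))).
- exact: jets_over_open.
- by move=> w; rewrite inE => Ow; rewrite dirE.
move=> k; apply: Ck_on_sum; first exact: jets_over_open.
move=> i _; apply: (smooth_scale (a := mxcoord 1 i)).
- exact: jets_over_open.
- apply: (smooth_lin (l := mxcoord 1 i) _ jets_over_open (smooth_id jets_over_open)).
  exact: mxcoord_continuous.
- exact: smooth_base (smooth_derive _ sF).
Qed.

Lemma derive_dir w xi : jets_over w ->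
  'D_xi (fun w => 'D_(row 1 w) F (row 0 w)) w =
  'D_(row 1 xi) F (row 0 w) + 'D_(row 0 xi) ('D_(row 1 w) F) (row 0 w).
Proof.
move=> Ow; have dF := smooth_differentiable sF Ow.
have sD a := smooth_derive a sF.
have dD a := smooth_differentiable (smooth_base (sD a)) Ow.
have dc i : differentiable (mxcoord 1 i : 'M[R]_(3, n) -> R^o) w.
  by apply: linear_differentiable; exact: mxcoord_continuous.
pose G i w := mxcoord 1 i w *: 'D_(delta_mx 0 i) F (row 0 w).
have dG i : differentiable (G i) w by apply: differentiable_scale.
rewrite (derive_open_eq (h := \sum_i G i) _ jets_over_open Ow); last first.
  by move=> y; rewrite inE => Oy; rewrite fct_sumE; exact: dirE.
rewrite derive_sum; last by move=> i; exact: diff_derivable.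
have DG i : 'D_xi (G i) w = xi 1 i *: 'D_(delta_mx 0 i) F (row 0 w) +
    w 1 i *: 'D_(row 0 xi) ('D_(delta_mx 0 i) F) (row 0 w).
  have E : 'D_xi (mxcoord 1 i) w = xi 1 i.
    exact: (@derive_linear _ _ _ (mxcoord 1 i) w xi
                   (@mxcoord_continuous _ _ _ 1 i)).
  exact: (derive_scale_eq (dc i) (dD _) E (derive_base (sD _) xi Ow)).
rewrite (eq_bigr _ (fun i _ => DG i)) big_split.
congr (_ + _); first exact: esym (dirE xi Ow).
have dDx : differentiable ('D_(row 0 xi) F) (row 0 w).
  exact: smooth_differentiable (sD _) Ow.
have H1 := derive_basis (row 1 w) dDx.
have H2 : 'D_(row 1 w) ('D_(row 0 xi) F) (row 0 w) =
    'D_(row 0 xi) ('D_(row 1 w) F) (row 0 w).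
  exact: (derive_commute_mx _ _ oO sF Ow).
(* The basis derivatives stand innermost; moving them outward lets [H1] reassemble the sum into one
   directional derivative. *)
have H3 : \sum_i w 1 i *: 'D_(row 0 xi) ('D_(delta_mx 0 i) F) (row 0 w) =
    \sum_i row 1 w 0 i *: 'D_(delta_mx 0 i) ('D_(row 0 xi) F) (row 0 w).
  apply: eq_bigr => i _; rewrite [row 1 w 0 i]mxE.
  exact: (congr1 ( *:%R (w 1 i))
    (derive_commute_mx (row 0 xi) (delta_mx 0 i) oO sF Ow)).
exact: (eq_trans H3 (eq_trans (esym H1) H2)).
Qed.

End Dir.

(* The coefficients of the expansion A(t) = A0 + t A1 + t^2 A2 of the Jacobian
   along the curve x + t y1 + t^2 y2. *)
Definition A0 w : 'M[R]_n := Jac (row 0 w).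
Definition A1 w : 'M[R]_n := 'D_(row 1 w) Jac (row 0 w).
Definition A2 w : 'M[R]_n := 'D_(row 2 w) Jac (row 0 w) +
  2^-1 *: 'D_(row 1 w) ('D_(row 1 w) Jac) (row 0 w).

(** The coefficients of 1, t, t^2 in phi(x + t y1 + t^2 y2), where x, y1, y2 are the rows of w. *)
Definition prolong w : 'M[R]_(3, n) :=
  mx3 (phi (row 0 w)) (row 1 w *m A0 w)
    (row 2 w *m A0 w + 2^-1 *: (row 1 w *m A1 w)).

Lemma smooth_A0 : smooth_on jets_over A0.
Proof. exact: smooth_base smooth_Jac. Qed.

Lemma smooth_A1 : smooth_on jets_over A1.
Proof. exact: smooth_dir smooth_Jac. Qed.

Lemma smooth_row (k : 'I_3) : smooth_on jets_over (row k : 'M[R]_(3, n) -> _).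
Proof.
by apply: (smooth_lin (l := row k) _ jets_over_open (smooth_id jets_over_open));
  exact: row_continuous.
Qed.

Lemma smooth_prolong : smooth_on jets_over prolong.
Proof.
have oT := jets_over_open; apply: smooth_mx3 => //; first exact: smooth_base.
  by apply: smooth_mulmx => //; [exact: smooth_row|exact: smooth_A0].
move=> k; apply: Ck_onD => //.
  by apply: smooth_mulmx => //; [exact: smooth_row|exact: smooth_A0].
apply: (Ck_onZ (f := fun w => row 1 w *m A1 w)) => //.
by apply: smooth_mulmx => //; [exact: smooth_row|exact: smooth_A1].
Qed.

Lemma derive_A0 w xi : jets_over w -> 'D_xi A0 w = 'D_(row 0 xi) Jac (row 0 w).
Proof. by move=> Ow; rewrite (derive_base smooth_Jac). Qed.

Lemma derive_A1 w xi : jets_over w -> 'D_xi A1 w = 'D_(row 1 xi) Jac (row 0 w)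
  + 'D_(row 0 xi) ('D_(row 1 w) Jac) (row 0 w).
Proof. by move=> Ow; rewrite (derive_dir smooth_Jac). Qed.

(** Write w(t) and xi(t) for the polynomials with these rows as coefficients. Differentiating
    phi(w(t)) in the direction xi(t) gives xi(t) times the Jacobian at w(t), that is, xi(t) A(t)
    modulo t^3. *)
Lemma derive_prolong w xi : jets_over w -> 'D_xi prolong w =
  mx3 (row 0 xi *m A0 w) (row 1 xi *m A0 w + row 0 xi *m A1 w)
    (row 2 xi *m A0 w + row 1 xi *m A1 w + row 0 xi *m A2 w).
Proof.
move=> Ow; have dP := smooth_differentiable smooth_prolong Ow.
have d0 := smooth_differentiable smooth_A0 Ow.
have d1 := smooth_differentiable smooth_A1 Ow.
have dr k := smooth_differentiable (smooth_row k) Ow.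
have Dr k : 'D_xi (row k : 'M[R]_(3, n) -> _) w = row k xi.
  by apply: (@derive_linear _ _ _ (row k)); exact: row_continuous.
have DA0 := derive_A0 xi Ow; have DA1 := derive_A1 xi Ow.
have E0 : (fun w => row 0 (prolong w)) = (fun w => phi (row 0 w)).
  by apply/funext => y; rewrite /prolong row0_mx3.
have E1 : (fun w => row 1 (prolong w)) = (fun w => row 1 w *m A0 w).
  by apply/funext => y; rewrite /prolong row1_mx3.
have E2 : (fun w => row 2 (prolong w)) =
    (fun w => row 2 w *m A0 w) + 2^-1 *: (fun w => row 1 w *m A1 w).
  by apply/funext => y; rewrite /prolong row2_mx3.
have D0 := eq_trans (derive_base sphi xi Ow) (derive_Jac (row 0 xi) Ow).
have D1 := derive_mulmx_eq (dr 1) d0 (Dr 1) DA0.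
have D2 := derive_mulmx_eq (dr 2) d0 (Dr 2) DA0.
have D3 := derive_mulmx_eq (dr 1) d1 (Dr 1) DA1.
have dm := differentiable_mulmx (dr 2) d0.
have dm1 := differentiable_mulmx (dr 1) d1.
apply: row3P.
- rewrite row0_mx3; apply: (eq_trans (derive_row xi 0 dP)); rewrite E0.
  exact: D0.
- rewrite row1_mx3; apply: (eq_trans (derive_row xi 1 dP)); rewrite E1.
  have H : row 1 w *m 'D_(row 0 xi) Jac (row 0 w) = row 0 xi *m A1 w.
    exact: derive_Jac_sym.
  exact: (eq_trans D1 (congr1 (fun T => row 1 xi *m A0 w + T) H)).
- rewrite row2_mx3; apply: (eq_trans (derive_row xi 2 dP)); rewrite E2.
  have vm := @diff_derivable _ _ _ _ _ xi dm.
  have vm1 := @diff_derivable _ _ _ _ _ xi dm1.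
  have D4 := deriveD vm (derivableZ (k := (2^-1 : R)) vm1).
  have D5 := @deriveZ _ _ _ _ (2^-1 : R) _ _ vm1.
  have H1 : row 2 w *m 'D_(row 0 xi) Jac (row 0 w) =
            row 0 xi *m 'D_(row 2 w) Jac (row 0 w) by exact: derive_Jac_sym.
  have H2 : row 1 w *m 'D_(row 1 xi) Jac (row 0 w) = row 1 xi *m A1 w.
    exact: derive_Jac_sym.
  have H3 : row 1 w *m 'D_(row 0 xi) ('D_(row 1 w) Jac) (row 0 w) =
            row 0 xi *m 'D_(row 1 w) ('D_(row 1 w) Jac) (row 0 w).
    apply: (eq_trans (congr1 (mulmx (row 1 w))
      (derive_commute_mx (row 0 xi) (row 1 w) oO smooth_Jac Ow))).
    exact: derive2_Jac_sym.
  apply: (eq_trans D4); apply: (eq_trans _ (prolong_row2 _ _ H1 H2 H3)).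
  apply: (eq_trans (congr2 +%R D2 D5)).
  exact: (congr1 (fun T => _ + 2^-1 *: T) D3).
Qed.

End Prolongation.
Arguments jets_over {R n} O.

(** * Jets and induced charts *)

Section Charts.
Context {R : realType} {n : nat} {M : smoothManifold R n}.
Implicit Types (c d : mchart M) (x : 'rV[R]_n).

Definition overlap c d : set 'rV[R]_n := cmap c @` (cdom c `&` cdom d).
Definition transition c d : 'rV[R]_n -> 'rV[R]_n := cmap d \o cinv c.

Lemma overlapP c d x : overlap c d x <->
  [/\ (cmap c @` cdom c) x, cdom c (cinv c x) & cdom d (cinv c x)].
Proof.
split=> [[p [cp dp] <-]|[[p cp <-] _]].
  by rewrite cmapK//; split => //; exists p.
by rewrite cmapK// => dp; exists p.
Qed.

Lemma overlap_cmap c d p : cdom c p -> cdom d p -> overlap c d (cmap c p).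
Proof. by move=> cp dp; exists p. Qed.

Lemma overlapxx c : overlap c c = cmap c @` cdom c.
Proof. by rewrite /overlap setIid. Qed.

Lemma chart_image_open c (A : set M) : open A ->
  open (cmap c @` (cdom c `&` A)).
Proof.
move=> oA; rewrite openE => _ [p [cp Ap] <-].
have cont : {in cmap c @` cdom c, continuous (cinv c)}.
  by rewrite -continuous_open_subspace; [exact: cinv_continuous|exact: cimg_open].
have xc : (cmap c @` cdom c) (cmap c p) by exists p.
have cy := cont _ (mem_set xc).
have N1 : nbhs (cmap c p) (cinv c @^-1` A).
  by apply: cy; apply: open_nbhs_nbhs; split => //; rewrite cmapK.
have N2 := open_nbhs_nbhs (conj (@cimg_open _ _ _ c) xc).
apply: filterS (filterI N1 N2) => y [Ay [q cq Eq]].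
by move: Ay; rewrite -Eq /preimage /= cmapK// => Aq; exists q.
Qed.

Lemma overlap_open c d : open (overlap c d).
Proof. by apply: chart_image_open; exact: cdom_open. Qed.

Lemma transition_smooth c d : smooth_on (overlap c d) (transition c d).
Proof. exact: (atlas_compatible (svalP c) (svalP d)). Qed.

Lemma transition_cmap c d p : cdom c p -> transition c d (cmap c p) = cmap d p.
Proof. by move=> cp; rewrite /transition /= cmapK. Qed.

(** The formula of [tcoord] for an arbitrary curve instead of the chosen representative of a jet;
    needed to show that the choice is immaterial. *)
Definition curve_coord c (rho : R -> M) : 'M[R]_(3, n) :=
  \matrix_(k, i) ((k`!%:R)^-1 * ((cmap c \o rho)^`(k) 0)%classic 0 i).

Lemma curve_coord_eq c (rho sigma : R -> M) :
  curve_coord c rho = curve_coord c sigma <-> forall k, (k <= 2)%N ->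
    ((cmap c \o rho)^`(k) 0 = (cmap c \o sigma)^`(k) 0)%classic.
Proof.
split=> [E k k2|E]; last first.
  by apply/matrixP => k i; rewrite !mxE E// -ltnS ltn_ord.
apply/rowP => i; have /matrixP/(_ (Ordinal (k2 : (k < 3)%N)) i) := E.
rewrite !mxE /= => /mulfI; apply.
by rewrite invr_eq0 pnatr_eq0 -lt0n fact_gt0.
Qed.

Lemma row_curve_coord c rho :
  [/\ row 0 (curve_coord c rho) = cmap c (rho 0),
      row 1 (curve_coord c rho) = ((cmap c \o rho)^`() 0)%classic &
      row 2 (curve_coord c rho) =
        2^-1 *: ((cmap c \o rho)^`()^`() 0)%classic].
Proof.
by split; apply/rowP => i; rewrite !mxE /= ?fact0 ?factS ?invr1 ?mul1r.
Qed.

End Charts.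

Arguments overlap_open {R n M} c d.
Arguments transition_smooth {R n M} c d.

(** * Curves: composition with a smooth map to second order, and quadratic curves *)

Section CurveCalculus.
Context {R : realType} {n : nat}.
Implicit Types (gam : R^o -> 'rV[R]_n) (B : set R^o).

Lemma comp_curve_derive (phi : 'rV[R]_n -> 'rV[R]_n) (O : set 'rV[R]_n)
    gam B t : open O -> smooth_on O phi -> open B -> smooth_on B gam ->
  (forall s, B s -> O (gam s)) -> B t ->
  'D_1 (phi \o gam) t = 'D_1 gam t *m Jac phi (gam t).
Proof.
move=> oO sphi oB sg gO Bt.
have dg := smooth_differentiable sg Bt.
have dphi : differentiable phi (gam t) := smooth_differentiable sphi (gO _ Bt).
apply: (eq_trans (derive_comp (1 : R^o) dg dphi)).
exact: (derive_Jac sphi _ (gO _ Bt)).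
Qed.

Lemma comp_curve_derive2 (phi : 'rV[R]_n -> 'rV[R]_n) (O : set 'rV[R]_n)
    gam B t : open O -> smooth_on O phi -> open B -> smooth_on B gam ->
  (forall s, B s -> O (gam s)) -> B t ->
  'D_1 ('D_1 (phi \o gam)) t = 'D_1 ('D_1 gam) t *m Jac phi (gam t) +
    'D_1 gam t *m 'D_('D_1 gam t) (Jac phi) (gam t).
Proof.
move=> oO sphi oB sg gO Bt.
have sJ := smooth_Jac oO sphi.
have E : {in B, 'D_1 (phi \o gam) =1 fun s => 'D_1 gam s *m Jac phi (gam s)}.
  by move=> s; rewrite inE => Bs; exact: (comp_curve_derive oO sphi oB sg gO Bs).
apply: (eq_trans (derive_open_eq (1 : R^o) oB Bt E)).
have dJ : differentiable (Jac phi) (gam t).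
  exact: smooth_differentiable sJ (gO _ Bt).
have dg := smooth_differentiable sg Bt.
have dg1 := smooth_differentiable (smooth_derive (1 : R^o) sg) Bt.
exact: (derive_mulmx_eq dg1 (differentiable_comp dg dJ) erefl
  (derive_comp (1 : R^o) dg dJ)).
Qed.

(** A curve whose 2-jet at 0 has prescribed coordinates z; it shows that all values of y^(1), y^(2)
    occur. *)
Definition quad (z : 'M[R]_(3, n)) : R^o -> 'rV[R]_n :=
  fun t => row 0 z + t *: row 1 z + t ^+ 2 *: row 2 z.

Lemma smooth_quad z : smooth_on setT (quad z).
Proof.
have sid : smooth_on (setT : set R^o) (idfun : R^o -> R^o).
  by apply: smooth_id; exact: openT.
have oT : open (setT : set R^o) by exact: openT.
move=> k; apply: Ck_onD => //; first apply: Ck_onD => //.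
- exact: Ck_on_cst.
- exact: (Ck_onZl _ oT (sid k)).
- exact: (Ck_onZl _ oT (Ck_onM oT (sid k) (sid k))).
Qed.

Lemma derive_quad z t : 'D_1 (quad z) t = row 1 z + (2 * t) *: row 2 z.
Proof.
have d1 : differentiable (fun t : R^o => t *: row 1 z) t.
  exact: differentiableZl.
have did : differentiable (idfun : R^o -> R^o) t by [].
have d2 : differentiable (fun t : R^o => (t ^+ 2 : R^o)) t.
  exact: (differentiableM did did).
have d0 : differentiable (cst (row 0 z) : R^o -> 'rV[R]_n) t by [].
have dA := differentiable_scale did (differentiable_cst (row 1 z) t).
have dB := differentiable_scale d2 (differentiable_cst (row 2 z) t).
have D1 := derive_scale_eq did (differentiable_cst (row 1 z) t)
  (derive_id t (1 : R^o)) (derive_cst (row 1 z) t (1 : R^o)).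
have E2 : 'D_1 (fun t : R^o => (t ^+ 2 : R^o)) t = 2 * t.
  have Did : 'D_1 (idfun : R^o -> R^o) t = 1 by exact: derive_id.
  have H := @deriveM _ _ _ _ t (1 : R^o) (diff_derivable did) (diff_derivable did).
  apply: (eq_trans H); rewrite !Did /GRing.scale /= mulr1.
  by rewrite mulr_natl mulr2n.
have D2 := derive_scale_eq d2 (differentiable_cst (row 2 z) t) E2
  (derive_cst (row 2 z) t (1 : R^o)).
have D0 := derive_cst (row 0 z) t (1 : R^o).
have v0 := @diff_derivable _ _ _ _ _ (1 : R^o) d0.
have vA := @diff_derivable _ _ _ _ _ (1 : R^o) dA.
have vB := @diff_derivable _ _ _ _ _ (1 : R^o) dB.
apply: (eq_trans (deriveD (derivableD v0 vA) vB)).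
apply: (eq_trans (congr2 +%R (deriveD v0 vA) D2)).
apply: (eq_trans (congr1 (fun T => T + _) (congr2 +%R D0 D1))).
by rewrite !scaler0 !addr0 add0r scale1r.
Qed.

Lemma derive2_quad z t : 'D_1 ('D_1 (quad z)) t = 2 *: row 2 z.
Proof.
pose f : R^o -> R^o := fun t => 2 * t.
have df s : differentiable f s.
  by apply: (@differentiableZ _ _ _ (idfun : R^o -> R^o) 2 s).
have dc : differentiable (cst (row 1 z) : R^o -> 'rV[R]_n) t by [].
have -> : 'D_1 (quad z) = cst (row 1 z) + (fun s : R^o => f s *: row 2 z).
  by apply/funext => s; exact: derive_quad.
have Df : 'D_1 f t = 2.
  have did : differentiable (idfun : R^o -> R^o) t by [].
  have Did : 'D_1 (idfun : R^o -> R^o) t = 1 by exact: derive_id.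
  apply: (eq_trans (@deriveZ _ _ _ (idfun : R^o -> R^o) 2 t 1 (diff_derivable did))).
  by rewrite Did /GRing.scale /= mulr1.
have D2 := derive_scale_eq (df t) (differentiable_cst (row 2 z) t) Df
  (derive_cst (row 2 z) t (1 : R^o)).
have dB := differentiable_scale (df t) (differentiable_cst (row 2 z) t).
have v1 := @diff_derivable _ _ _ _ _ (1 : R^o) dc.
have vB := @diff_derivable _ _ _ _ _ (1 : R^o) dB.
apply: (eq_trans (deriveD v1 vB)).
apply: (eq_trans (congr2 +%R (derive_cst (row 1 z) t (1 : R^o)) D2)).
by rewrite scaler0 addr0 add0r.
Qed.

End CurveCalculus.

Section Jets.
Context {R : realType} {n : nat} {M : smoothManifold R n}.
Implicit Types (c d : mchart M) (rho sigma : R -> M) (u v : jet2 M).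

Let ballR (e : R) : set R^o := [set t : R^o | `|t| < e].

Lemma ballR_open e : open (ballR e).
Proof.
rewrite (_ : ballR e = ball (0 : R^o) e); first exact: ball_open.
by rewrite -ball_normE; apply/seteqP; split => t /=; rewrite /ballR /= sub0r normrN.
Qed.

Lemma row_derive_curve c rho :
  [/\ row 0 (curve_coord c rho) = cmap c (rho 0),
      row 1 (curve_coord c rho) = 'D_1 (cmap c \o rho : R^o -> 'rV[R]_n) 0 &
      row 2 (curve_coord c rho) =
        2^-1 *: 'D_1 ('D_1 (cmap c \o rho : R^o -> 'rV[R]_n)) 0].
Proof.
have E (f : R^o -> 'rV[R]_n) : f^`()%classic = 'D_1 f.
  by apply/funext => t; exact: derive1E.
by have [] := row_curve_coord c rho; rewrite !E.
Qed.

Lemma curve_coord_transition c d rho : smooth_curve rho ->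
  cdom c (rho 0) -> cdom d (rho 0) ->
  curve_coord d rho = prolong (transition c d) (curve_coord c rho).
Proof.
move=> srho c0 d0.
have [e1 e10 [c1 s1]] := srho c c0; have [e2 e20 [c2 s2]] := srho d d0.
pose e := Num.min e1 e2; have e0 : 0 < e by rewrite lt_min e10.
have oB := @ballR_open e; pose gam : R^o -> 'rV[R]_n := cmap c \o rho.
have B0 : ballR e 0 by rewrite /ballR /= normr0.
have sg : smooth_on (ballR e) gam.
  by apply: smooth_sub s1 => t; rewrite /ballR /= lt_min => /andP[].
have cB t : ballR e t -> cdom c (rho t).
  by rewrite /ballR /= lt_min => /andP[te _]; exact: c1.
have dB t : ballR e t -> cdom d (rho t).
  by rewrite /ballR /= lt_min => /andP[_ te]; exact: c2.
have gO t : ballR e t -> overlap c d (gam t).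
  by move=> Bt; apply: overlap_cmap; [exact: cB|exact: dB].
have oO := overlap_open c d; have sphi := transition_smooth c d.
have E : {in ballR e, (cmap d \o rho : R^o -> 'rV[R]_n) =1 transition c d \o gam}.
  by move=> t; rewrite inE => Bt; rewrite /= transition_cmap//; exact: cB.
have D1 : {in ballR e, 'D_1 (cmap d \o rho : R^o -> 'rV[R]_n) =1
                       'D_1 (transition c d \o gam)}.
  by move=> t; rewrite inE => Bt; exact: (derive_open_eq (1 : R^o) oB Bt E).
have [r0 r1 r2] := row_derive_curve c rho.
have [q0 q1 q2] := row_derive_curve d rho.
have C1 := comp_curve_derive oO sphi oB sg gO B0.
have C2 := comp_curve_derive2 oO sphi oB sg gO B0.
have D10 : 'D_1 (cmap d \o rho : R^o -> 'rV[R]_n) 0 =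
           'D_1 (transition c d \o gam) 0 by apply: D1; rewrite inE.
have D20 := derive_open_eq (1 : R^o) oB B0 D1.
apply: row3P; rewrite /prolong.
- by rewrite row0_mx3 q0 r0 transition_cmap.
- by rewrite row1_mx3 q1 D10 C1 r1 /A0 r0.
- rewrite row2_mx3 q2 D20 C2 r2 /A0 /A1 r0 r1 scalerDr -scalemxAl.
  reflexivity.
Qed.

Lemma same_jet2_sym rho sigma : same_jet2 rho sigma -> same_jet2 sigma rho.
Proof.
by move=> [E0 E]; split=> // c cs k k2; rewrite (E c)// E0.
Qed.

Lemma same_jet2_trans rho sigma tau :
  same_jet2 rho sigma -> same_jet2 sigma tau -> same_jet2 rho tau.
Proof.
move=> [E0 E] [F0 F]; split=> [|c cr k k2]; first by rewrite E0.
by rewrite (E c)// (F c)// -E0.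
Qed.

(** One chart is enough to compare jets: the coordinates in any other chart are a function, the
    prolonged transition, of those in c. *)
Lemma same_jet2P c rho sigma : smooth_curve rho -> smooth_curve sigma ->
  cdom c (rho 0) -> cdom c (sigma 0) ->
  curve_coord c rho = curve_coord c sigma <-> same_jet2 rho sigma.
Proof.
move=> sr ss cr cs; split=> [E|[_ /(_ c cr) E]]; last exact/curve_coord_eq.
have E0 : rho 0 = sigma 0.
  rewrite -(cmapK cr) -(cmapK cs).
  have [<- _ _] := row_curve_coord c rho.
  by have [<- _ _] := row_curve_coord c sigma; rewrite E.
split=> // d dr; apply/curve_coord_eq.
have ds : cdom d (sigma 0) by rewrite -E0.
by rewrite (curve_coord_transition sr cr dr) (curve_coord_transition ss cs ds) E.
Qed.

Lemma jet2_curve_smooth u : smooth_curve (jet2_curve u).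
Proof. by rewrite /jet2_curve; case: cid2. Qed.

Lemma jet2_classE u : jet2_class u =
  [set sigma | smooth_curve sigma /\ same_jet2 (jet2_curve u) sigma].
Proof. by rewrite /jet2_curve; case: cid2. Qed.

Lemma jet2_class_inj u v : jet2_class u = jet2_class v -> u = v.
Proof.
case: u v => [A PA] [B PB] /= E; subst B.
by rewrite (Prop_irrelevance PA PB).
Qed.

Lemma jet2_eq u v : same_jet2 (jet2_curve u) (jet2_curve v) -> u = v.
Proof.
move=> uv; apply: jet2_class_inj; rewrite !jet2_classE.
apply/seteqP; split=> sigma [ss su]; split => //.
  exact: same_jet2_trans (same_jet2_sym uv) su.
exact: same_jet2_trans uv su.
Qed.

Lemma tcoord_inj c u v : tdom c u -> tdom c v -> tcoord c u = tcoord c v -> u = v.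
Proof.
move=> cu cv E; apply: jet2_eq.
exact: ((same_jet2P (@jet2_curve_smooth u) (@jet2_curve_smooth v) cu cv).1 E).
Qed.

Definition jet_of rho (srho : smooth_curve rho) : jet2 M :=
  Jet2 (ex_intro2 _ _ rho srho erefl).

Lemma jet_of_same rho (srho : smooth_curve rho) :
  same_jet2 rho (jet2_curve (jet_of srho)).
Proof.
have : jet2_class (jet_of srho) (jet2_curve (jet_of srho)).
  by rewrite jet2_classE; split; [exact: jet2_curve_smooth|split].
by move=> [].
Qed.

Lemma jet_of_tcoord rho (srho : smooth_curve rho) c : cdom c (rho 0) ->
  tdom c (jet_of srho) /\ tcoord c (jet_of srho) = curve_coord c rho.
Proof.
move=> cr; have S := jet_of_same srho; have [E0 _] := S.
have cj : tdom c (jet_of srho) by rewrite /tdom /= -E0.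
split => //; apply: esym.
exact: ((same_jet2P srho (@jet2_curve_smooth _) cr cj).2 S).
Qed.

Lemma row0_tcoord c u : row 0 (tcoord c u) = cmap c (jet2_curve u 0).
Proof. by have [] := row_curve_coord c (jet2_curve u). Qed.

Lemma tdom_jets_over c d u : tdom c u -> tdom d u ->
  jets_over (overlap c d) (tcoord c u).
Proof.
by move=> cu du; rewrite /jets_over /= row0_tcoord; exact: overlap_cmap.
Qed.

Lemma tcoord_transition c d u : tdom c u -> tdom d u ->
  tcoord d u = prolong (transition c d) (tcoord c u).
Proof. exact: (curve_coord_transition (@jet2_curve_smooth u)). Qed.

Lemma quad_smooth_curve c (z : 'M[R]_(3, n)) : (cmap c @` cdom c) (row 0 z) ->
  smooth_curve (cinv c \o quad z) /\ curve_coord c (cinv c \o quad z) = z.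
Proof.
move=> zc; pose q := quad z.
have q0 : q 0 = row 0 z by rewrite /q /quad scale0r addr0 expr2 mul0r scale0r addr0.
have sq := smooth_quad z; have cq : continuous q.
  by move=> t; exact: (smooth_continuous sq).
(* By openness of the overlap. Every chart d is treated because [smooth_curve] requires smoothness
   in all charts at the point. *)
have pre d : overlap c d (q 0) -> exists2 e : R, 0 < e &
    forall t, ballR e t -> overlap c d (q t).
  move=> d0.
  have : nbhs (0 : R^o) (q @^-1` overlap c d).
    by apply: cq; apply: open_nbhs_nbhs; split => //; exact: overlap_open.
  move=> /nbhs_ballP[e e0 eB]; exists e => // t te; apply: eB.
  by rewrite -ball_normE /= sub0r normrN.
split.
  move=> d; rewrite /= -/q => d0.
  have d0' : overlap c d (q 0).
    apply/overlapP; rewrite q0; split => //; last by rewrite -q0.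
    by move: zc => [p cp <-]; rewrite cmapK.
  have [e e0 eO] := pre d d0'; exists e => //; split.
    by move=> t te; have /overlapP[] := eO t te.
  move=> k; have oB := @ballR_open e.
  have sqe : smooth_on (ballR e) q by apply: smooth_sub sq.
  exact: (Ck_on_comp oB (overlap_open c d) eO (sqe k) (transition_smooth c d k)).
have [|e e0 eO] := pre c; first by rewrite overlapxx q0.
have oB := @ballR_open e; have B0 : ballR e 0 by rewrite /ballR /= normr0.
have E : {in ballR e, (cmap c \o (cinv c \o q) : R^o -> 'rV[R]_n) =1 q}.
  move=> t; rewrite inE => /eO[p [cp _] Ep]; rewrite [LHS]/= -/(q t) -Ep cmapK//.
have D1 : {in ballR e, 'D_1 (cmap c \o (cinv c \o q) : R^o -> 'rV[R]_n) =1 'D_1 q}.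
  by move=> t; rewrite inE => Bt; exact: (derive_open_eq (1 : R^o) oB Bt E).
have D10 : 'D_1 (cmap c \o (cinv c \o q) : R^o -> 'rV[R]_n) 0 = 'D_1 q 0.
  by apply: D1; rewrite inE.
have D20 := derive_open_eq (1 : R^o) oB B0 D1.
have [r0 r1 r2] := row_derive_curve c (cinv c \o q).
apply: row3P.
- by rewrite r0 -q0; apply: E; rewrite inE.
- by rewrite r1 D10 derive_quad mulr0 scale0r addr0.
- by rewrite r2 D20 derive2_quad scalerA mulVf ?scale1r// pnatr_eq0.
Qed.

(** Only the base point is constrained: any rows 1 and 2 are realised by a quadratic curve in the
    chart. *)
Lemma timgP c z : timg c z <-> (cmap c @` cdom c) (row 0 z).
Proof.
split=> [[u cu <-]|zc].
  by rewrite row0_tcoord; exists (jet2_curve u 0).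
have [srho E] := quad_smooth_curve zc.
have c0 : cdom c ((cinv c \o quad z) 0).
  rewrite /= /quad scale0r addr0 expr2 mul0r scale0r addr0.
  by move: zc => [p cp <-]; rewrite cmapK.
by have [cj Ej] := jet_of_tcoord srho c0; exists (jet_of srho); rewrite // Ej.
Qed.

Lemma timg_open c : open (timg c).
Proof.
rewrite (_ : timg c = jets_over (cmap c @` cdom c)).
  by apply: jets_over_open; exact: cimg_open.
by apply/seteqP; split => z /timgP.
Qed.

(** [tcoord c] is injective on its domain, so the set from which [xget] chooses is the singleton of
    [F u]. *)
Lemma inchartE (E : zmodType) c (F : jet2 M -> E) u : tdom c u ->
  inchart c F (tcoord c u) = F u.
Proof.
move=> cu; rewrite /inchart.
have : [set F u' | u' in tdom c `&` tcoord c @^-1` [set tcoord c u]] (F u).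
  by exists u.
move=> /(xgetI 0)[u' [cu' /= E'] <-].
by rewrite (tcoord_inj cu' cu E').
Qed.

Lemma jets_over_overlap c d z : jets_over (overlap c d) z <->
  exists u, [/\ tdom c u, tdom d u & tcoord c u = z].
Proof.
split=> [Oz|[u [cu du <-]]]; last exact: tdom_jets_over.
have [zc cz dz] := (overlapP c d (row 0 z)).1 Oz.
have [u cu E] := (timgP c z).2 zc; exists u; split => //.
by rewrite /tdom /= -(cmapK cu) -row0_tcoord E.
Qed.

Lemma inchart_transition (E : zmodType) c d (F : jet2 M -> E) z :
  jets_over (overlap c d) z ->
  inchart c F z = inchart d F (prolong (transition c d) z).
Proof.
by move=> /jets_over_overlap[u [cu du <-]]; rewrite -tcoord_transition// !inchartE.
Qed.

Lemma inchart_tcoord c d z : jets_over (overlap c d) z ->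
  inchart c (tcoord d) z = prolong (transition c d) z.
Proof.
by move=> /jets_over_overlap[u [cu du <-]]; rewrite inchartE// -tcoord_transition.
Qed.

Lemma jets_over_timg c d z : jets_over (overlap c d) z -> timg c z.
Proof. by move=> /jets_over_overlap[u [cu _ <-]]; exists u. Qed.

Lemma jets_over_prolong c d z : jets_over (overlap c d) z ->
  jets_over (overlap d c) (prolong (transition c d) z).
Proof.
move=> /jets_over_overlap[u [cu du <-]]; rewrite -tcoord_transition//.
exact: tdom_jets_over.
Qed.

End Jets.

(** * Tangent vectors *)

Section JetMx.
Context {R : realType} {n : nat}.
Implicit Types (xi eta : 'M[R]_(3, n)) (B : 'M[R]_n).

(* Row k of xi is the coefficient of t^k: this is multiplication by
   B0 + t B1 + t^2 B2 modulo t^3, and Jmx is multiplication by t. *)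
Definition jetmx B0 B1 B2 xi : 'M[R]_(3, n) :=
  mx3 (row 0 xi *m B0) (row 1 xi *m B0 + row 0 xi *m B1)
    (row 2 xi *m B0 + row 1 xi *m B1 + row 0 xi *m B2).

Lemma row_partial (k l : 'I_3) (i : 'I_n) :
  row k (partial l i : 'M[R]_(3, n)) = if k == l then delta_mx 0 i else 0.
Proof.
by apply/rowP => j; rewrite /partial !mxE; case: (k == l); rewrite !mxE.
Qed.

Lemma JmxE xi : Jmx xi = mx3 0 (row 0 xi) (row 1 xi).
Proof.
rewrite /Jmx; apply: row3P; rewrite row_mx3 linear_sum /=.
- by rewrite big1// => i _; rewrite linearD !linearZ /= !row_partial /= !scaler0 addr0.
- rewrite [RHS]row_sum_delta; apply: eq_bigr => i _.
  by rewrite linearD !linearZ /= !row_partial /= scaler0 addr0 mxE.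
- rewrite [RHS]row_sum_delta; apply: eq_bigr => i _.
  by rewrite linearD !linearZ /= !row_partial /= scaler0 add0r mxE.
Qed.

Lemma jetmx_Jmx B0 B1 B2 xi : jetmx B0 B1 B2 (Jmx xi) = Jmx (jetmx B0 B1 B2 xi).
Proof.
by rewrite !JmxE /jetmx !row_mx3 !mul0mx !addr0.
Qed.

End JetMx.

Section Tangent.
Context {R : realType} {n : nat} {M : smoothManifold R n}.
Implicit Types (c d e : mchart M) (u : jet2 M) (xi eta : 'M[R]_(3, n)).

Definition push c d u xi : 'M[R]_(3, n) :=
  'd (inchart c (tcoord d)) (tcoord c u) xi.

Lemma open_jets_overlap c d : open (jets_over (overlap c d)).
Proof. by apply: jets_over_open; exact: overlap_open. Qed.

Arguments open_jets_overlap : clear implicits.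

Lemma smooth_trans c d :
  smooth_on (jets_over (overlap c d)) (inchart c (tcoord d)).
Proof.
apply: (smooth_eq (f := prolong (transition c d))).
- exact: open_jets_overlap.
- by move=> z; rewrite inE => Oz; rewrite inchart_tcoord.
- apply: smooth_prolong; first exact: overlap_open.
  exact: transition_smooth.
Qed.

Lemma derive_trans c d z xi : jets_over (overlap c d) z ->
  'D_xi (inchart c (tcoord d)) z =
  jetmx (A0 (transition c d) z) (A1 (transition c d) z) (A2 (transition c d) z) xi.
Proof.
move=> Oz; have E : {in jets_over (overlap c d),
    inchart c (tcoord d) =1 prolong (transition c d)}.
  by move=> y; rewrite inE => Oy; rewrite inchart_tcoord.
apply: (eq_trans (derive_open_eq xi (open_jets_overlap c d) Oz E)).
exact: (derive_prolong (overlap_open c d) (transition_smooth c d)).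
Qed.

Lemma pushE c d u xi : tdom c u -> tdom d u ->
  push c d u xi = 'D_xi (inchart c (tcoord d)) (tcoord c u).
Proof.
move=> cu du; rewrite deriveE//.
exact: smooth_differentiable (smooth_trans c d) (tdom_jets_over cu du).
Qed.

Lemma push_jetmx c d u xi : tdom c u -> tdom d u ->
  let z := tcoord c u in push c d u xi =
  jetmx (A0 (transition c d) z) (A1 (transition c d) z) (A2 (transition c d) z) xi.
Proof.
by move=> cu du z; rewrite pushE// derive_trans//; exact: tdom_jets_over.
Qed.

Lemma pushJ c d u xi : tdom c u -> tdom d u ->
  push c d u (Jmx xi) = Jmx (push c d u xi).
Proof. by move=> cu du; rewrite !push_jetmx// jetmx_Jmx. Qed.

Lemma push_id c u xi : tdom c u -> push c c u xi = xi.
Proof.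
move=> cu; rewrite pushE//.
have E : {in jets_over (overlap c c), inchart c (tcoord c) =1 idfun}.
  by move=> z; rewrite inE => /jets_over_overlap[u' [cu' _ <-]]; rewrite inchartE.
apply: (eq_trans (derive_open_eq xi (open_jets_overlap c c) (tdom_jets_over cu cu) E)).
exact: derive_id.
Qed.

Lemma push_comp c d e u xi : tdom c u -> tdom d u -> tdom e u ->
  push d e u (push c d u xi) = push c e u xi.
Proof.
move=> cu du eu; rewrite (pushE _ du eu) (pushE _ cu du) (pushE _ cu eu).
have E : {in jets_over (overlap c d) `&` jets_over (overlap c e),
    inchart c (tcoord e) =1 inchart d (tcoord e) \o inchart c (tcoord d)}.
  move=> z; rewrite inE => -[/jets_over_overlap[u1 [cu1 du1 E1]]].
  move=> /jets_over_overlap[u2 [cu2 eu2 E2]].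
  have E12 : u1 = u2 by apply: (tcoord_inj cu1 cu2); rewrite E1 E2.
  by rewrite -E2 /= -E12 !inchartE// E12.
have oI := openI (open_jets_overlap c d) (open_jets_overlap c e).
have Iz : (jets_over (overlap c d) `&` jets_over (overlap c e)) (tcoord c u).
  by split; exact: tdom_jets_over.
apply: esym; apply: (eq_trans (derive_open_eq xi oI Iz E)).
have d1 := smooth_differentiable (smooth_trans c d) (tdom_jets_over cu du).
have d2 : differentiable (inchart d (tcoord e)) (inchart c (tcoord d) (tcoord c u)).
  rewrite (inchartE (tcoord d) cu).
  exact: smooth_differentiable (smooth_trans d e) (tdom_jets_over du eu).
apply: (eq_trans (derive_comp xi d1 d2)).
by rewrite (inchartE (tcoord d) cu).
Qed.

Lemma push_linear c d u (a : R) xi eta :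
  push c d u (a *: xi + eta) = a *: push c d u xi + push c d u eta.
Proof. by rewrite /push linearP. Qed.

Lemma push0 c d u : push c d u 0 = 0.
Proof. by rewrite /push linear0. Qed.

Lemma pushZ c d u (a : R) xi : push c d u (a *: xi) = a *: push c d u xi.
Proof. by rewrite /push linearZ. Qed.

(** The tangent vector at u whose components in c are xi; the value 0 in charts away from u is
    imposed by [tangent]. *)
Definition mktangent c u xi : tvector M :=
  fun d => if `[< tdom d u >] then push c d u xi else 0.

Lemma mktangent_self c u xi : tdom c u -> mktangent c u xi c = xi.
Proof. by move=> cu; rewrite /mktangent asboolT// push_id. Qed.

Lemma mktangentP c u xi : tdom c u -> tangent u (mktangent c u xi).
Proof.
move=> cu; split=> [d e du eu|d /asboolF E]; last by rewrite /mktangent E.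
rewrite -/(push d e u _) /mktangent !asboolT//.
by rewrite push_comp.
Qed.

Lemma tangent_push u (v : tvector M) c d : tangent u v -> tdom c u -> tdom d u ->
  v d = push c d u (v c).
Proof. by move=> [+ _]; exact. Qed.

Lemma tangent_eq c u (v w : tvector M) : tdom c u -> tangent u v -> tangent u w ->
  v c = w c -> v = w.
Proof.
move=> cu tv tw E; apply/funext => d.
have [du|nd] := pselect (tdom d u).
  by rewrite (tangent_push tv cu du) (tangent_push tw cu du) E.
by rewrite (tv.2 _ nd) (tw.2 _ nd).
Qed.

Lemma tangent_lin u (a : R) v w : tangent u v -> tangent u w ->
  tangent u (a *: v + w).
Proof.
move=> tv tw; split=> [c d cu du|c nc].
  rewrite !fctE -/(push c d u _) push_linear.
  by rewrite -(tangent_push tv cu du) -(tangent_push tw cu du).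
by rewrite !fctE (tv.2 _ nc) (tw.2 _ nc) scaler0 addr0.
Qed.

Lemma tangent0 u : tangent u 0.
Proof.
split=> [c d cu du|//]; by rewrite -/(push c d u _) push0.
Qed.

Lemma tangentJ u v : tangent u v -> tangent u (J v).
Proof.
move=> tv; split=> [c d cu du|c nc].
  by rewrite -/(push c d u _) /J pushJ// -(tangent_push tv cu du).
by rewrite /J (tv.2 _ nc) JmxE !linear0; apply: row3P; rewrite row_mx3 linear0.
Qed.

Lemma tdom_exists u : exists c, tdom c u.
Proof.
by have [c ac cu] := @atlas_cover _ _ M (jet2_curve u 0); exists (exist _ c ac).
Qed.

(** Row 0 of pushing from c to d and back is multiplication by the two Jacobians in turn, and the
    round trip is the identity. *)
Lemma A0_unit c d u : tdom c u -> tdom d u ->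
  A0 (transition c d) (tcoord c u) \in unitmx.
Proof.
move=> cu du.
suff : A0 (transition c d) (tcoord c u) *m A0 (transition d c) (tcoord d u) = 1%:M.
  by move=> /mulmx1_unit[uA _]; exact: uA.
apply/row_matrixP => i; rewrite rowE mulmxA.
have := push_comp (mx3 (delta_mx 0 i) 0 0) cu du cu.
rewrite push_id// !push_jetmx// => /(congr1 (row 0)).
by rewrite /jetmx !row_mx3 => ->; rewrite rowE mulmx1.
Qed.

End Tangent.

Arguments open_jets_overlap {R n M} c d.
Arguments smooth_trans {R n M} c d.

(** * The tensors omega and g^c *)

Section Dot.
Context {R : realType} {n : nat}.

Definition dot (a b : 'rV[R]_n) : R^o := (a *m b^T) 0 0.

Lemma dot_linear a : linear (dot a).
Proof.
move=> k b b'.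
by rewrite /dot linearD linearZ /= mulmxDr -scalemxAr mxE [in LHS]mxE.
Qed.

HB.instance Definition _ a :=
  GRing.isLinear.Build R 'rV[R]_n R^o _ (dot a) (dot_linear a).

Lemma dotE a b : dot a b = \sum_i a 0 i * b 0 i.
Proof. by rewrite /dot mxE; apply: eq_bigr => i _; rewrite mxE. Qed.

Lemma dotC a b : dot a b = dot b a.
Proof. by rewrite !dotE; apply: eq_bigr => i _; rewrite mulrC. Qed.

Lemma dot_mulmx a b (B : 'M[R]_n) : dot a (b *m B^T) = dot (a *m B) b.
Proof. by rewrite /dot trmx_mul trmxK mulmxA. Qed.

Lemma dotDr a b b' : dot a (b + b') = dot a b + dot a b'.
Proof. exact: linearD. Qed.

Lemma dotDl a a' b : dot (a + a') b = dot a b + dot a' b.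
Proof. by rewrite /dot mulmxDl mxE. Qed.

Lemma dotZl k a b : dot (k *: a) b = k * dot a b.
Proof. by rewrite /dot -scalemxAl mxE. Qed.

Lemma dotNl a b : dot (- a) b = - dot a b.
Proof. by rewrite /dot mulNmx mxE. Qed.

Lemma dot0l b : dot 0 b = 0.
Proof. by rewrite /dot mul0mx mxE. Qed.

Lemma dot0r a : dot a 0 = 0.
Proof. exact: linear0. Qed.

(* The t^2 coefficient of xi(t) G(t) eta(t)^T. *)
Definition gcm (G0 G1 G2 : 'M[R]_n) (xi eta : 'M[R]_(3, n)) : R :=
  dot (row 0 xi *m G0) (row 2 eta) + dot (row 1 xi *m G0) (row 1 eta) +
  dot (row 2 xi *m G0) (row 0 eta) + dot (row 0 xi *m G1) (row 1 eta) +
  dot (row 1 xi *m G1) (row 0 eta) + dot (row 0 xi *m G2) (row 0 eta).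

(** The matrices on the left are the coefficients of B(t) G(t) B(t)^T, so this is associativity of
    the product xi(t) B(t) G(t) B(t)^T eta(t)^T at order t^2. *)
Lemma gcm_jetmx (B0 B1 B2 G0 G1 G2 : 'M[R]_n) xi eta :
  gcm (B0 *m G0 *m B0^T)
    (B1 *m G0 *m B0^T + B0 *m G1 *m B0^T + B0 *m G0 *m B1^T)
    (B2 *m G0 *m B0^T + B1 *m G1 *m B0^T + B1 *m G0 *m B1^T +
     B0 *m G2 *m B0^T + B0 *m G1 *m B1^T + B0 *m G0 *m B2^T) xi eta =
  gcm G0 G1 G2 (jetmx B0 B1 B2 xi) (jetmx B0 B1 B2 eta).
Proof.
have D a b (B : 'M[R]_n) : dot (a *m B^T) b = dot a (b *m B).
  by rewrite [LHS]dotC dot_mulmx dotC.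
rewrite /gcm /jetmx !row_mx3.
rewrite !(mulmxDr, mulmxDl, dotDl, dotDr, mulmxA) !D.
ring.
Qed.

Lemma sum_dot (G : 'M[R]_n) (a b : 'rV[R]_n) :
  dot (a *m G) b = \sum_i \sum_j G i j * (a 0 i * b 0 j).
Proof.
rewrite dotE exchange_big /=; apply: eq_bigr => j _.
by rewrite mxE mulr_suml; apply: eq_bigr => i _; rewrite mulrCA mulrA.
Qed.

End Dot.

Lemma derive_tr (R : realType) (V : normedModType R) (p q : nat)
    (F : V -> 'M[R]_(p, q)) x v : differentiable F x ->
  'D_v (fun y => (F y)^T) x = ('D_v F x)^T.
Proof.
move=> dF; apply: (@derive_lin _ _ _ _ (trmx : {linear _ -> 'M[R]_(q, p)})) => //.
exact: linear_mx_continuous.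
Qed.

Lemma differentiable_tr (R : realType) (V : normedModType R) (p q : nat)
    (F : V -> 'M[R]_(p, q)) x : differentiable F x ->
  differentiable (fun y => (F y)^T) x.
Proof.
move=> dF; apply: (differentiable_comp dF).
apply: (@linear_differentiable _ _ _ (trmx : {linear _ -> 'M[R]_(q, p)})).
exact: linear_mx_continuous.
Qed.

Lemma derive_matrix_basis (R : realType) (p q : nat) (W : normedModType R)
    (F : 'M[R]_(p, q) -> W) x a : differentiable F x ->
  'D_a F x = \sum_i \sum_j a i j *: 'D_(delta_mx i j) F x.
Proof.
move=> dF; rewrite deriveE// {1}(matrix_sum_delta a) linear_sum.
apply: eq_bigr => i _; rewrite linear_sum; apply: eq_bigr => j _.
by rewrite linearZ deriveE.
Qed.

Lemma row0_jetmx (R : realType) (n : nat) (B0 B1 B2 : 'M[R]_n) xi :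
  row 0 (jetmx B0 B1 B2 xi) = row 0 xi *m B0.
Proof. exact: row0_mx3. Qed.

Lemma jetmx_partial2 (R : realType) (n : nat) (B0 B1 B2 : 'M[R]_n) i :
  jetmx B0 B1 B2 (partial 2 i) = \sum_k B0 i k *: partial 2 k.
Proof.
apply: row3P; rewrite /jetmx row_mx3 !row_partial /= ?mul0mx ?addr0 linear_sum /=.
- by rewrite big1// => k _; rewrite linearZ /= row_partial scaler0.
- by rewrite big1// => k _; rewrite linearZ /= row_partial scaler0.
- rewrite -rowE [LHS]row_sum_delta; apply: eq_bigr => k _.
  by rewrite linearZ /= row_partial /= mxE.
Qed.

(** With S(A0) = A1, S(A1) = 2 A2, and S, T standing for the first two derivatives of G along the
    spray, the left side is half the second derivative of A0 G A0^T; the right side is the t^2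
    coefficient of A(t) G(t) A(t)^T. *)
Lemma halve_second_derivative (R : realType) (n : nat)
    (A0 A1 A2 G S T : 'M[R]_n) :
  2^-1 *: (((2 *: A2) *m G + A1 *m S) *m A0^T + A1 *m G *m A1^T +
    ((A1 *m S + A0 *m T) *m A0^T + A0 *m S *m A1^T) +
    ((A1 *m G + A0 *m S) *m A1^T + A0 *m G *m (2 *: A2)^T)) =
  A2 *m G *m A0^T + A1 *m S *m A0^T + A1 *m G *m A1^T +
  A0 *m (2^-1 *: T) *m A0^T + A0 *m S *m A1^T + A0 *m G *m A2^T.
Proof.
rewrite linearZ /= !mulmxDl -!scalemxAr -!scalemxAl.
move: (A2 *m G *m A0^T) (A1 *m S *m A0^T) (A1 *m G *m A1^T) (A0 *m T *m A0^T)
  (A0 *m S *m A1^T) (A0 *m G *m A2^T) => x1 x2 x3 x4 x5 x6.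
by apply/matrixP => i j; rewrite !mxE; field.
Qed.

Section Tensors.
Context {R : realType} {n : nat} {M : smoothManifold R n}.
Implicit Types (c d e : mchart M) (u : jet2 M) (z xi eta : 'M[R]_(3, n)).

Definition Phi c d : 'M[R]_(3, n) -> 'M[R]_(3, n) := inchart c (tcoord d).
Definition B0 c d := A0 (transition c d).
Definition B1 c d := A1 (transition c d).
Definition B2 c d := A2 (transition c d).
Notation tov c d := (jets_over (overlap c d)).

Lemma derive_pull c d (W : normedModType R) (F : 'M[R]_(3, n) -> W) z xi :
  tov c d z -> differentiable F (Phi c d z) ->
  'D_xi (F \o Phi c d) z =
  'D_(jetmx (B0 c d z) (B1 c d z) (B2 c d z) xi) F (Phi c d z).
Proof.
move=> Oz dF; have dP := smooth_differentiable (smooth_trans c d) Oz.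
apply: (eq_trans (derive_comp xi dP dF)).
by rewrite (derive_trans xi Oz).
Qed.

Lemma Phi_timg c d z : tov c d z -> timg d (Phi c d z).
Proof.
by move=> /jets_over_overlap[u [cu du <-]]; rewrite /Phi inchartE//; exists u.
Qed.

Lemma differentiable_pull c d (W : normedModType R) (F : 'M[R]_(3, n) -> W) z :
  tov c d z -> smooth_on (timg d) F -> differentiable (F \o Phi c d) z.
Proof.
move=> Oz sF; apply: differentiable_comp.
  exact: smooth_differentiable (smooth_trans c d) Oz.
exact: smooth_differentiable sF (Phi_timg Oz).
Qed.

Lemma smooth_B0 c d : smooth_on (tov c d) (B0 c d).
Proof. exact: smooth_A0 (overlap_open c d) (transition_smooth c d). Qed.

Lemma smooth_B1 c d : smooth_on (tov c d) (B1 c d).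
Proof. exact: smooth_A1 (overlap_open c d) (transition_smooth c d). Qed.

(** * How the metric and omega transform under a change of charts *)

Section Lagrangian.
Variable L : jet2 M -> R.
Hypothesis sL : smooth_fun L.

(** The momenta dL/dy^(2)i, which are the coefficients of theta^2 in the dx^i. *)
Definition pL c z : 'rV[R]_n := \row_i 'D_(partial 2 i) (Lc L c) z.

Lemma smooth_pL c : smooth_on (timg c) (pL c).
Proof.
move=> k; apply/(Ck_on_mx _ _ (@timg_open _ _ _ c)) => i j.
under eq_fun do rewrite mxE.
exact: (smooth_derive (partial 2 j) (sL c)).
Qed.

Lemma Lc_trans c d : {in tov c d, Lc L c =1 Lc L d \o Phi c d}.
Proof.
move=> z; rewrite inE => Oz; rewrite /Lc /= /Phi inchart_tcoord//.
exact: inchart_transition.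
Qed.

Lemma pL_trans c d z : tov c d z ->
  pL c z = pL d (Phi c d z) *m (B0 c d z)^T.
Proof.
move=> Oz; apply/rowP => i; rewrite mxE.
have dL := smooth_differentiable (sL d) (Phi_timg Oz).
apply: (eq_trans (derive_open_eq _ (open_jets_overlap c d) Oz (@Lc_trans c d))).
apply: (eq_trans (derive_pull _ Oz dL)); rewrite jetmx_partial2.
rewrite derive_sumd// mxE; apply: eq_bigr => k _.
by rewrite deriveZd// !mxE mulrC.
Qed.

Lemma derive_pL_trans c d z xi : tov c d z ->
  'D_xi (pL c) z =
  'D_(jetmx (B0 c d z) (B1 c d z) (B2 c d z) xi) (pL d) (Phi c d z)
     *m (B0 c d z)^T +
  pL d (Phi c d z) *m ('D_(row 0 xi) (Jac (transition c d)) (row 0 z))^T.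
Proof.
move=> Oz; have E : {in tov c d, pL c =1
    fun y => (pL d \o Phi c d) y *m (B0 c d y)^T}.
  by move=> y; rewrite inE => Oy; exact: pL_trans.
apply: (eq_trans (derive_open_eq xi (open_jets_overlap c d) Oz E)).
have d1 := differentiable_pull Oz (@smooth_pL d).
have d0 : differentiable (B0 c d) z := smooth_differentiable (smooth_B0 c d) Oz.
have D0 : 'D_xi (B0 c d) z = 'D_(row 0 xi) (Jac (transition c d)) (row 0 z).
  exact: (derive_A0 (overlap_open c d) (transition_smooth c d)).
have D1 : 'D_xi (pL d \o Phi c d) z =
    'D_(jetmx (B0 c d z) (B1 c d z) (B2 c d z) xi) (pL d) (Phi c d z).
  exact: (derive_pull xi Oz (smooth_differentiable (@smooth_pL d) (Phi_timg Oz))).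
have D2 := eq_trans (derive_tr xi d0) (congr1 trmx D0).
exact: (derive_mulmx_eq d1 (differentiable_tr d0) D1 D2).
Qed.

Lemma row_metric c z i : timg c z ->
  row i (metric L c z) = 2^-1 *: 'D_(partial 2 i) (pL c) z.
Proof.
move=> zc; have dp := smooth_differentiable (@smooth_pL c) zc.
apply/rowP => j; have E : (fun y => pL c y 0 j : R^o) = 'D_(partial 2 j) (Lc L c).
  by apply/funext => y; rewrite /pL mxE.
have H := derive_coord (partial 2 i) 0 j dp; rewrite E in H.
by rewrite [LHS]mxE [RHS]mxE H mxE.
Qed.

Lemma metric_trans c d z : tov c d z ->
  metric L c z = B0 c d z *m metric L d (Phi c d z) *m (B0 c d z)^T.
Proof.
move=> Oz; have zc := jets_over_timg Oz; have wd := Phi_timg Oz.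
have dp := smooth_differentiable (@smooth_pL d) wd.
apply/row_matrixP => i; rewrite row_metric//.
rewrite (derive_pL_trans (partial 2 i) Oz).
(* The term with the derivative of [B0] drops out: [B0] depends on the base point only, and
   [partial 2 i] does not move it. *)
rewrite jetmx_partial2 row_partial /= derive0 trmx0 mulmx0 addr0.
rewrite derive_sumd// !row_mul scalemxAl; congr (_ *m _).
rewrite mulmx_sum_row scaler_sumr; apply: eq_bigr => k _.
rewrite deriveZd// (row_metric _ wd) scalerA [RHS]scalerA mulrC.
by rewrite [row i _ 0 k]mxE.
Qed.

Lemma smooth_metric c : smooth_on (timg c) (metric L c).
Proof.
move=> k; apply/(Ck_on_mx _ _ (@timg_open _ _ _ c)) => i j.
under eq_fun do rewrite mxE.
apply: (Ck_onZ (f := 'D_(partial 2 i) ('D_(partial 2 j) (Lc L c)))).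
  exact: timg_open.
exact: (smooth_derive (partial 2 i) (smooth_derive (partial 2 j) (sL c))).
Qed.

Lemma metric_tensor_sym c z : timg c z -> (metric L c z)^T = metric L c z.
Proof.
move=> zc; apply/matrixP => i j; rewrite [LHS]mxE /metric [LHS]mxE [RHS]mxE.
exact: (congr1 ( *%R 2^-1) (derive_commute (partial 2 j) (partial 2 i)
  (@timg_open _ _ _ c) (sL c 2) zc)).
Qed.

Lemma theta2E c z xi : timg c z -> theta2 L c z xi = dot (row 0 xi) (pL c z).
Proof.
move=> zc; have dL := smooth_differentiable (sL c) zc.
rewrite /theta2 -deriveE//.
have -> : Jmx (Jmx xi) = \sum_i xi 0 i *: partial 2 i.
  apply: row3P; rewrite !JmxE !row_mx3 linear_sum /=.
  - by rewrite big1// => k _; rewrite linearZ /= row_partial scaler0.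
  - by rewrite big1// => k _; rewrite linearZ /= row_partial scaler0.
  - rewrite [LHS]row_sum_delta; apply: eq_bigr => k _.
    by rewrite linearZ /= row_partial /= mxE.
rewrite derive_sumd// dotE; apply: eq_bigr => k _.
by rewrite deriveZd// !mxE.
Qed.

Lemma omega2E c z xi eta : timg c z -> omega2 L c z xi eta =
  dot (row 0 eta) ('D_xi (pL c) z) - dot (row 0 xi) ('D_eta (pL c) z).
Proof.
move=> zc; have dp := smooth_differentiable (@smooth_pL c) zc.
have D a b : 'D_a ((theta2 L c) ^~ b : _ -> R^o) z = dot (row 0 b) ('D_a (pL c) z).
  have E : {in timg c, ((theta2 L c) ^~ b : _ -> R^o) =1 dot (row 0 b) \o pL c}.
    by move=> y; rewrite inE => yc; exact: theta2E.
  apply: (eq_trans (derive_open_eq a (@timg_open _ _ _ c) zc E)).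
  apply: (@derive_lin _ _ _ _ (dot (row 0 b))) => //.
  exact: linear_mx_continuous.
by rewrite /omega2 /exterior_derivative !D.
Qed.

Lemma omega2_trans c d z xi eta : tov c d z -> omega2 L c z xi eta =
  omega2 L d (Phi c d z) (jetmx (B0 c d z) (B1 c d z) (B2 c d z) xi)
    (jetmx (B0 c d z) (B1 c d z) (B2 c d z) eta).
Proof.
move=> Oz; rewrite (omega2E _ _ (jets_over_timg Oz)) (omega2E _ _ (Phi_timg Oz)).
rewrite (derive_pL_trans xi Oz) (derive_pL_trans eta Oz) !dotDr !dot_mulmx.
rewrite !row0_jetmx.
(* The inhomogeneous terms in the derivative of [pL] are symmetric in xi and eta, so they cancel in
   the antisymmetric omega. *)
have -> : row 0 eta *m 'D_(row 0 xi) (Jac (transition c d)) (row 0 z) =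
          row 0 xi *m 'D_(row 0 eta) (Jac (transition c d)) (row 0 z).
  exact: (derive_Jac_sym (overlap_open c d) (transition_smooth c d)).
have addrKK (a b t : R) : a + t - (b + t) = a - b by ring.
exact: addrKK.
Qed.

(** * First and second derivatives of the metric along a semispray *)

Section Spray.
Variable S : jet2 M -> tvector M.
Hypothesis spray : semispray S.

Definition Sx c : 'M[R]_(3, n) -> 'M[R]_(3, n) := inchart c (S ^~ c).

Lemma smooth_Sx c : smooth_on (timg c) (Sx c).
Proof. by have [[_ +] _] := spray; apply. Qed.

Lemma row_Sx c z : timg c z ->
  row 0 (Sx c z) = row 1 z /\ row 1 (Sx c z) = 2 *: row 2 z.
Proof.
move=> [u cu <-]; rewrite /Sx inchartE//.
have [_ /(_ c u cu)] := spray; rewrite /J JmxE => E.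
split; [move/(congr1 (row 1)) : E|move/(congr1 (row 2)) : E];
  rewrite row_mx3 => ->; rewrite linear_sum /= [RHS]row_sum_delta;
  apply: eq_bigr => i _; rewrite linearD !linearZ /= !row_partial /=.
  by rewrite scaler0 addr0 [row 1 _ 0 i]mxE.
rewrite scaler0 add0r; congr (_ *: _); rewrite [RHS]mxE.
by congr (_ * _); rewrite [RHS]mxE.
Qed.

Lemma Sx_trans c d z : tov c d z ->
  jetmx (B0 c d z) (B1 c d z) (B2 c d z) (Sx c z) = Sx d (Phi c d z).
Proof.
move=> /jets_over_overlap[u [cu du <-]].
rewrite /Sx /Phi !inchartE//.
have [[tS _] _] := spray.
by rewrite (tangent_push (tS u) cu du) push_jetmx.
Qed.

Definition SD c (p q : nat) (F : 'M[R]_(3, n) -> 'M[R]_(p, q)) z :=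
  'D_(Sx c z) F z.

Lemma smooth_SD c p q (F : 'M[R]_(3, n) -> 'M[R]_(p, q)) :
  smooth_on (timg c) F -> smooth_on (timg c) (SD c F).
Proof.
move=> sF; have oc := @timg_open _ _ _ c.
apply: (smooth_eq (f := fun z => \sum_i \sum_j
   Sx c z i j *: 'D_(delta_mx i j) F z) oc).
  move=> z; rewrite inE => zc; apply: esym; apply: derive_matrix_basis.
  exact: smooth_differentiable sF zc.
move=> k; apply: Ck_on_sum => // i _; apply: Ck_on_sum => // j _.
have sS : smooth_on (timg c) (fun z => Sx c z i j : R^o).
  by move=> m; apply: (Ck_on_mx _ _ oc).1; exact: smooth_Sx.
exact: (smooth_scale oc sS (smooth_derive (delta_mx i j) sF)).
Qed.

Lemma SD_pull c d p q (F : 'M[R]_(3, n) -> 'M[R]_(p, q)) z : tov c d z ->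
  smooth_on (timg d) F ->
  'D_(Sx c z) (F \o Phi c d) z = SD d F (Phi c d z).
Proof.
move=> Oz sF.
apply: (eq_trans (derive_pull _ Oz (smooth_differentiable sF (Phi_timg Oz)))).
by rewrite Sx_trans.
Qed.

Lemma SD_B0 c d z : tov c d z -> 'D_(Sx c z) (B0 c d) z = B1 c d z.
Proof.
move=> Oz; have [E _] := row_Sx (jets_over_timg Oz).
apply: (eq_trans (derive_A0 (overlap_open c d) (transition_smooth c d) _ Oz)).
by rewrite E.
Qed.

(** [B1] depends on rows 0 and 1 only, where a semispray is prescribed as y^(1) and 2 y^(2); the
    latter 2 is matched by the 1/2 in [A2]. *)
Lemma SD_B1 c d z : tov c d z -> 'D_(Sx c z) (B1 c d) z = 2 *: B2 c d z.
Proof.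
move=> Oz; have [E0 E1] := row_Sx (jets_over_timg Oz).
apply: (eq_trans (derive_A1 (overlap_open c d) (transition_smooth c d) _ Oz)).
rewrite E0 E1 /B2 /A2 scalerDr scalerA mulfV ?pnatr_eq0// scale1r.
rewrite deriveZd//.
exact: smooth_differentiable (smooth_Jac (overlap_open c d) (transition_smooth c d)) Oz.
Qed.

Notation G c := (metric L c).
Definition SG c := SD c (metric L c).
Definition SSG c := SD c (SG c).

Lemma smooth_SG c : smooth_on (timg c) (SG c).
Proof. exact: smooth_SD (@smooth_metric c). Qed.

(** A and B are kept apart for the mixed terms B1 G B0^T and B0 G B1^T of S(G), which are
    differentiated again in [SSG_trans]. *)
Lemma derive_conj c d (A B : 'M[R]_(3, n) -> 'M[R]_n) (F : 'M[R]_(3, n) -> 'M[R]_n)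
    z dA dB : tov c d z -> smooth_on (timg d) F ->
  differentiable A z -> differentiable B z ->
  'D_(Sx c z) A z = dA -> 'D_(Sx c z) B z = dB ->
  'D_(Sx c z) (fun y => A y *m (F \o Phi c d) y *m (B y)^T) z =
    (dA *m F (Phi c d z) + A z *m SD d F (Phi c d z)) *m (B z)^T +
    A z *m F (Phi c d z) *m dB^T.
Proof.
move=> Oz sF Ad Bd DA DB.
have dF := differentiable_pull Oz sF.
have D1 := derive_mulmx_eq Ad dF DA (SD_pull Oz sF).
have D2 := eq_trans (derive_tr (Sx c z) Bd) (congr1 trmx DB).
exact: (derive_mulmx_eq (differentiable_mulmx Ad dF) (differentiable_tr Bd) D1 D2).
Qed.

Lemma SG_trans c d z : tov c d z -> let w := Phi c d z in
  SG c z = B1 c d z *m G d w *m (B0 c d z)^T + B0 c d z *m SG d w *m (B0 c d z)^T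
    + B0 c d z *m G d w *m (B1 c d z)^T.
Proof.
move=> Oz w; have E : {in tov c d, G c =1
    fun y => B0 c d y *m (G d \o Phi c d) y *m (B0 c d y)^T}.
  by move=> y; rewrite inE => Oy; exact: metric_trans.
have d0 : differentiable (B0 c d) z := smooth_differentiable (smooth_B0 c d) Oz.
apply: (eq_trans (derive_open_eq _ (open_jets_overlap c d) Oz E)).
apply: (eq_trans (derive_conj Oz (@smooth_metric d) d0 d0 (SD_B0 Oz) (SD_B0 Oz))).
by rewrite mulmxDl.
Qed.

Lemma SSG_trans c d z : tov c d z -> let w := Phi c d z in
  let A0 := B0 c d z in let A1 := B1 c d z in let A2 := B2 c d z in
  2^-1 *: SSG c z = A2 *m G d w *m A0^T + A1 *m SG d w *m A0^T
    + A1 *m G d w *m A1^T + A0 *m (2^-1 *: SSG d w) *m A0^T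
    + A0 *m SG d w *m A1^T + A0 *m G d w *m A2^T.
Proof.
move=> Oz w A0 A1 A2.
pose T1 y := B1 c d y *m (G d \o Phi c d) y *m (B0 c d y)^T.
pose T2 y := B0 c d y *m (SG d \o Phi c d) y *m (B0 c d y)^T.
pose T3 y := B0 c d y *m (G d \o Phi c d) y *m (B1 c d y)^T.
have E : {in tov c d, SG c =1 T1 + T2 + T3}.
  by move=> y; rewrite inE => Oy; exact: SG_trans.
have d0 : differentiable (B0 c d) z := smooth_differentiable (smooth_B0 c d) Oz.
have d1 : differentiable (B1 c d) z := smooth_differentiable (smooth_B1 c d) Oz.
have dG := differentiable_pull Oz (@smooth_metric d).
have dS := differentiable_pull Oz (@smooth_SG d).
have D1 := derive_conj Oz (@smooth_metric d) d1 d0 (SD_B1 Oz) (SD_B0 Oz).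
have D2 := derive_conj Oz (@smooth_SG d) d0 d0 (SD_B0 Oz) (SD_B0 Oz).
have D3 := derive_conj Oz (@smooth_metric d) d0 d1 (SD_B0 Oz) (SD_B1 Oz).
have v1 : derivable T1 z (Sx c z).
  apply: diff_derivable.
  exact: differentiable_mulmx (differentiable_mulmx d1 dG) (differentiable_tr d0).
have v2 : derivable T2 z (Sx c z).
  apply: diff_derivable.
  exact: differentiable_mulmx (differentiable_mulmx d0 dS) (differentiable_tr d0).
have v3 : derivable T3 z (Sx c z).
  apply: diff_derivable.
  exact: differentiable_mulmx (differentiable_mulmx d0 dG) (differentiable_tr d1).
have E1 : SSG c z = 'D_(Sx c z) T1 z + 'D_(Sx c z) T2 z + 'D_(Sx c z) T3 z.
  apply: (eq_trans (derive_open_eq _ (open_jets_overlap c d) Oz E)).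
  apply: (eq_trans (deriveD (derivableD v1 v2) v3)).
  exact: (congr1 (fun X => X + _) (deriveD v1 v2)).
rewrite E1; apply: (eq_trans _ (halve_second_derivative A0 A1 A2 _ _ _)).
exact: (congr1 ( *:%R 2^-1) (congr2 +%R (congr2 +%R D1 D2) D3)).
Qed.

End Spray.

End Lagrangian.
End Tensors.

(** * The pointwise system for the local coefficients *)

Section Algebra.
Context {R : realType} {n : nat}.
Implicit Types (a b : 'rV[R]_n) (K G X Y Z : 'M[R]_n).

(* The delta/delta x^i are the [hor K1 K2 e_i] when K_k = - N_k^T. *)
Definition hor K1 K2 a : 'M[R]_(3, n) := mx3 a (a *m K1) (a *m K2).

Lemma Jmx_hor K1 K2 a : Jmx (hor K1 K2 a) = mx3 0 a (a *m K1).
Proof. by rewrite JmxE /hor !row_mx3. Qed.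

Lemma dot_mulmxr a b X : dot a (b *m X) = dot (a *m X^T) b.
Proof. by rewrite -{1}(trmxK X) dot_mulmx. Qed.

Lemma dot_eq0 X : (forall a b, dot (a *m X) b = 0) <-> X = 0.
Proof.
split=> [H|-> a b]; last by rewrite mulmx0 dot0l.
apply/matrixP => i j; have := H (delta_mx 0 i) (delta_mx 0 j).
rewrite dotE (bigD1 j)//= big1 ?addr0; last first.
  by move=> k kj; rewrite [delta_mx _ _ _ _]mxE (negbTE kj) andbF mulr0.
by rewrite -rowE !mxE !eqxx mulr1.
Qed.

Section Solve.
Variables (G0 G1 G2 P0 P1 : 'M[R]_n).
Hypotheses (G0u : G0 \in unitmx) (G0s : G0^T = G0) (G1s : G1^T = G1)
  (G2s : G2^T = G2).

(* The first equation determines X = K1 G0, the other two the symmetric and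
   antisymmetric parts of Z = K2 G0. *)
Definition solves K1 K2 :=
  [/\ 4 *: (K1 *m G0)^T + 2 *: (K1 *m G0) = - P1^T - 2 *: G1,
      K2 *m G0 + (K2 *m G0)^T =
        - (K1 *m G0 *m K1^T + G1 *m K1^T + K1 *m G1 + G2) &
      2 *: (K2 *m G0 - (K2 *m G0)^T) =
        - (P0 + K1 *m P1 - (P0 + K1 *m P1)^T)].

(** Put Y = - P1^T - 2 G1. From 4 X^T + 2 X = Y and its transpose, 2 Y^T - Y = 6 X; Y^T is written
    with G1 in place of G1^T. *)
Definition sol1 : 'M[R]_n :=
  6^-1 *: (2 *: (- P1 - 2 *: G1) - (- P1^T - 2 *: G1)) *m invmx G0.

(** If Z + Z^T = - W and 2 (Z - Z^T) = - V, then the symmetric part of Z is - W/2 and the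
    antisymmetric part is - V/4. *)
Definition sol2 : 'M[R]_n := let K1 := sol1 in
  (- (2^-1 *: (K1 *m G0 *m K1^T + G1 *m K1^T + K1 *m G1 + G2)
      + 4^-1 *: (P0 + K1 *m P1 - (P0 + K1 *m P1)^T))) *m invmx G0.

Lemma sol_solves : solves sol1 sol2.
Proof.
rewrite /solves; set K1 := sol1.
have E1 : K1 *m G0 = 6^-1 *: (2 *: (- P1 - 2 *: G1) - (- P1^T - 2 *: G1)).
  by rewrite /K1 /sol1 mulmxKV.
have E2 : sol2 *m G0 = - (2^-1 *: (K1 *m G0 *m K1^T + G1 *m K1^T + K1 *m G1 + G2)
      + 4^-1 *: (P0 + K1 *m P1 - (P0 + K1 *m P1)^T)).
  by rewrite /sol2 mulmxKV.
(* The compatibility condition of the second equation, whose left side is symmetric; transposition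
   exchanges the two middle terms. *)
have Ws : (K1 *m G0 *m K1^T + G1 *m K1^T + K1 *m G1 + G2)^T =
    K1 *m G0 *m K1^T + G1 *m K1^T + K1 *m G1 + G2.
  rewrite !linearD /= !trmx_mul !trmxK G0s G1s G2s mulmxA.
  by congr (_ + _); rewrite -!addrA; congr (_ + _); rewrite addrC.
split.
- rewrite E1; apply/matrixP => i j.
  have := congr1 (fun A : 'M[R]_n => A i j) G1s; rewrite !mxE => ->.
  by field.
- rewrite E2; move: Ws; move: (_ + G2) (P0 + _) => W Q Ws.
  apply/matrixP => i j; have := congr1 (fun A : 'M[R]_n => A i j) Ws.
  by rewrite !mxE => ->; field.
- rewrite E2; move: Ws; move: (_ + G2) (P0 + _) => W Q Ws.
  apply/matrixP => i j; have := congr1 (fun A : 'M[R]_n => A i j) Ws.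
  by rewrite !mxE => ->; field.
Qed.

Lemma solves_uniq K1 K2 : solves K1 K2 -> K1 = sol1 /\ K2 = sol2.
Proof.
move=> [E1 E2 E3].
have K1E : K1 = sol1.
  rewrite /sol1 -[LHS](mulmxK G0u); congr (_ *m _).
  move: (K1 *m G0) E1 => X E1; apply/matrixP => i j.
  (* Entries (i, j) and (j, i) give two linear equations in X i j and X j i. *)
  have e1 := congr1 (fun A : 'M[R]_n => A i j) E1.
  have e2 := congr1 (fun A : 'M[R]_n => A j i) E1.
  have e3 := congr1 (fun A : 'M[R]_n => A i j) G1s.
  by move: e1 e2 e3; rewrite !mxE; lra.
split=> //; rewrite /sol2 -K1E -[LHS](mulmxK G0u); congr (_ *m _).
rewrite -[X in 2^-1 *: X]opprK -E2 -[X in 4^-1 *: X]opprK -E3.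
by apply/matrixP => i j; rewrite !mxE; field.
Qed.

End Solve.
End Algebra.

Section Pointwise.
Context {R : realType} {n : nat} {M : smoothManifold R n}.
Variables (L : jet2 M -> R) (S : jet2 M -> tvector M).
Hypotheses (rL : regular_lagrangian L) (spray : semispray S).
Implicit Types (c d : mchart M) (u : jet2 M) (z xi eta : 'M[R]_(3, n)).

Let sL : smooth_fun L := rL.1.

Lemma metric_unit c z : timg c z -> metric L c z \in unitmx.
Proof. by move=> zc; rewrite -row_full_unit /row_full (rL.2 _ _ zc). Qed.

(** Passes from derivatives of single entries, as in the definition of g^c, to derivatives of the
    whole matrix. *)
Lemma SgE c z i j : timg c z -> Sg L S c i j z = SG L S c z i j.
Proof.
move=> zc; apply: esym.
exact: (derive_coord _ i j (smooth_differentiable (smooth_metric sL c) zc)).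
Qed.

Lemma SSgE c z i j : timg c z -> SSg L S c i j z = SSG L S c z i j.
Proof.
move=> zc; have E : {in timg c, Sg L S c i j =1 fun y => SG L S c y i j : R^o}.
  by move=> y; rewrite inE => yc; exact: SgE.
apply: (eq_trans (derive_open_eq _ (@timg_open _ _ _ c) zc E)).
apply: esym.
exact: (derive_coord _ i j
  (smooth_differentiable (@smooth_SG _ _ _ _ sL _ spray c) zc)).
Qed.

Lemma gcE c z xi eta : timg c z -> gc L S c z xi eta =
  gcm (metric L c z) (SG L S c z) (2^-1 *: SSG L S c z) xi eta.
Proof.
move=> zc; rewrite /gcm !sum_dot -!big_split; apply: eq_bigr => i _ /=.
rewrite -!big_split; apply: eq_bigr => j _ /=.
rewrite SgE// SSgE// /g.
have -> : (2^-1 *: SSG L S c z) i j = 2^-1 * SSG L S c z i j by rewrite mxE.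
rewrite ![row _ _ _ _]mxE.
ring.
Qed.

Lemma gc_trans c d z xi eta : jets_over (overlap c d) z -> gc L S c z xi eta =
  gc L S d (Phi c d z) (jetmx (B0 c d z) (B1 c d z) (B2 c d z) xi)
    (jetmx (B0 c d z) (B1 c d z) (B2 c d z) eta).
Proof.
move=> Oz; rewrite (gcE _ _ (jets_over_timg Oz)) (gcE _ _ (Phi_timg Oz)).
have C (a a' b b' e e' : 'M[R]_n) : a = a' -> b = b' -> e = e' ->
    gcm a b e xi eta = gcm a' b' e' xi eta by move=> -> -> ->.
exact: (eq_trans (C _ _ _ _ _ _ (metric_trans sL Oz) (SG_trans sL spray Oz)
          (SSG_trans sL spray Oz)) (gcm_jetmx _ _ _ _ _ _ _ _)).
Qed.

Lemma SG_sym c z : timg c z -> (SG L S c z)^T = SG L S c z.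
Proof.
move=> zc; have E : {in timg c, (fun y => (metric L c y)^T) =1 metric L c}.
  by move=> y; rewrite inE => yc; exact: (metric_tensor_sym sL yc).
have D := derive_tr (Sx S c z) (smooth_differentiable (smooth_metric sL c) zc).
exact: (eq_trans (esym D) (derive_open_eq _ (@timg_open _ _ _ c) zc E)).
Qed.

Lemma SSG_sym c z : timg c z -> (SSG L S c z)^T = SSG L S c z.
Proof.
move=> zc; have E : {in timg c, (fun y => (SG L S c y)^T) =1 SG L S c}.
  by move=> y; rewrite inE => yc; exact: SG_sym.
have D := derive_tr (Sx S c z)
  (smooth_differentiable (@smooth_SG _ _ _ _ sL _ spray c) zc).
exact: (eq_trans (esym D) (derive_open_eq _ (@timg_open _ _ _ c) zc E)).
Qed.

Lemma row_sum_partial (k l : 'I_3) (f : 'I_n -> R) :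
  row k (\sum_j f j *: partial l j) = if k == l then \row_j f j else 0.
Proof.
rewrite linear_sum /=; case: eqP => [<-|/eqP kl]; last first.
  by rewrite big1// => j _; rewrite linearZ /= row_partial (negbTE kl) scaler0.
rewrite [RHS]row_sum_delta; apply: eq_bigr => j _.
by rewrite linearZ /= row_partial eqxx mxE.
Qed.

Lemma delta_x_hor (N1 N2 : 'M[R]_n) i :
  delta_x N1 N2 i = hor (- N1^T) (- N2^T) (delta_mx 0 i).
Proof.
have D k : row k (delta_x N1 N2 i) = row k (partial 0 i) -
    row k (\sum_j N1 j i *: partial 1 j) - row k (\sum_j N2 j i *: partial 2 j).
  by apply/rowP => j; rewrite /delta_x !mxE.
have E (A : 'M[R]_n) : \row_j A j i = delta_mx 0 i *m A^T.
  by rewrite -rowE; apply/rowP => j; rewrite !mxE.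
rewrite /hor; apply: row3P; rewrite row_mx3 D row_partial !row_sum_partial /= ?subr0//.
  by rewrite sub0r mulmxN E.
by rewrite sub0r mulmxN E.
Qed.

Lemma gcm_delta_x (G0 G1 T N1 N2 : 'M[R]_n) i j :
  2 * gcm G0 G1 (2^-1 *: T) (delta_x N1 N2 i) (delta_x N1 N2 j) =
  T i j - 2 * (N1^T *m G1) i j - 2 * (G1 *m N1) i j
    - 2 * (N2^T *m G0) i j - 2 * (G0 *m N2) i j + 2 * (N1^T *m (G0 *m N1)) i j.
Proof.
have R1 (A : 'M[R]_n) : dot (delta_mx 0 i *m A) (delta_mx 0 j) = A i j.
  rewrite dotE (bigD1 j)//= big1 ?addr0; last first.
    by move=> k kj; rewrite [delta_mx _ _ _ _]mxE (negbTE kj) andbF mulr0.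
  by rewrite -rowE [row i A 0 j]mxE [delta_mx _ _ _ _]mxE !eqxx mulr1.
rewrite !delta_x_hor /gcm /hor !row_mx3.
have R2 (A B : 'M[R]_n) :
    dot (delta_mx 0 i *m A) (delta_mx 0 j *m - B^T) = - (A *m B) i j.
  by rewrite dot_mulmxr linearN /= trmxK mulmxN -mulmxA dotNl R1.
have R3 (A B : 'M[R]_n) :
    dot (delta_mx 0 i *m - A^T *m B) (delta_mx 0 j) = - (A^T *m B) i j.
  by rewrite mulmxN mulNmx -mulmxA dotNl R1.
have R4 (A B C : 'M[R]_n) :
    dot (delta_mx 0 i *m - A^T *m B) (delta_mx 0 j *m - C^T) = (A^T *m (B *m C)) i j.
  by rewrite mulmxN mulNmx -mulmxA dotNl R2 opprK mulmxA.
have R5 : dot (delta_mx 0 i *m (2^-1 *: T)) (delta_mx 0 j) = 2^-1 * T i j.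
  by rewrite R1 mxE.
by rewrite !R4 !R2 !R3 R5; field.
Qed.

Lemma nabla2gE c z N1 N2 i j : timg c z -> nabla2g L S c z N1 N2 i j =
  2 * gc L S c z (delta_x N1 N2 i) (delta_x N1 N2 j).
Proof.
move=> zc; rewrite gcE// gcm_delta_x /nabla2g SSgE// ![(_ *m _) i j]mxE.
congr (_ - _ * _ - _ * _ - _ * _ - _ * _ + _ * _); apply: eq_bigr => k _.
- by rewrite SgE// mxE.
- by rewrite SgE// mulrC.
- by rewrite mxE.
- by rewrite mulrC.
rewrite !mxE mulr_sumr; apply: eq_bigr => l _.
by rewrite mulrC.
Qed.

End Pointwise.

(** * Omega and g^c on horizontal vectors as bilinear forms in their base components *)

Section Forms.
Context {R : realType} {n : nat}.
Variables (G0 G1 G2 P0 P1 K1 K2 : 'M[R]_n) (a b : 'rV[R]_n).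
Hypothesis G0s : G0^T = G0.

(** Omega in coordinates, with P0 and P1 the derivatives of the momenta in x and y^(1); the
    derivative in y^(2) is 2 G0 because g is half the second derivative of L. *)
Definition omq (xi eta : 'M[R]_(3, n)) : R :=
  dot (row 0 eta) (row 0 xi *m P0 + row 1 xi *m P1 + 2 *: (row 2 xi *m G0)) -
  dot (row 0 xi) (row 0 eta *m P0 + row 1 eta *m P1 + 2 *: (row 2 eta *m G0)).

(** Every term is brought to the form q A with a and b fixed; additivity of q then leaves an
    identity for [ring]. *)
Let q A := dot (a *m A) b.
Let qD A B : q (A + B) = q A + q B. Proof. by rewrite /q mulmxDr dotDl. Qed.
Let qN A : q (- A) = - q A. Proof. by rewrite /q mulmxN dotNl. Qed.
Let qZ k A : q (k *: A) = k * q A. Proof. by rewrite /q -scalemxAr dotZl. Qed.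
Let qr A : dot b (a *m A) = q A. Proof. by rewrite dotC. Qed.
Let ql B : dot a (b *m B) = q B^T. Proof. by rewrite dot_mulmxr. Qed.
Let qlr (A B : 'M[R]_n) : dot (a *m A) (b *m B) = q (A *m B^T).
Proof. by rewrite dot_mulmxr -mulmxA. Qed.
Let qE A : dot (a *m A) b = q A. Proof. by []. Qed.
Let dotZr k (x y : 'rV[R]_n) : dot x (k *: y) = k * dot x y.
Proof. by rewrite dotC dotZl dotC. Qed.

(** Omega contributes - 2 (K1 G0)^T, and - 2 g^c contributes - 2 (K1 G0)^T - 2 K1 G0: this is where
    4 X^T + 2 X comes from. *)
Lemma omq_horv :
  omq (hor K1 K2 a) (Jmx (hor K1 K2 b)) -
    2 * gcm G0 G1 G2 (hor K1 K2 a) (Jmx (hor K1 K2 b)) =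
  dot (a *m (- P1^T - 2 *: G1 - (4 *: (K1 *m G0)^T + 2 *: (K1 *m G0)))) b.
Proof.
rewrite qE Jmx_hor /omq /gcm /hor !row_mx3 !mul0mx !dot0l !dot0r !add0r !addr0.
rewrite -!mulmxA dotDr dotZr !ql !qlr !qE !trmx_mul G0s.
by rewrite !(qD, qN, qZ); ring.
Qed.

Lemma gcm_horh :
  gcm G0 G1 G2 (hor K1 K2 a) (hor K1 K2 b) =
  dot (a *m (K2 *m G0 + (K2 *m G0)^T -
      - (K1 *m G0 *m K1^T + G1 *m K1^T + K1 *m G1 + G2))) b.
Proof.
rewrite qE /gcm /hor !row_mx3.
rewrite -!mulmxA !mulmxA -!(mulmxA a) !qlr !qE !trmx_mul G0s.
by rewrite !(qD, qN, qZ); ring.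
Qed.

Lemma omq_horh :
  omq (hor K1 K2 a) (hor K1 K2 b) =
  dot (a *m (2 *: (K2 *m G0 - (K2 *m G0)^T) -
      - (P0 + K1 *m P1 - (P0 + K1 *m P1)^T))) b.
Proof.
rewrite qE /omq /hor !row_mx3 -!mulmxA !dotDr !dotZr !ql !qr.
have -> : (P0 + K1 *m P1)^T = P0^T + (K1 *m P1)^T by rewrite linearD.
by rewrite !trmx_mul !(qD, qN, qZ); ring.
Qed.

End Forms.

Section Conditions.
Context {R : realType} {n : nat} {M : smoothManifold R n}.
Variables (L : jet2 M -> R) (S : jet2 M -> tvector M).
Hypotheses (rL : regular_lagrangian L) (spray : semispray S).
Implicit Types (c d : mchart M) (u : jet2 M) (z xi eta : 'M[R]_(3, n)).
Implicit Types (a b : 'rV[R]_n) (K : 'M[R]_n).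

Let sL : smooth_fun L := rL.1.

Definition DpL c k z : 'M[R]_n := \matrix_i 'D_(partial k i) (pL L c) z.

Lemma mx3_partial a b e : mx3 a b e = \sum_i a 0 i *: partial 0 i +
  \sum_i b 0 i *: partial 1 i + \sum_i e 0 i *: partial 2 i :> 'M[R]_(3, n).
Proof.
have E (f : 'rV[R]_n) : \row_j f 0 j = f by apply/rowP => j; rewrite mxE.
by apply: row3P; rewrite row_mx3 !linearD /= !row_sum_partial /= E ?addr0 ?add0r.
Qed.

Lemma derive_pLE c z xi : timg c z -> 'D_xi (pL L c) z =
  row 0 xi *m DpL c 0 z + row 1 xi *m DpL c 1 z +
  2 *: (row 2 xi *m metric L c z).
Proof.
move=> zc; have dp := smooth_differentiable (smooth_pL sL c) zc.
have E k (a : 'rV[R]_n) : 'D_(\sum_i a 0 i *: partial k i) (pL L c) z = a *m DpL c k z.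
  apply: (eq_trans (derive_sumd _ dp)); rewrite mulmx_sum_row.
  by apply: eq_bigr => i _; rewrite rowK; exact: deriveZd.
rewrite -{1}(mx3_row xi) mx3_partial.
apply: (eq_trans (deriveDd _ _ dp)).
apply: (eq_trans (congr2 +%R (deriveDd _ _ dp) (E 2 (row 2 xi)))).
apply: (eq_trans (congr1 (fun X => X + _)
  (congr2 +%R (E 0 (row 0 xi)) (E 1 (row 1 xi))))).
congr (_ + _); rewrite scalemxAr; congr (_ *m _).
apply/row_matrixP => i; rewrite rowK linearZ /= (row_metric sL i zc) scalerA.
by rewrite mulfV ?pnatr_eq0// scale1r.
Qed.

Definition compatible c z K1 K2 := [/\
  forall a b, omega2 L c z (hor K1 K2 a) (Jmx (hor K1 K2 b)) =
              2 * gc L S c z (hor K1 K2 a) (Jmx (hor K1 K2 b)),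
  forall a b, gc L S c z (hor K1 K2 a) (hor K1 K2 b) = 0 &
  forall a b, omega2 L c z (hor K1 K2 a) (hor K1 K2 b) = 0].

Lemma compatible_solves c z K1 K2 : timg c z ->
  compatible c z K1 K2 <-> solves (metric L c z) (SG L S c z)
    (2^-1 *: SSG L S c z) (DpL c 0 z) (DpL c 1 z) K1 K2.
Proof.
move=> zc; have Gs := metric_tensor_sym sL zc.
have OE xi eta : omega2 L c z xi eta =
    omq (metric L c z) (DpL c 0 z) (DpL c 1 z) xi eta.
  by rewrite omega2E// !derive_pLE.
have F1 a b := @omq_horv _ _ _ (SG L S c z) (2^-1 *: SSG L S c z)
  (DpL c 0 z) (DpL c 1 z) K1 K2 a b Gs.
have F2 a b := @gcm_horh _ _ _ (SG L S c z) (2^-1 *: SSG L S c z) K1 K2 a b Gs.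
have F3 a b := @omq_horh _ _ (metric L c z) (DpL c 0 z) (DpL c 1 z) K1 K2 a b.
rewrite /compatible /solves.
split=> -[H1 H2 H3]; split.
- apply/esym/subr0_eq; apply/dot_eq0 => a b.
  by rewrite -F1 -OE -gcE// H1 subrr.
- by apply/subr0_eq; apply/dot_eq0 => a b; rewrite -F2 -gcE.
- by apply/subr0_eq; apply/dot_eq0 => a b; rewrite -F3 -OE.
- move=> a b; apply/subr0_eq; rewrite OE gcE// F1.
  by apply: (dot_eq0 _).2; rewrite H1 subrr.
- move=> a b; rewrite gcE// F2.
  by apply: (dot_eq0 _).2; rewrite H2 subrr.
- move=> a b; rewrite OE F3.
  by apply: (dot_eq0 _).2; rewrite H3 subrr.
Qed.

Definition K1of c z : 'M[R]_n :=
  sol1 (metric L c z) (SG L S c z) (DpL c 1 z).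
Definition K2of c z : 'M[R]_n :=
  sol2 (metric L c z) (SG L S c z) (2^-1 *: SSG L S c z) (DpL c 0 z) (DpL c 1 z).

Lemma compatible_uniq c z K1 K2 : timg c z ->
  compatible c z K1 K2 <-> K1 = K1of c z /\ K2 = K2of c z.
Proof.
move=> zc; have Gu := metric_unit rL zc; rewrite compatible_solves//.
have Gs := metric_tensor_sym sL zc.
have G1s : (SG L S c z)^T = SG L S c z by exact: SG_sym.
split=> [|[-> ->]]; first exact: solves_uniq.
apply: sol_solves => //.
by rewrite linearZ /= SSG_sym.
Qed.

Lemma smooth_DpL c k : smooth_on (timg c) (DpL c k).
Proof.
have oc := @timg_open _ _ _ c.
move=> m; apply/(Ck_on_mx _ _ oc) => i j.
under eq_fun do rewrite mxE.
exact: ((Ck_on_mx _ _ oc).1 (smooth_derive (partial k i) (smooth_pL sL c) m) 0 j).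
Qed.

Lemma smooth_lin_mx c p q p' q' (l : {linear 'M[R]_(p, q) -> 'M[R]_(p', q')})
    (F : 'M[R]_(3, n) -> 'M[R]_(p, q)) :
  smooth_on (timg c) F -> smooth_on (timg c) (fun z => l (F z)).
Proof.
move=> sF; apply: (smooth_lin (l := l)) => //; first exact: linear_mx_continuous.
exact: timg_open.
Qed.

Lemma smooth_Kof c : smooth_on (timg c) (K1of c) /\ smooth_on (timg c) (K2of c).
Proof.
have oc := @timg_open _ _ _ c.
have sG := smooth_metric sL c.
have sSG := @smooth_SG _ _ _ _ sL _ spray c.
have sSSG : smooth_on (timg c) (SSG L S c) := smooth_SD spray sSG.
have sP k := @smooth_DpL c k.
have sinv : smooth_on (timg c) (fun z => invmx (metric L c z)).
  move=> k; apply: Ck_on_invmx => //.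
  by move=> z zc; exact: metric_unit.
have sT (F : 'M[R]_(3, n) -> 'M[R]_n) : smooth_on (timg c) F ->
    smooth_on (timg c) (fun z => (F z)^T).
  by move=> sF; exact: (smooth_lin_mx (trmx : {linear 'M[R]_n -> 'M[R]_n}) sF).
have sA (F H : 'M[R]_(3, n) -> 'M[R]_n) : smooth_on (timg c) F ->
    smooth_on (timg c) H -> smooth_on (timg c) (fun z => F z + H z).
  by move=> sF sH k; exact: (Ck_onD oc (sF k) (sH k)).
have sZ (k : R) (F : 'M[R]_(3, n) -> 'M[R]_n) : smooth_on (timg c) F ->
    smooth_on (timg c) (fun z => k *: F z).
  by move=> sF m; exact: (Ck_onZ k oc (sF m)).
have sN (F : 'M[R]_(3, n) -> 'M[R]_n) : smooth_on (timg c) F ->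
    smooth_on (timg c) (fun z => - F z).
  by move=> sF; under eq_fun do rewrite -scaleN1r; exact: sZ.
have sM (F H : 'M[R]_(3, n) -> 'M[R]_n) : smooth_on (timg c) F ->
    smooth_on (timg c) H -> smooth_on (timg c) (fun z => F z *m H z).
  exact: (smooth_mulmx oc).
have s1 : smooth_on (timg c) (K1of c).
  apply: (sM (fun z => 6^-1 *: (2 *: (- DpL c 1 z - 2 *: SG L S c z) -
    (- (DpL c 1 z)^T - 2 *: SG L S c z))) (fun z => invmx (metric L c z))) => //.
  apply: (sZ _ (fun z => 2 *: (- DpL c 1 z - 2 *: SG L S c z) -
    (- (DpL c 1 z)^T - 2 *: SG L S c z))).
  apply: (sA (fun z => 2 *: (- DpL c 1 z - 2 *: SG L S c z))
    (fun z => - (- (DpL c 1 z)^T - 2 *: SG L S c z))).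
    apply: (sZ _ (fun z => - DpL c 1 z - 2 *: SG L S c z)).
    apply: (sA (fun z => - DpL c 1 z) (fun z => - (2 *: SG L S c z))); first exact: sN.
    exact: (sN (fun z => 2 *: SG L S c z) (sZ _ _ sSG)).
  apply: (sN (fun z => - (DpL c 1 z)^T - 2 *: SG L S c z)).
  apply: (sA (fun z => - (DpL c 1 z)^T) (fun z => - (2 *: SG L S c z))).
    exact: (sN _ (sT _ (sP 1))).
  exact: (sN (fun z => 2 *: SG L S c z) (sZ _ _ sSG)).
split=> //.
have sQ : smooth_on (timg c) (fun z => DpL c 0 z + K1of c z *m DpL c 1 z).
  exact: (sA _ _ (sP 0) (sM _ _ s1 (sP 1))).
pose W z := K1of c z *m metric L c z *m (K1of c z)^T + SG L S c z *m (K1of c z)^T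
  + K1of c z *m SG L S c z + 2^-1 *: SSG L S c z.
have sW : smooth_on (timg c) W.
  exact: (sA _ _ (sA _ _ (sA _ _ (sM _ _ (sM _ _ s1 sG) (sT _ s1))
    (sM _ _ sSG (sT _ s1))) (sM _ _ s1 sSG)) (sZ 2^-1 _ sSSG)).
pose V z := DpL c 0 z + K1of c z *m DpL c 1 z -
  (DpL c 0 z + K1of c z *m DpL c 1 z)^T.
have sV : smooth_on (timg c) V by apply: (sA _ _ sQ (sN _ (sT _ sQ))).
exact: (sM _ _ (sN _ (sA _ _ (sZ 2^-1 _ sW) (sZ 4^-1 _ sV))) sinv).
Qed.

(* The solution in c is pushed forward to a solution in d: by uniqueness it is
   the solution in d. *)
Lemma jetmx_hor_trans c d u : tdom c u -> tdom d u -> forall a,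
  push c d u (hor (K1of c (tcoord c u)) (K2of c (tcoord c u)) a) =
  hor (K1of d (tcoord d u)) (K2of d (tcoord d u)) (a *m B0 c d (tcoord c u)).
Proof.
move=> cu du; set z := tcoord c u; set w := tcoord d u.
have zc : timg c z by exists u. have wd : timg d w by exists u.
have Oz : jets_over (overlap c d) z by exact: tdom_jets_over.
have Pz : Phi c d z = w by rewrite /Phi /z inchartE.
have Bu : B0 c d z \in unitmx by exact: A0_unit.
set K1 := K1of c z; set K2 := K2of c z.
(* Multiplying (a, a K1, a K2) by B(t) gives rows a B0, a (K1 B0 + B1) and a (K2 B0 + K1 B1 + B2);
   these form a graph over a B0. *)
pose K1' := invmx (B0 c d z) *m (K1 *m B0 c d z + B1 c d z).
pose K2' := invmx (B0 c d z) *m (K2 *m B0 c d z + K1 *m B1 c d z + B2 c d z).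
have jE a : jetmx (B0 c d z) (B1 c d z) (B2 c d z) (hor K1 K2 a) =
    hor K1' K2' (a *m B0 c d z).
  rewrite /jetmx /hor !row_mx3 /K1' /K2' !mulmxA !mulmxK//.
  by rewrite !mulmxDr !mulmxA.
have jE' a : hor K1' K2' a =
    jetmx (B0 c d z) (B1 c d z) (B2 c d z) (hor K1 K2 (a *m invmx (B0 c d z))).
  by rewrite jE mulmxKV.
have [C1 C2 C3] := (compatible_uniq K1 K2 zc).2 (conj erefl erefl).
have : compatible d w K1' K2'.
  rewrite -Pz; split=> a b.
  - rewrite !jE' -jetmx_Jmx -(omega2_trans sL _ _ Oz) -(gc_trans rL spray _ _ Oz).
    exact: C1.
  - by rewrite !jE' -(gc_trans rL spray _ _ Oz) C2.
  - by rewrite !jE' -(omega2_trans sL _ _ Oz) C3.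
move=> /(compatible_uniq _ _ wd).1[<- <-] a.
by rewrite push_jetmx// -jE.
Qed.

End Conditions.

(** * Extension of tangent vectors to global vector fields *)

Section Flat.
Context {R : realType}.
Implicit Types (p : {poly R}) (s x : R).

(** The polynomial factor makes this family closed under differentiation, so smoothness can be
    proved by induction for all p at once. *)
Definition flat p (s : R^o) : R^o :=
  if 0 < s then p.[s^-1] * expR (- s^-1) else 0.

Lemma monomial_exp_bound k : exists C : R, forall x, 0 < x ->
  x ^+ k * expR (- x) <= C.
Proof.
(* The 1 covers x <= 1. For x > 1 one has x^k <= x^(k+1), and exp x >= x^(k+1)/(k+1)!. *)
exists (k.+1`!%:R + 1) => x x0.
have [x1|x1] := leP x 1.
  apply: (@le_trans _ _ 1); last by rewrite lerDr ler0n.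
  rewrite -[leRHS]mulr1; apply: ler_pM.
  - by rewrite exprn_ge0// ltW.
  - exact: expR_ge0.
  - by rewrite exprn_ile1// ltW.
  - by rewrite -expR0 ler_expR oppr_le0 ltW.
have xk : x ^+ k <= x ^+ k.+1 by rewrite exprSr ler_peMr ?exprn_ge0// ltW.
have := expR_ge1Dxn k (ltW x0).
have f0 : 0 < (k.+1`!)%:R :> R by rewrite ltr0n fact_gt0.
move=> H; have : x ^+ k.+1 <= k.+1`!%:R * expR x.
  rewrite -ler_pdivrMl// mulrC; apply: le_trans H.
  by rewrite lerDr.
rewrite expRN => H2.
rewrite ler_pdivrMr ?expR_gt0//; apply: (le_trans xk).
apply: (le_trans H2); rewrite ler_pM2r ?expR_gt0// lerDl.
exact: ler01.
Qed.

(** Order two makes the difference quotient at 0 at most C s. The monomial bound is used at x = 1/s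
    with exponent i + 2, the 2 paying for the division by s^2. *)
Lemma flat_bound p : exists C : R, forall s, 0 < s -> `|flat p s| <= C * s ^+ 2.
Proof.
have [Cf Cb] := choice (fun k : nat => monomial_exp_bound k).
exists (\sum_(i < size p) `|p`_i| * Cf (i + 2)%N) => s s0.
rewrite /flat s0 normrM (ger0_norm (expR_ge0 _)).
have s20 : 0 < s ^+ 2 by rewrite exprn_gt0.
rewrite -ler_pdivrMr// horner_coef.
have si0 : 0 < s^-1 by rewrite invr_gt0.
apply: (@le_trans _ _
  ((\sum_(i < size p) `|p`_i| * s^-1 ^+ i) * expR (- s^-1) / s ^+ 2)).
  rewrite !ler_pM2r ?invr_gt0 ?expR_gt0//.
  apply: (le_trans (ler_norm_sum _ _ _)); apply: ler_sum => i _.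
  by rewrite normrM normrX (ger0_norm (ltW si0)).
rewrite !mulr_suml; apply: ler_sum => i _.
rewrite -!mulrA ler_wpM2l//.
have := Cb (i + 2)%N s^-1 si0; apply: le_trans.
by rewrite exprD [s^-1 ^+ 2]exprVn mulrAC mulrA.
Qed.

(** With x = 1/s, the derivative of p(x) exp(-x) is (p' - p)(x) exp(-x), and dx/ds = - x^2. *)
Definition dflat p : {poly R} := 'X^2 * (p - p^`()).

Lemma flat_derive_pos p s : 0 < s ->
  is_derive (s : R^o) 1 (flat p) (flat (dflat p) s).
Proof.
move=> s0.
have E : \forall t \near (s : R^o), p.[t^-1] * expR (- t^-1) = flat p t.
  near=> t; rewrite /flat ifT//; near: t; exact: lt_nbhsr.
apply: (near_eq_is_derive E).
have sn0 : s != 0 by rewrite gt_eqF.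
have dinv : is_derive (s : R^o) 1 (fun t : R => t^-1 : R^o) (- s ^- 2).
  have := @is_deriveV R id s 1 1 sn0 (is_derive_id _ _).
  by rewrite /GRing.scale /= mulr1.
have dg : is_derive (s^-1 : R^o) 1 (fun x : R => p.[x] * expR (- x) : R^o)
    (p^`().[s^-1] * expR (- s^-1) - p.[s^-1] * expR (- s^-1)).
  have d1 := is_derive_poly p (s^-1).
  have d2 : is_derive (s^-1 : R^o) 1 (fun x : R => expR (- x) : R^o) (- expR (- s^-1)).
    have := is_derive1_comp (is_derive_expR (- s^-1)) (is_deriveNid (s^-1 : R) 1).
    by rewrite mulrN1.
  have H := is_deriveM d1 d2; apply: (is_derive_eq H).
  by rewrite /GRing.scale /=; ring.
have := is_derive1_comp dg dinv => H.
apply: is_derive_eq H _.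
rewrite /flat s0 /dflat !hornerE /GRing.scale /= ?exprVn; ring.
Unshelve. all: by end_near. Qed.

Lemma flat_derive_npos p s : s <= 0 ->
  is_derive (s : R^o) 1 (flat p) (flat (dflat p) s).
Proof.
move=> s0; rewrite [flat (dflat p) s]/flat ltNge s0 /=.
move: s0; rewrite le_eqVlt => /predU1P[->|s0]; last first.
  have E : \forall t \near (s : R^o), 0 = flat p t.
    near=> t; rewrite /flat ifF//; apply/negbTE; rewrite -leNgt ltW//.
    by near: t; exact: lt_nbhsl.
  exact: (near_eq_is_derive E (is_derive_cst (0 : R^o) (s : R^o) 1)).
have f0 : flat p 0 = 0 by rewrite /flat ltxx.
have [C HC] := flat_bound p.
have C0 : 0 <= C.
  have := HC 1 ltr01; rewrite expr1n mulr1; apply: le_trans.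
  exact: normr_ge0.
(* At 0 the quotient vanishes for h < 0 and is bounded by C h for h > 0. *)
have cv : (fun h : R => h^-1 *: (flat p (h *: (1 : R^o) + 0) - flat p 0))
    @ (0 : R)^' --> (0 : R^o).
  apply/cvgrPdist_le => e e0; near=> h.
  rewrite sub0r normrN addr0 f0 subr0 normrZ.
  have hE : h *: (1 : R^o) = h by rewrite /GRing.scale /= mulr1.
  rewrite hE.
  have [h0|h0] := ltP 0 h; last first.
    by rewrite /flat ltNge h0 /= normr0 mulr0 ltW.
  rewrite normfV (gtr0_norm h0) ler_pdivrMl//.
  apply: (le_trans (HC h h0)).
  rewrite expr2 mulrA [leLHS]mulrC ler_pM2l//.
  have hle : h <= e / (C + 1).
    apply: ltW; apply: le_lt_trans (ler_norm h) _.
    near: h; apply: dnbhs0_lt; rewrite divr_gt0// ltr_wpDl//.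
  apply: (@le_trans _ _ ((C + 1) * h)).
    by rewrite ler_pM2r// lerDl.
  by rewrite -ler_pdivlMl ?ltr_wpDl// mulrC.
apply: DeriveDef; first by apply/cvg_ex; exists (0 : R^o).
exact: cvg_lim cv.
Unshelve. all: by end_near. Qed.

Lemma flat_derive p s : is_derive (s : R^o) 1 (flat p) (flat (dflat p) s).
Proof.
by have [s0|s0] := ltP 0 s; [exact: flat_derive_pos|exact: flat_derive_npos].
Qed.

Lemma smooth_flat p : smooth_on setT (flat p).
Proof.
move=> k; elim: k p => [|k IH] p.
  move=> s _; apply: differentiable_continuous; apply/derivable1_diffP.
  exact: (@ex_derive _ _ _ _ _ _ _ (flat_derive p s)).
have dp s : differentiable (flat p) s.
  by apply/derivable1_diffP; exact: (@ex_derive _ _ _ _ _ _ _ (flat_derive p s)).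
split=> [s _|v]; first exact: dp.
rewrite (_ : 'D_v (flat p) = v *: flat (dflat p)).
  by apply: Ck_onZ => //; exact: openT.
apply/funext => s; have E := deriveZd v (1 : R^o) (dp s).
have vE : v *: (1 : R^o) = v by rewrite /GRing.scale /= mulr1.
rewrite vE in E; apply: (eq_trans E).
by rewrite (@derive_val _ _ _ _ _ _ _ (flat_derive p s)).
Qed.

End Flat.

Section Bump.
Context {R : realType} {n : nat}.

(** Built on the Euclidean distance, because the norm on row vectors is a maximum of absolute
    values; [bump_supp] compares the two. *)
Definition bump_fun (x0 : 'rV[R]_n) (r : R) (x : 'rV[R]_n) : R^o :=
  flat 1 (r ^+ 2 - \sum_i (x 0 i - x0 0 i) ^+ 2).

Lemma smooth_bump x0 r : smooth_on setT (bump_fun x0 r).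
Proof.
move=> k.
have oT : open (setT : set 'rV[R]_n) by exact: openT.
have C1 i : Ck_on k setT (fun x : 'rV[R]_n => x 0 i - x0 0 i : R^o).
  apply: (Ck_onD oT _ (Ck_on_cst k setT (- x0 0 i : R^o))).
  apply: (smooth_lin (l := mxcoord 0 i) _ oT (smooth_id oT)).
  exact: mxcoord_continuous.
have C2 : Ck_on k setT (fun x : 'rV[R]_n => \sum_i (x 0 i - x0 0 i) ^+ 2 : R^o).
  by apply: Ck_on_sum => // i _; exact: (Ck_onM oT (C1 i) (C1 i)).
have C3 : Ck_on k setT (fun x : 'rV[R]_n =>
    r ^+ 2 - \sum_i (x 0 i - x0 0 i) ^+ 2 : R^o).
  apply: (Ck_on_eq (f := cst (r ^+ 2 : R^o) +
     (-1) *: (fun x : 'rV[R]_n => \sum_i (x 0 i - x0 0 i) ^+ 2 : R^o))) => //.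
    by move=> x _; rewrite !fctE scaleN1r.
  exact: (Ck_onD oT (Ck_on_cst _ _ _) (Ck_onZ _ oT C2)).
exact: (Ck_on_comp_real oT (fun _ _ => Logic.I) C3 (smooth_flat 1 k)).
Qed.

Lemma bump_gt0 x0 r : 0 < r -> 0 < bump_fun x0 r x0.
Proof.
move=> r0; rewrite /bump_fun big1; last by move=> i _; rewrite subrr expr0n.
by rewrite subr0 /flat exprn_gt0// hornerE mul1r expR_gt0.
Qed.

Lemma bump_supp x0 r x : 0 < r -> bump_fun x0 r x != 0 -> `|x0 - x| <= r.
Proof.
move=> r0; rewrite /bump_fun /flat; case: ifPn => [H _|_ /eqP//].
rewrite [leLHS]/Num.Def.normr/= mx_normrE (bigmax_le _ (ltW r0))//= => -[i j] _.
rewrite [i]ord1 !mxE /= -(@ler_pXn2r _ 2%N)// ?nnegrE ?normr_ge0 ?(ltW r0)//.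
rewrite real_normK ?num_real// -sqrrN opprB.
rewrite subr_gt0 in H; apply: le_trans (ltW H).
rewrite (bigD1 j)//= lerDl; apply: sumr_ge0 => k _; exact: sqr_ge0.
Qed.

End Bump.

Section Extension.
Context {R : realType} {n : nat} {M : smoothManifold R n}.
Implicit Types (c d : mchart M) (u : jet2 M) (xi : 'M[R]_(3, n)).

Lemma smooth_push c d xi : smooth_on (jets_over (overlap d c))
  (fun w => 'D_xi (inchart c (tcoord d)) (inchart d (tcoord c) w)).
Proof.
have o1 := open_jets_overlap d c; have o2 := open_jets_overlap c d.
move=> k; apply: (Ck_on_comp o1 o2 _ (smooth_trans d c k)
  (smooth_derive xi (smooth_trans c d) k)).
move=> w Ow; rewrite inchart_tcoord//; exact: jets_over_prolong.
Qed.

Section Field.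
Variables (c : mchart M) (x0 : 'rV[R]_n) (r : R) (xi : 'M[R]_(3, n)).
Hypotheses (r0 : 0 < r) (rK : closed_ball x0 r `<=` cmap c @` cdom c).

Definition bump_field u : tvector M :=
  if `[< tdom c u >]
  then mktangent c u (bump_fun x0 r (row 0 (tcoord c u)) *: xi) else 0.

Lemma bump_field_tangent u : tangent u (bump_field u).
Proof.
rewrite /bump_field; case: asboolP => [cu|_]; first exact: mktangentP.
exact: tangent0.
Qed.

Let K : set M := cinv c @` closed_ball x0 r.

(** K is compact as a continuous image of a closed ball, hence closed because M is Hausdorff. So the
    extended field vanishes near every jet based outside the chart. *)
Lemma bump_support_closed : closed K.
Proof.
apply: compact_closed; first exact: carrier_hausdorff.
apply: continuous_compact.
  by apply: continuous_subspaceW rK _; exact: cinv_continuous.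
apply: bounded_closed_compact; last exact: closed_ball_closed.
rewrite closed_ballE//.
exists (`|x0| + r); split; first exact: num_real.
move=> N xN x /=; rewrite /closed_ball_ /= => xr; apply: le_trans (ltW xN).
rewrite -[x](subrK x0) addrC; apply: (le_trans (ler_normD _ _)).
by rewrite lerD2l distrC.
Qed.

Lemma bump_field_out u : ~ K (jet2_curve u 0) -> bump_field u = 0.
Proof.
move=> nK; rewrite /bump_field; case: asboolP => // cu.
have -> : bump_fun x0 r (row 0 (tcoord c u)) = 0.
  apply/eqP; apply/negPn/negP => /(bump_supp r0) H; apply: nK.
  exists (row 0 (tcoord c u)); first by rewrite closed_ballE.
  by rewrite row0_tcoord cmapK.
rewrite scale0r; apply/funext => d; rewrite /mktangent push0.
by case: ifP.
Qed.

Lemma bump_field_smooth d : smooth_on (timg d) (inchart d (bump_field ^~ d)).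
Proof.
apply: smooth_local => w [u du <-].
have [cu|ncu] := pselect (tdom c u).
  exists (jets_over (overlap d c)); first exact: tdom_jets_over.
  have oO := open_jets_overlap d c.
  have sr : smooth_on (jets_over (overlap d c))
      (fun w => row 0 (inchart d (tcoord c) w)).
    apply: (smooth_lin (l := row 0) _ oO (smooth_trans d c)).
    exact: row_continuous.
  have sb : smooth_on (jets_over (overlap d c))
      (fun w => bump_fun x0 r (row 0 (inchart d (tcoord c) w))).
    move=> k; exact: (Ck_on_comp_mx oO (fun _ _ => Logic.I) (sr k)
      (@smooth_bump _ _ x0 r k)).
  apply: (smooth_eq oO _ (smooth_scale oO sb (smooth_push c d xi))).
  move=> z; rewrite inE => /jets_over_overlap[v [dv cv <-]].
  rewrite (inchartE (bump_field ^~ d) dv) (inchartE (tcoord c) dv).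
  rewrite /bump_field asboolT// /mktangent asboolT// pushZ.
  by rewrite (pushE xi cv dv).
(* Outside the domain of c, the field is identically 0 over the complement of K, which is open and
   contains the base point. *)
have oK : open (~` K) by rewrite openC; exact: bump_support_closed.
have oW := chart_image_open (c := d) oK.
exists (jets_over (cmap d @` (cdom d `&` ~` K))).
  rewrite /jets_over /= row0_tcoord; exists (jet2_curve u 0) => //; split => //.
  move=> [x /rK[p cp <-]]; rewrite cmapK// => E.
  by apply: ncu; rewrite /tdom /= -E.
apply: (smooth_eq (f := cst 0) (jets_over_open oW)); last first.
  by move=> k; exact: Ck_on_cst.
move=> z; rewrite inE => -[p [dp nKp] Ep].
have [v dv E] : timg d z by apply/timgP; rewrite -Ep; exists p.
rewrite -E (inchartE (bump_field ^~ d) dv) bump_field_out//.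
have -> // : jet2_curve v 0 = p.
by rewrite -(cmapK dv) -row0_tcoord E -Ep cmapK.
Qed.

End Field.

Lemma tangent_extension u0 c xi : tdom c u0 ->
  exists X : jet2 M -> tvector M, vector_field X /\ X u0 = mktangent c u0 xi.
Proof.
move=> cu; pose x0 := row 0 (tcoord c u0).
have x0c : (cmap c @` cdom c) x0.
  by rewrite /x0 row0_tcoord; exists (jet2_curve u0 0).
have /nbhs_ballP[e e0 eK] := open_nbhs_nbhs (conj (@cimg_open _ _ _ c) x0c).
have r0 : 0 < e / 2 by rewrite divr_gt0.
have rK : closed_ball x0 (e / 2) `<=` cmap c @` cdom c.
  apply: subset_trans eK; apply: closed_ball_subset => //.
  by rewrite ltr_pdivrMr// ltr_pMr// ltr1n.
(* Dividing by the value of the bump at its centre makes the field equal to xi there. *)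
pose b := bump_fun x0 (e / 2) x0.
have b0 : b != 0 by rewrite gt_eqF// bump_gt0.
exists (bump_field c x0 (e / 2) (b^-1 *: xi)); split.
  split=> [u|d]; first exact: bump_field_tangent.
  exact: bump_field_smooth.
rewrite /bump_field asboolT// scalerA -/x0 -/b mulfV// scale1r.
by [].
Qed.

End Extension.

(** * Nonlinear connections as graphs *)

Section Graphs.
Context {R : realType} {n : nat} {M : smoothManifold R n}.
Implicit Types (c d : mchart M) (u : jet2 M) (xi eta : 'M[R]_(3, n)).
Implicit Types (a b : 'rV[R]_n) (K : 'M[R]_n) (v w : tvector M).

Lemma row0_hor K1 K2 a : row 0 (hor K1 K2 a) = a.
Proof. exact: row0_mx3. Qed.

Lemma hor_linear K1 K2 : linear (hor K1 K2 : 'rV[R]_n -> 'M[R]_(3, n)).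
Proof.
move=> k a b; have rowP l (x y : 'M[R]_(3, n)) :
    row l (k *: x + y) = k *: row l x + row l y by exact: linearP.
rewrite /hor; apply: row3P; rewrite rowP !row_mx3 //.
  by rewrite mulmxDl -scalemxAl.
by rewrite mulmxDl -scalemxAl.
Qed.

HB.instance Definition _ K1 K2 :=
  GRing.isLinear.Build R 'rV[R]_n 'M[R]_(3, n) _ (hor K1 K2) (hor_linear K1 K2).

Lemma hor_basis K1 K2 a :
  hor K1 K2 a = \sum_i a 0 i *: hor K1 K2 (delta_mx 0 i).
Proof.
rewrite {1}(row_sum_delta a) linear_sum.
by apply: eq_bigr => i _; rewrite linearZ.
Qed.

Definition hor_frame K1 K2 := [seq hor K1 K2 (delta_mx 0 i) | i : 'I_n].

Lemma span_hor K1 K2 xi :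
  (xi \in <<hor_frame K1 K2>>%VS) <->
  xi = hor K1 K2 (row 0 xi).
Proof.
split=> [|->]; last first.
  rewrite hor_basis; apply: memv_suml => i _; apply: memvZ; apply: memv_span.
  by apply/mapP; exists i; rewrite // mem_enum.
(* The graph is the kernel V of the identity minus [hor K1 K2] after [row 0], a subspace; it
   contains the frame and therefore its span. *)
pose f := linfun (row 0 : 'M[R]_(3, n) -> 'rV[R]_n).
pose h := linfun (hor K1 K2).
pose V := lker (\1 - (h \o f))%VF.
have VP eta : (eta \in V) = (eta == hor K1 K2 (row 0 eta)).
  by rewrite memv_ker !lfun_simp /= subr_eq0.
have /subvP sV : (<<hor_frame K1 K2>> <= V)%VS.
  apply/span_subvP => _ /mapP[i _ ->].
  by rewrite VP row0_hor.
by move=> /sV; rewrite VP => /eqP.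
Qed.

Lemma free_hor K1 K2 : free (hor_frame K1 K2).
Proof.
pose X := [tuple hor K1 K2 (delta_mx 0 i) | i < n].
suff : free X by [].
apply/freeP => k kX i.
have : row 0 (\sum_(i < n) k i *: X`_i) 0 i = 0 by rewrite kX linear0 mxE.
rewrite (_ : \sum_(i < n) k i *: X`_i = hor K1 K2 (\row_i k i)).
  by rewrite row0_hor mxE.
rewrite hor_basis; apply: eq_bigr => j _.
by rewrite mxE -tnth_nth tnth_mktuple.
Qed.

Variable N : jet2 M -> set (tvector M).

Definition graph_at c u K1 K2 := forall v, tangent u v ->
  (N u v <-> v c = hor K1 K2 (row 0 (v c))).

Lemma local_coefficients_graph c u (N1 N2 : 'M[R]_n) :
  local_coefficients N c u N1 N2 <-> graph_at c u (- N1^T) (- N2^T).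
Proof.
have E : [seq delta_x N1 N2 i | i : 'I_n] =
         hor_frame (- N1^T) (- N2^T).
  by apply: eq_map => i; exact: delta_x_hor.
by rewrite /local_coefficients E; split=> H v tv; rewrite H// span_hor.
Qed.

Lemma V1_row0 c u v : V1 u v -> row 0 (v c) = 0.
Proof. by move=> [w _ <-]; rewrite /J JmxE row0_mx3. Qed.

Lemma row0_V1 c u v : tdom c u -> tangent u v -> row 0 (v c) = 0 -> V1 u v.
Proof.
move=> cu tv v0; exists (mktangent c u (mx3 (row 1 (v c)) (row 2 (v c)) 0)).
  exact: mktangentP.
apply: (tangent_eq cu) => //; first exact/tangentJ/mktangentP.
rewrite /J mktangent_self// JmxE !row_mx3.
by apply: row3P; rewrite row_mx3.
Qed.

Hypothesis Ntan : forall u, N u `<=` tangent u.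

Section AtPoint.
Variables (c : mchart M) (u : jet2 M) (K1 K2 : 'M[R]_n).
Hypotheses (cu : tdom c u) (NK : graph_at c u K1 K2).

Lemma mktangent_hor a : N u (mktangent c u (hor K1 K2 a)).
Proof.
by apply/NK; [exact: mktangentP|rewrite mktangent_self// row0_hor].
Qed.

Lemma graph_decomposition v : tangent u v ->
  exists! p : tvector M * tvector M, [/\ N u p.1, V1 u p.2 & v = p.1 + p.2].
Proof.
move=> tv; pose p1 := mktangent c u (hor K1 K2 (row 0 (v c))).
have t1 : tangent u p1 by exact: mktangentP.
have p1E : p1 c = hor K1 K2 (row 0 (v c)) by exact: mktangent_self.
have vE w : v = w + (v - w) by rewrite addrC subrK.
exists (p1, v - p1); split.
  split; [exact: mktangent_hor| |exact: vE].
  have tvp : tangent u (v - p1).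
    by rewrite addrC -scaleN1r; exact: tangent_lin.
  apply: (row0_V1 cu tvp); rewrite !fctE linearB /= p1E.
  by rewrite row0_hor subrr.
move=> [q1 q2] /= [Nq1 Vq2 E].
have q1p1 : p1 = q1.
  apply: (tangent_eq cu) => //; first exact: Ntan.
  rewrite p1E [RHS](NK (Ntan Nq1)).1//.
  by rewrite E !fctE linearD /= (V1_row0 c Vq2) addr0.
by rewrite -q1p1 E -q1p1 addrC addKr.
Qed.

(** The system v = h + J w + J J t is triangular in the rows: row 0 gives h, row 1 gives w, and row
    2 gives what t has to supply. *)
Lemma adapted_componentsE v : tangent u v ->
  hproj N u v c = hor K1 K2 (row 0 (v c)) /\
  v1proj N u v c = Jmx (hor K1 K2 (row 1 (v c) - row 0 (v c) *m K1)).
Proof.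
move=> tv; pose a := row 0 (v c); pose b := row 1 (v c) - a *m K1.
pose e := row 2 (v c) - a *m K2 - b *m K1.
pose P p := [/\ N u p.1.1, N_1 N u p.1.2, V2 u p.2 & v = p.1.1 + p.1.2 + p.2].
have : P (mktangent c u (hor K1 K2 a), J (mktangent c u (hor K1 K2 b)),
          (J \o J) (mktangent c u (mx3 e 0 0))).
  split => /=; first exact: mktangent_hor.
  - by exists (mktangent c u (hor K1 K2 b)) => //; exact: mktangent_hor.
  - by exists (mktangent c u (mx3 e 0 0)) => //; exact: mktangentP.
  - apply: (tangent_eq cu) => //.
      have tD x y : tangent u x -> tangent u y -> tangent u (x + y).
        by move=> tx ty; rewrite -[x]scale1r; exact: tangent_lin.
      apply: (tD _ _); last by do 2!apply: tangentJ; exact: mktangentP.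
      apply: (tD _ _); first exact: mktangentP.
      by apply: tangentJ; exact: mktangentP.
    rewrite !fctE /J !mktangent_self// Jmx_hor !JmxE !row_mx3 /hor.
    apply: row3P; rewrite !linearD /= !row_mx3 ?addr0//.
      by rewrite /b addrC subrK.
    have AB (x y z : 'rV[R]_n) : x = y + z + (x - y - z).
      by apply/rowP => j; rewrite !mxE; ring.
    exact: AB.
(* The witness shows only that [xget] returns an admissible triple; what follows reads its first two
   components off rows 0 and 1. *)
move=> /(xgetI 0) [].
rewrite -/(adapted_components N u v) -/(hproj N u v) -/(v1proj N u v).
move: (hproj N u v) (v1proj N u v) (adapted_components N u v).2 => q0 q1 q2.
move=> Nh [w Nw Ew] [t tt Et] E.
have hE := (NK (Ntan Nh)).1 Nh.
have wE := (NK (Ntan Nw)).1 Nw.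
have E0 : row 0 (q0 c) = a.
  by rewrite /a E -Ew -Et !fctE /J !linearD /= !JmxE !row_mx3 !addr0.
split; first by rewrite hE E0.
rewrite -Ew /J wE; congr (Jmx (hor _ _ _)).
rewrite E -Ew -Et !fctE /J !linearD /= !JmxE !row_mx3 !addr0.
by rewrite hE /hor !row_mx3 addrC addKr.
Qed.

End AtPoint.

Hypothesis reg : regular_distribution N.

Lemma distribution_lin u k v w : N u v -> N u w -> N u (k *: v + w).
Proof.
move=> Nv Nw; have [_ [m H]] := reg.
have [c cu [U [oU Uu _]] [E _ frame]] := H u.
have [_ NE] := frame u cu Uu.
have tv := Ntan Nv; have tw := Ntan Nw.
apply/NE; first exact: tangent_lin.
by rewrite !fctE memvD ?memvZ//; apply/NE.
Qed.

Lemma distribution0 u : N u 0.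
Proof.
have [_ [m H]] := reg; have [c cu [U [oU Uu _]] [E _ frame]] := H u.
have [_ NE] := frame u cu Uu.
by apply/NE; [exact: tangent0|exact: mem0v].
Qed.

Hypothesis split1 : forall u v, tangent u v ->
  exists! p : tvector M * tvector M, [/\ N u p.1, V1 u p.2 & v = p.1 + p.2].

(** The N-components of the d/dx^i have the standard basis as their row 0, and rows 1 and 2 of these
    vectors form K1 and K2. Any v in N differs from their combination with the same row 0 by a
    vector in both N and V_1. *)
Lemma connection_graph c u : tdom c u -> exists K1 K2, graph_at c u K1 K2.
Proof.
move=> cu.
have H (i : 'I_n) : exists w, N u w /\ row 0 (w c) = delta_mx 0 i.
  have [[p1 p2] [[/= N1 V2 E] _]] := split1 (mktangentP (partial 0 i) cu).
  exists p1; split => //.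
  have := congr1 (fun x : tvector M => row 0 (x c)) E.
  rewrite !fctE linearD /= (V1_row0 c V2) addr0 mktangent_self// => <-.
  by rewrite row_partial.
have [w wP] := choice H.
pose K1 := \matrix_i row 1 (w i c); pose K2 := \matrix_i row 2 (w i c).
have wE i : w i c = hor K1 K2 (delta_mx 0 i).
  apply: row3P; rewrite /hor row_mx3; first by case: (wP i).
    by rewrite -rowE rowK.
  by rewrite -rowE rowK.
pose del a := \sum_i a 0 i *: w i.
have Ndel a : N u (del a).
  rewrite /del; elim/big_rec: _ => [|i x _ Nx]; first exact: distribution0.
  by apply: distribution_lin => //; case: (wP i).
have delE a : del a c = hor K1 K2 a.
  rewrite hor_basis /del fct_sumE; apply: eq_bigr => i _.
  by rewrite !fctE wE.
exists K1, K2 => v tv; split=> [Nv|E]; last first.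
  rewrite (tangent_eq cu tv (Ntan (Ndel (row 0 (v c)))))//.
  by rewrite delE.
pose x := v - del (row 0 (v c)).
have Nx : N u x by rewrite /x addrC -scaleN1r; exact: distribution_lin.
have tx := Ntan Nx.
have Vx : V1 u x.
  by apply: (row0_V1 cu tx); rewrite /x !fctE linearB /= delE row0_hor subrr.
have V0 : V1 u 0.
  by exists 0; [exact: tangent0|apply/funext => d; rewrite /J JmxE !linear0;
    apply: row3P; rewrite row_mx3 linear0].
(* x lies in N and in V_1, so (x, 0) and (0, x) both decompose it; uniqueness forces x = 0. *)
have [p [_ pU]] := split1 tx.
have e1 : p = (x, 0) by apply: pU; split; rewrite //= addr0.
have e2 : p = (0, x) by apply: pU; split; rewrite //= ?add0r//; exact: distribution0.
have x0 : x = 0 by move: e1; rewrite e2 => -[].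
by rewrite -delE -[LHS](subrK (del (row 0 (v c)) c)) -[v c - _]/(x c) x0 add0r.
Qed.

End Graphs.

(** * The local solutions as one global connection, and its uniqueness *)

Section Main.
Context {R : realType} {n : nat} {M : smoothManifold R n}.
Variables (L : jet2 M -> R) (S : jet2 M -> tvector M).
Hypotheses (rL : regular_lagrangian L) (spray : semispray S).
Implicit Types (c d : mchart M) (u : jet2 M) (N : jet2 M -> set (tvector M)).

(** Quantifying over all charts at u avoids choosing one; [solution_graph] shows that the equation
    in a single chart implies all the others. *)
Definition solution u : set (tvector M) := [set v | tangent u v /\
  forall c, tdom c u -> v c =
    hor (K1of L S c (tcoord c u)) (K2of L S c (tcoord c u)) (row 0 (v c))].

Lemma solution_tangent u : solution u `<=` tangent u.
Proof. by move=> v []. Qed.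

Lemma solution_graph c u : tdom c u ->
  graph_at solution c u (K1of L S c (tcoord c u)) (K2of L S c (tcoord c u)).
Proof.
move=> cu v tv; split=> [[_]|E]; first exact.
split; first exact: tv.
move=> d du; have H := jetmx_hor_trans rL spray cu du (row 0 (v c)).
have Ev := eq_trans (tangent_push tv cu du) (eq_trans (congr1 (push c d u) E) H).
have Er := eq_trans (congr1 (row 0) Ev) (row0_hor _ _ _).
exact: (eq_trans Ev (congr1 (hor _ _) (esym Er))).
Qed.

Lemma solution_connection : nonlinear_connection solution.
Proof.
split; last first.
  move=> u v tv; have [c cu] := tdom_exists u.
  exact: (graph_decomposition solution_tangent cu (solution_graph cu) tv).
split; first exact: solution_tangent.
exists n => u0; have [c cu0] := tdom_exists u0; exists c => //.
exists (timg c); first by split=> //; [exact: timg_open|exists u0].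
exists (fun i z => hor (K1of L S c z) (K2of L S c z) (delta_mx 0 i)).
  move=> i; have [s1 s2] := smooth_Kof rL spray c.
  have oc := @timg_open _ _ _ c.
  have sc : smooth_on (timg c) (cst (delta_mx 0 i : 'rV[R]_n)).
    by move=> k; exact: Ck_on_cst.
  apply: smooth_mx3 => //.
    exact: (smooth_mulmx oc sc s1).
  exact: (smooth_mulmx oc sc s2).
move=> u cu _ /=; split; first exact: free_hor.
by move=> v tv; rewrite (solution_graph cu tv) span_hor.
Qed.

Lemma graph_uniq N c u (K1 K2 K1' K2' : 'M[R]_n) : tdom c u ->
  graph_at N c u K1 K2 -> graph_at N c u K1' K2' -> K1 = K1' /\ K2 = K2'.
Proof.
move=> cu H H'.
have E (a : 'rV[R]_n) : hor K1 K2 a = hor K1' K2' a.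
  have t := mktangentP (hor K1 K2 a) cu.
  have := (H' _ t).1 (mktangent_hor cu H a).
  by rewrite mktangent_self// row0_hor.
split; apply/row_matrixP => i; rewrite !rowE.
  by have := congr1 (row 1) (E (delta_mx 0 i)); rewrite /hor !row_mx3.
by have := congr1 (row 2) (E (delta_mx 0 i)); rewrite /hor !row_mx3.
Qed.

(** The components of nabla^2 g give g^c on basis vectors only; bilinearity extends the vanishing to
    all horizontal vectors. *)
Lemma gc_hor_eq0 c (z : 'M[R]_(3, n)) (K1 K2 : 'M[R]_n) : timg c z ->
  (forall i j, gc L S c z (hor K1 K2 (delta_mx 0 i)) (hor K1 K2 (delta_mx 0 j)) = 0) ->
  forall a b, gc L S c z (hor K1 K2 a) (hor K1 K2 b) = 0.
Proof.
move=> zc H a b; have Gs := metric_tensor_sym rL.1 zc.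
have F a' b' : gc L S c z (hor K1 K2 a') (hor K1 K2 b') = _ :=
  eq_trans (gcE rL spray _ _ zc)
    (@gcm_horh _ _ _ (SG L S c z) (2^-1 *: SSG L S c z) K1 K2 a' b' Gs).
rewrite F; apply: (dot_eq0 _).2; apply/matrixP => i j.
have := H i j; rewrite F -rowE dotE (bigD1 j)//= big1 ?addr0; last first.
  by move=> k kj; rewrite [delta_mx _ _ _ _]mxE (negbTE kj) andbF mulr0.
by rewrite [row i _ 0 j]mxE [delta_mx _ _ _ _]mxE !eqxx mulr1 => ->; rewrite mxE.
Qed.

Lemma solution_conditions : compatible_hv1 solution L S /\
  (metric_parallel solution L S /\ horizontally_closed solution L).
Proof.
have C c u : tdom c u -> compatible L S c (tcoord c u)
    (K1of L S c (tcoord c u)) (K2of L S c (tcoord c u)).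
  by move=> cu; apply/(compatible_uniq rL spray); [exists u|].
have AE c u v (cu : tdom c u) (tv : tangent u v) :=
  adapted_componentsE solution_tangent cu (solution_graph cu) tv.
split; [|split].
- move=> X Y [tX _] [tY _] c u cu; have [C1 _ _] := C c u cu.
  have [hX _] := AE c u (X u) cu (tX u).
  have [_ hY] := AE c u (Y u) cu (tY u).
  by rewrite hX hY C1.
- move=> c u cu N1 N2 /local_coefficients_graph G i j.
  have zc : timg c (tcoord c u) by exists u.
  have [E1 E2] := graph_uniq cu G (solution_graph cu).
  have [_ C2 _] := C c u cu.
  by rewrite (nabla2gE rL spray) // !delta_x_hor E1 E2 C2 mulr0.
- move=> X Y [tX _] [tY _] c u cu; have [_ _ C3] := C c u cu.
  have [hX _] := AE c u (X u) cu (tX u).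
  have [hY _] := AE c u (Y u) cu (tY u).
  by rewrite hX hY C3.
Qed.

Lemma solution_uniq N : nonlinear_connection N -> compatible_hv1 N L S ->
  metric_parallel N L S -> horizontally_closed N L -> solution = N.
Proof.
move=> [reg split1] H1 H2 H3; have Nt : forall u, N u `<=` tangent u := reg.1.
apply/funext => u; have [c cu] := tdom_exists u.
have [K1 [K2 G]] := connection_graph Nt reg split1 cu.
have zc : timg c (tcoord c u) by exists u.
have AE v (tv : tangent u v) := adapted_componentsE Nt cu G tv.
have [E1 E2] : K1 = K1of L S c (tcoord c u) /\ K2 = K2of L S c (tcoord c u).
  apply/(compatible_uniq rL spray _ _ zc); split.
  - move=> a b.
    have [X [vX EX]] := tangent_extension (hor K1 K2 a) cu.
    (* This vector has rows 0 and 1 equal to 0 and b, so it is its own v_1-component. *)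
    have [Y [vY EY]] := tangent_extension (Jmx (hor K1 K2 b)) cu.
    have [hX _] := AE _ (vX.1 u); have [_ hY] := AE _ (vY.1 u).
    have := H1 X Y vX vY c u cu; rewrite hX hY EX EY !mktangent_self//.
    have J0 : row 0 (Jmx (hor K1 K2 b)) = 0 by rewrite Jmx_hor row0_mx3.
    have J1 : row 1 (Jmx (hor K1 K2 b)) = b by rewrite Jmx_hor row1_mx3.
    by rewrite J0 J1 mul0mx subr0 row0_hor.
  - apply: gc_hor_eq0 => // i j.
    have lc : local_coefficients N c u (- K1^T) (- K2^T).
      by apply/local_coefficients_graph; rewrite !linearN /= !trmxK !opprK.
    have := H2 c u cu _ _ lc i j; rewrite (nabla2gE rL spray)//.
    rewrite !delta_x_hor !linearN /= !trmxK !opprK => /eqP.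
    by rewrite mulf_eq0 pnatr_eq0 /= => /eqP.
  - move=> a b.
    have [X [vX EX]] := tangent_extension (hor K1 K2 a) cu.
    have [Y [vY EY]] := tangent_extension (hor K1 K2 b) cu.
    have [hX _] := AE _ (vX.1 u); have [hY _] := AE _ (vY.1 u).
    have := H3 X Y vX vY c u cu.
    rewrite hX hY EX EY !(mktangent_self _ cu) !row0_hor; exact.
apply/seteqP; split=> v.
  move=> Sv; have tv := solution_tangent Sv; apply/(G v tv).
  by rewrite E1 E2; exact: (solution_graph cu tv).1.
move=> Nv; have tv := Nt u v Nv; apply/(solution_graph cu tv).
by rewrite -E1 -E2; exact: (G v tv).1.
Qed.

End Main.

Theorem theorem5p1 (R : realType) (n : nat) (M : smoothManifold R n)
    (L : jet2 M -> R) (S : jet2 M -> tvector M) :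
  regular_lagrangian L -> associated_semispray L S ->
  exists! N : jet2 M -> set (tvector M),
    nonlinear_connection N /\
    compatible_hv1 N L S /\
    (metric_parallel N L S /\ horizontally_closed N L).
Proof.
move=> rL [spray _]; exists (solution L S); split.
  split; first exact: solution_connection.
  exact: solution_conditions.
by move=> N [cN [H1 [H2 H3]]]; exact: solution_uniq.
Qed.
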